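(* Let $n\ge 2$. The following hold. (i) If $K\subseteq\mathbb R^n$ is compact, then $C_{BV,d}(K)=C_{BV,d}(\partial K)$. (ii) If $K\subseteq\mathbb R^n$ is compact, $x_0\in\mathbb R^n$, $r\in(0,\infty)$ and $\{x_0\}+rK=\{x_0+rx: x\in K\}$, then $C_{BV,d}(\{x_0\}+rK)=r^{n-1}C_{BV,d}(K)$. (iii) For each compact $K\subset\mathbb R^n$, each $\Phi\in SL(n)$ and each $x\in\mathbb R^n$, $C_{BV,d}(K)=C_{BV,d}(\Phi K+x)$. (iv) If $K_1,K_2\subset\mathbb R^n$ are compact with $K_1\subseteq K_2$, then $C_{BV,d}(K_1)\le C_{BV,d}(K_2)$. (v) If $\{K_j\}_{j=1}^\infty$ is a sequence of compact subsets of $\mathbb R^n$ with $K_{j+1}\subseteq K_j$ for $j=1,2,3,\dots$, then $C_{BV,d}\big(\bigcap_{j=1}^\infty K_j\big)=\lim_{j\to\infty}C_{BV,d}(K_j)$. (vi) For each compact $K\subset\mathbb R^n$ and each $\epsilon>0$ there is an open set $O\supset K$ such that for every compact $F\subset\mathbb R^n$ with $O\supset F\supset K$ one has $C_{BV,d}(F)\le C_{BV,d}(K)+\epsilon$. (vii) There are two compact sets $E$ and $F$ in $\mathbb R^2$ such that $C_{BV,d}(E\cup F)\ge C_{BV,d}(E)+C_{BV,d}(F)$. (viii) $C_{BV,d}(\mathbb B^n)=2\omega_{n-1}$ and $C_{BV,d}(\mathbb B^n\cap\mathbb R^{n-1})=0$.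
   Context: $\mathbb B^n$ is the Euclidean unit ball of $\mathbb R^n$, $\omega_k$ is the volume of the unit ball of $\mathbb R^k$, and $\mathbb R^{n-1}$ is identified with the hyperplane $\mathbb R^{n-1}\times\{0\}\subset\mathbb R^n$. $du$ is the standard surface area measure on the unit sphere $\mathbb S^{n-1}$ (total mass $n\omega_n$). $BV(\mathbb R^n)$ is the space of $f\in L^1(\mathbb R^n)$ whose distributional derivative $Df$ is a finite $\mathbb R^n$-valued Radon measure; $|Df|$ is its variation measure and $\sigma_f=dDf/d|Df|$ the Radon–Nikodym derivative. For $f\in BV(\mathbb R^n)$, $$\|f\|_{BV,d(\mathbb R^n)}=\left(\int_{\mathbb S^{n-1}}\Big(\int_{\mathbb R^n}|u\cdot\sigma_f|\,d|Df|\Big)^{-n}\frac{du}{n\omega_n}\right)^{-\frac1n},$$ with conventions $0^{-n}=\infty$, $\infty^{-1/n}=0$. For $E\subset\mathbb R^n$, the affine BV-capacity is $$C_{BV,d}(E)=\inf\{\|f\|_{BV,d(\mathbb R^n)}:\ f\in BV(\mathbb R^n),\ f\ge 1\text{ on a neighbourhood of }E\}$$ (in (vii) this is taken with $n=2$). *)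

(* Defs.v *)
From HB Require Import structures.
From mathcomp Require Import all_boot all_order all_algebra.
From mathcomp Require Import all_classical all_reals all_analysis.
From mathcomp Require Import measurable_realfun ring.

Set Implicit Arguments.
Unset Strict Implicit.
Unset Printing Implicit Defensive.

Import Order.TTheory GRing.Theory Num.Theory.
Import numFieldNormedType.Exports.
Local Open Scope classical_set_scope.
Local Open Scope ring_scope.


Section borel_mx.
Context {R : realType} {m n : nat}.

Let borel0 : <<s @open 'M[R]_(m, n) >> set0.
Proof. exact: sigma_algebra0. Qed.
Let borelC A : <<s @open 'M[R]_(m, n) >> A -> <<s @open 'M[R]_(m, n) >> (~` A).
Proof. exact: sigma_algebraC. Qed.
Let borel_bigcup (F : (set 'M[R]_(m, n))^nat) :
  (forall i, <<s open >> (F i)) -> <<s open >> (\bigcup_i F i).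
Proof. exact: sigma_algebra_bigcup. Qed.

(* Borel sigma-algebra. *)
HB.instance Definition _ :=
  @isMeasurable.Build (sigma_display (@open 'M[R]_(m, n))) 'M[R]_(m, n)
    <<s open >> borel0 borelC borel_bigcup.
End borel_mx.

Section borel_mx_lemmas.
Context {R : realType} {m n : nat}.

Lemma open_measurable_mx (A : set 'M[R]_(m, n)) : open A -> measurable A.
Proof. exact: sub_sigma_algebra. Qed.

Lemma measurable_coord (i : 'I_m) (j : 'I_n) :
  measurable_fun setT (fun M : 'M[R]_(m, n) => M i j).
Proof.
apply: (measurability _ (RGenOpens.measurableE R)).
move=> _ [_ [a [b ->] <-]]; apply: open_measurable_mx; rewrite setTI.
apply: open_comp; last exact: interval_open.
by move=> M _; exact: coord_continuous.
Qed.

Lemma measurable_fun_mx d (T : measurableType d) (f : T -> 'M[R]_(m, n)) :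
  (forall i j, measurable_fun setT (fun x => f x i j)) ->
  measurable_fun setT f.
Proof.
move=> mf; apply: (measurability (@open 'M[R]_(m, n))) => //.
move=> _ [U oU <-]; rewrite setTI.
pose q (M : 'M[rat]_(m, n)) : 'M[R]_(m, n) := map_mx ratr M.
pose P (p : 'M[rat]_(m, n) * nat) := ball (q p.1) p.2.+1%:R^-1 `<=` U.
have -> : U = \bigcup_(p in P) ball (q p.1) p.2.+1%:R^-1.
  apply/seteqP; split => [M UM|M [p]]; last exact.
  have : nbhs M U by exact: open_nbhs_nbhs.
  move=> /nbhs_ballP[e /= e0 eU].
  pose k := Num.truncn (2 / e).
  have k0 : (0 : R) < k.+1%:R^-1 by rewrite invr_gt0.
  have ke : k.+1%:R^-1 < e / 2.
    rewrite -[e / 2]invrK ltf_pV2 ?posrE ?invr_gt0 ?divr_gt0//.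
    by rewrite invf_div truncnS_gt.
  have ex (i : 'I_m) (j : 'I_n) :
      exists r : rat, `|M i j - ratr r| < k.+1%:R^-1.
    have [r] : exists r : rat, ratr r \in `](M i j), (M i j + k.+1%:R^-1)[.
      by apply: rat_in_itvoo; rewrite ltrDl.
    rewrite in_itv/= => /andP[Mr rM]; exists r.
    by rewrite distrC ger0_norm ?subr_ge0 1?ltW// ltrBlDl.
  pose r : 'M[rat]_(m, n) := \matrix_(i, j) sval (cid (ex i j)).
  have rP i j : `|M i j - ratr (r i j)| < k.+1%:R^-1.
    by rewrite mxE; case: cid.
  have Mr : ball (q r) k.+1%:R^-1 M.
    by split => // i j; rewrite /ball/= mxE distrC.
  exists (r, k) => //= N /= Nr.
  apply: eU; rewrite (splitr e); apply: (@ball_triangle _ _ (q r)).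
    by apply: ball_sym; exact: (le_ball (ltW ke)).
  exact: (le_ball (ltW ke)).
rewrite preimage_bigcup bigcup_mkcond.
apply: countable_bigcupT_measurable => //.
move=> p; case: ifPn => // _.
have -> : f @^-1` ball (q p.1) p.2.+1%:R^-1 =
    \bigcap_(i in [set: 'I_m]) \bigcap_(j in [set: 'I_n])
      ((fun x => f x i j) @^-1` ball (q p.1 i j) p.2.+1%:R^-1).
  apply/seteqP; split => x /=; first by move=> [_ fx] i _ j _; exact: fx.
  by move=> fx; split => [|i j]; [rewrite invr_gt0|exact: fx].
apply: fin_bigcap_measurable => // i _; apply: fin_bigcap_measurable => // j _.
rewrite -[X in measurable X]setTI; apply: mf => //.
apply: measurable_ball.
Qed.


End borel_mx_lemmas.

Section lebesgue_rV.
Context {R : realType}.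

Definition rV_cons {n} (p : measurableTypeR R * 'rV[R]_n) : 'rV[R]_n.+1 :=
  row_mx (p.1 : R)%:M p.2.

Lemma measurable_rV_cons n : measurable_fun setT (@rV_cons n).
Proof.
apply: measurable_fun_mx => i j.
case: (split_ordP (j : 'I_(1 + n))) => k ->.
  rewrite (_ : (fun x => _) = fst); first exact: measurable_fst.
  by apply/funext => x; apply: etrans (row_mxEl _ _ _ _) _; rewrite mxE !ord1.
rewrite (_ : (fun x => _) = (fun M : 'rV[R]_n => M i k) \o snd).
  by apply: measurableT_comp; [exact: measurable_coord|exact: measurable_snd].
by apply/funext => x; exact: row_mxEr.
Qed.

Section lebesgue_cons.
Context n (mu : {sigma_finite_measure set 'rV[R]_n -> \bar R}).

Definition lebesgue_cons : set 'rV[R]_n.+1 -> \bar R :=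
  pushforward (lebesgue_measure \x mu)%E (@rV_cons n).

Let mcons := @measurable_rV_cons n.
Let lebesgue_cons0 : lebesgue_cons set0 = 0%E.
Proof. exact: measure0. Qed.
Let lebesgue_cons_ge0 A : (0 <= lebesgue_cons A)%E.
Proof. exact: measure_ge0. Qed.
Let lebesgue_cons_sigma_additive : semi_sigma_additive lebesgue_cons.
Proof. exact: measure_semi_sigma_additive. Qed.

HB.instance Definition _ := isMeasure.Build _ _ _ lebesgue_cons
  lebesgue_cons0 lebesgue_cons_ge0 lebesgue_cons_sigma_additive.

Let lebesgue_cons_sigma_finite : sigma_finite setT lebesgue_cons.
Proof.
have /sigma_finiteP[A [AT ndA mA]] := sigma_finiteT (@lebesgue_measure R).
have /sigma_finiteP[B [BT ndB mB]] := sigma_finiteT mu.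
pose G (x : 'rV[R]_n.+1) : measurableTypeR R * 'rV[R]_n :=
  (x ord0 ord0, \row_i x ord0 (lift ord0 i)).
have consK : cancel (@rV_cons n) G.
  move=> [a x]; rewrite /G /rV_cons /=; congr pair.
    have E : ord0 = lshift n ord0 :> 'I_(1 + n) by exact/val_inj.
    apply: etrans (congr1 (row_mx (a : R)%:M x ord0) E) _.
    by apply: etrans (row_mxEl _ _ _ _) _; rewrite mxE.
  by apply/rowP => i; rewrite mxE -rshift1; exact: row_mxEr.
have mG : measurable_fun setT G.
  apply/measurable_fun_pairP; split; first exact: measurable_coord.
  apply: measurable_fun_mx => i j.
  rewrite (_ : (fun x => _) = (fun x : 'rV[R]_n.+1 => x ord0 (lift ord0 j))).
    exact: measurable_coord.
  by apply/funext => x; rewrite mxE.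
exists (fun k => G @^-1` (A k `*` B k)).
  apply/esym; rewrite -subTset => x _.
  have : setT (G x).1 by []; rewrite AT => -[k _ Ak].
  have : setT (G x).2 by []; rewrite BT => -[l _ Bl].
  exists (maxn k l) => //; split.
    by move: Ak; exact/subsetPset/ndA/leq_maxl.
  by move: Bl; exact/subsetPset/ndB/leq_maxr.
move=> k; have [mAk Ak] := mA k; have [mBk Bk] := mB k; split.
  by rewrite -[X in measurable X]setTI; apply: mG => //; exact: measurableX.
rewrite /lebesgue_cons /pushforward -comp_preimage.
rewrite (_ : G \o _ = id); last exact/funext.
by rewrite product_measure1E// lte_mul_pinfty// ge0_fin_numE.
Qed.

HB.instance Definition _ := Measure_isSigmaFinite.Build _ _ _ lebesgue_cons
  lebesgue_cons_sigma_finite.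
End lebesgue_cons.

(* Lebesgue measure on R^n as the n-fold product of Lebesgue measure on R; see
   lebesgue_rV_box for its value on boxes. *)
Fixpoint lebesgue_rV n : {sigma_finite_measure set 'rV[R]_n -> \bar R} :=
  if n is m.+1 then lebesgue_cons (lebesgue_rV m) else \d_(0 : 'rV[R]_0).
End lebesgue_rV.

Lemma lebesgue_rV_box {R : realType} n (A : 'I_n -> set R) :
  (forall i, measurable (A i)) ->
  lebesgue_rV n [set x | forall i, A i (x ord0 i)] =
  (\prod_(i < n) lebesgue_measure (A i))%E.
Proof.
elim: n A => [A _|n IH A mA].
  rewrite big_ord0 /= diracE mem_set//=; by case.
have mbox :
  measurable [set x : 'rV[R]_n | forall i, A (lift ord0 i) (x ord0 i)].
  rewrite (_ : mkset _ = \bigcap_(i in [set: 'I_n])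
      (fun x : 'rV[R]_n => x ord0 i) @^-1` A (lift ord0 i)).
    apply: fin_bigcap_measurable => // i _.
    by rewrite -[X in measurable X]setTI; apply: measurable_coord.
  by apply/seteqP; split=> x /= Ax i; [move=> _|]; exact: Ax.
rewrite big_ord_recl/= -IH// /lebesgue_cons /pushforward.
rewrite (_ : _ @^-1` _ = A ord0 `*`
    [set x : 'rV[R]_n | forall i, A (lift ord0 i) (x ord0 i)]).
  rewrite product_measure1E; [by []|exact: mA|exact: mbox].
have cons0 (p : measurableTypeR R * 'rV[R]_n) : rV_cons p ord0 ord0 = p.1.
  have E : ord0 = lshift n ord0 :> 'I_(1 + n) by exact/val_inj.
  apply: etrans (congr1 (row_mx (p.1 : R)%:M p.2 ord0) E) _.
  by apply: etrans (row_mxEl _ _ _ _) _; rewrite mxE.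
have consS (p : measurableTypeR R * 'rV[R]_n) i :
    rV_cons p ord0 (lift ord0 i) = p.2 ord0 i.
  by rewrite -rshift1; exact: row_mxEr.
apply/seteqP; split => [p /= Ap|p [/= Ap0 Ap] i].
  split => [|i] /=; first by rewrite -cons0.
  by rewrite -consS.
by case: (unliftP ord0 i) => [j ->|->]; rewrite ?cons0 ?consS.
Qed.

Section euclidean.
Context {R : realType} {n : nat}.
Implicit Types u v w : 'rV[R]_n.

Definition edot u v : R := \sum_i u ord0 i * v ord0 i.
Definition enorm u : R := Num.sqrt (edot u u).

Lemma edot_ge0 u : 0 <= edot u u.
Proof. by apply: sumr_ge0 => i _; rewrite -expr2 sqr_ge0. Qed.

Lemma enorm_ge0 u : 0 <= enorm u.
Proof. exact: sqrtr_ge0. Qed.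

Lemma enorm0 : enorm 0 = 0.
Proof. by rewrite /enorm /edot big1 ?sqrtr0// => i _; rewrite mxE mul0r. Qed.

Lemma edotC u v : edot u v = edot v u.
Proof. by apply: eq_bigr => i _; rewrite mulrC. Qed.

Lemma edotDl u v w : edot (u + v) w = edot u w + edot v w.
Proof. by rewrite -big_split; apply: eq_bigr => i _; rewrite mxE mulrDl. Qed.

Lemma edotZl a u w : edot (a *: u) w = a * edot u w.
Proof. by rewrite mulr_sumr; apply: eq_bigr => i _; rewrite mxE mulrA. Qed.

Lemma edot_le u v : edot u v <= enorm u * enorm v.
Proof.
rewrite -sqrtrM ?edot_ge0// (le_trans (ler_norm _))// -sqrtr_sqr ler_sqrt.
have := edot_ge0 (edot u u *: v + (- edot u v) *: u).
rewrite !(edotDl, edotZl) !(edotC _ (_ + _)) !(edotDl, edotZl) (edotC v u).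
have := edot_ge0 u; rewrite le_eqVlt => /predU1P[/esym uu0 _|].
  suff -> : edot u v = 0 by rewrite uu0 mul0r expr2 mul0r.
  rewrite /edot big1// => i _; move/eqP : uu0; rewrite psumr_eq0 => [|j _].
    move=> /allP/(_ i); rewrite mem_index_enum => /(_ isT).
    by rewrite mulf_eq0 orbb => /eqP ->; rewrite mul0r.
  by rewrite -expr2 sqr_ge0.
move=> uu0 h.
suff : 0 <= edot u u * (edot u u * edot v v - edot u v ^+ 2).
  by rewrite pmulr_rge0// subr_ge0.
by apply: le_trans h _; rewrite le_eqVlt; apply/orP; left; apply/eqP; ring.
by rewrite mulr_ge0 ?edot_ge0.
Qed.

Lemma enorm_le_sum u : enorm u <= \sum_i `|u ord0 i|.
Proof.
rewrite -[leRHS]ger0_norm ?sumr_ge0// -sqrtr_sqr ler_sqrt ?sqr_ge0//.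
rewrite /edot expr2 mulr_suml; apply: ler_sum => i _.
rewrite (le_trans (ler_norm _))// normrM ler_wpM2l//.
by rewrite (bigD1 i)//= lerDl sumr_ge0.
Qed.

Lemma measurable_enorm : measurable_fun setT enorm.
Proof.
apply: (@measurableT_comp _ _ _ _ _ _ (@Num.sqrt R)).
  by apply: continuous_measurable_fun; exact: sqrt_continuous.
by apply: measurable_sum => i; apply: measurable_funM; exact: measurable_coord.
Qed.

Definition unit_ball : set 'rV[R]_n := [set x | enorm x <= 1].
Definition unit_sphere : set 'rV[R]_n := [set x | enorm x = 1].
Definition punctured_ball : set 'rV[R]_n := [set x | 0 < enorm x <= 1].

Lemma measurable_punctured_ball : measurable punctured_ball.
Proof.
rewrite (_ : punctured_ball = enorm @^-1` `]0, 1]).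
  by rewrite -[X in measurable X]setTI; apply: measurable_enorm.
by apply/seteqP; split => x /=; rewrite in_itv.
Qed.

Definition radial_proj u : 'rV[R]_n := (enorm u)^-1 *: u.

Lemma measurable_radial_proj : measurable_fun setT radial_proj.
Proof.
apply: measurable_fun_mx => i j.
rewrite (_ : (fun x => _) = (fun u : 'rV[R]_n => enorm u `^ (-1) * u i j)).
  apply: measurable_funM; last exact: measurable_coord.
  exact: (measurableT_comp (measurable_powR _) measurable_enorm).
by apply/funext => u; rewrite mxE powR_inv1// enorm_ge0.
Qed.

(* Surface measure of the unit sphere, from polar coordinates:
   surface_measure A = n * lebesgue { t u | u in A, enorm u = 1, 0 < t <= 1 }. *)
Definition surface_measure : set 'rV[R]_n -> \bar R :=
  pushforward (mscale n%:R%:nng (mrestr (lebesgue_rV n)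
    measurable_punctured_ball)) radial_proj.

Let mradial := measurable_radial_proj.
Let surface_measure0 : surface_measure set0 = 0%E.
Proof. exact: measure0. Qed.
Let surface_measure_ge0 A : (0 <= surface_measure A)%E.
Proof. exact: measure_ge0. Qed.
Let surface_measure_sigma_additive : semi_sigma_additive surface_measure.
Proof. exact: measure_semi_sigma_additive. Qed.

HB.instance Definition _ := isMeasure.Build _ _ _ surface_measure
  surface_measure0 surface_measure_ge0 surface_measure_sigma_additive.

End euclidean.

Definition ball_volume (R : realType) k : \bar R := lebesgue_rV k unit_ball.


Section variation_measure_theory.
Local Open Scope ereal_scope.
Context d (T : measurableType d) {R : realType} {n : nat}.
Variable D : 'I_n -> {charge set T -> \bar R}.

Definition charge_vec (A : set T) : 'rV[R]_n := \row_i fine (D i A).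

(* The families (E k) are disjoint measurable subsets of A instead of partitions
   of A: the value is the same when A is measurable, and it is nonnegative for
   every A. *)
Definition variation_measure (A : set T) : \bar R :=
  ereal_sup [set \sum_(0 <= k <oo) (enorm (charge_vec (E k)))%:E
    | E in [set E : (set T)^nat | [/\ forall k, measurable (E k),
        trivIset setT E & \bigcup_k E k `<=` A]]].

Let vn A : \bar R := (enorm (charge_vec A))%:E.
Let vn_ge0 A : 0 <= vn A.
Proof. by rewrite lee_fin enorm_ge0. Qed.
Let vn0 : vn set0 = 0.
Proof.
rewrite /vn (_ : charge_vec _ = 0%R) ?enorm0//.
by apply/rowP => i; rewrite !mxE charge0.
Qed.

Let vn_sigma_subadd (F : (set T)^nat) : (forall k, measurable (F k)) ->
  trivIset setT F -> vn (\bigcup_k F k) <= \sum_(0 <= k <oo) vn (F k).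
Proof.
move=> mF tF; set U := \bigcup_k F k.
have [->|vnU] := eqVneq (vn U) 0; first exact: nneseries_ge0.
pose a := (enorm (charge_vec U))^-1%R.
pose u := (a *: charge_vec U)%R.
have a0 : (0 < enorm (charge_vec U))%R.
  rewrite lt_neqAle eq_sym enorm_ge0 andbT.
  by apply: contra vnU => /eqP h; rewrite /vn h.
have uE : edot u (charge_vec U) = enorm (charge_vec U).
  rewrite edotZl -[edot _ _]sqr_sqrtr ?edot_ge0// -/(enorm _) expr2 mulrA.
  by rewrite /a mulVf ?mul1r// gt_eqF.
have ule w : (edot u w <= enorm w)%R.
  rewrite edotZl ler_pdivrMl//; exact: edot_le.
have cv : (fun m => \sum_(0 <= k < m) edot u (charge_vec (F k)))%R @ \oo -->
    enorm (charge_vec U).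
  rewrite -uE.
  rewrite (_ : (fun m => _) = fun m =>
    (\sum_i u ord0 i * \sum_(0 <= k < m) fine (D i (F k)))%R); last first.
    apply/funext => m; rewrite exchange_big/=; apply: eq_bigr => i _.
    by rewrite mulr_sumr; apply: eq_bigr => k _; congr (_ * _)%R; rewrite mxE.
  apply: cvg_big => [|i _]; first exact: add_continuous.
  apply: cvgMr; rewrite mxE.
  have := @charge_semi_sigma_additive _ _ _ (D i) F mF tF
    (bigcupT_measurable _ mF).
  have DU : D i U \is a fin_num.
    by apply: fin_num_measure; exact: bigcupT_measurable.
  rewrite -/U -(fineK DU).
  move=> /fine_cvg.
  rewrite (_ : fine \o _ = fun m => (\sum_(0 <= k < m) fine (D i (F k)))%R)//.
  apply/funext => m /=; rewrite -sum_fine// => k _.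
  by rewrite fin_num_measure.
have cvE :
  (fun m => (\sum_(0 <= k < m) edot u (charge_vec (F k)))%:E) @ \oo --> vn U.
  by apply/fine_cvgP; split; [exact: nearW|].
have vnUE :
  limn (fun m => (\sum_(0 <= k < m) edot u (charge_vec (F k)))%:E) = vn U.
  exact/cvg_lim.
rewrite -[leLHS]vnUE; apply: lime_le; first by apply/cvg_ex; exists (vn U).
apply: nearW => m; apply: le_trans (nneseries_lim_ge m _) => //.
by rewrite -sumEFin lee_sum// => k _; rewrite lee_fin.
Qed.

Let V := variation_measure.

Lemma variation_measure_ge E A : (forall k, measurable (E k)) ->
  trivIset setT E -> \bigcup_k E k `<=` A ->
  \sum_(0 <= k <oo) (enorm (charge_vec (E k)))%:E <= V A.
Proof. by move=> mE tE EA; apply: ereal_sup_ubound; exists E. Qed.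

Let V_ge0 A : 0 <= V A.
Proof.
have h : \sum_(0 <= k <oo) vn set0 <= V A.
  apply: variation_measure_ge => //; last by move=> x [].
  by apply/trivIsetP => i j _ _ _; rewrite set0I.
by apply: le_trans h; exact: nneseries_ge0.
Qed.

Let V0 : V set0 = 0.
Proof.
apply/eqP; rewrite eq_le V_ge0 andbT; apply: ge_ereal_sup => _ [E [_ _ E0] <-].
rewrite eseries0// => k _ _; rewrite (_ : E k = set0); first exact: vn0.
by rewrite -subset0 => x Ekx; apply: E0; exists k.
Qed.

Let V_mono A B : A `<=` B -> V A <= V B.
Proof.
move=> AB; apply: ge_ereal_sup => _ [E [mE tE EA] <-].
by apply: variation_measure_ge => // x /EA /AB.
Qed.

Let V_super A B : A `&` B = set0 -> V A + V B <= V (A `|` B).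
Proof.
move=> AB0.
suff H E G : (forall k, measurable (E k)) -> trivIset setT E ->
    \bigcup_k E k `<=` A -> (forall k, measurable (G k)) -> trivIset setT G ->
    \bigcup_k G k `<=` B ->
    \sum_(0 <= k <oo) vn (E k) + \sum_(0 <= k <oo) vn (G k) <= V (A `|` B).
  have [VAB|VAB] := eqVneq (V (A `|` B)) +oo; first by rewrite VAB leey.
  have finV C : C `<=` A `|` B -> V C \is a fin_num.
    by move=> /V_mono VC; rewrite ge0_fin_numE// (le_lt_trans VC)// ltey.
  rewrite -leeBrDr ?finV//; apply: ge_ereal_sup => _ [E [mE tE EA] <-].
  rewrite leeBrDr ?finV// addeC.
  have Efin : \sum_(0 <= k <oo) vn (E k) \is a fin_num.
    rewrite ge0_fin_numE; last exact: nneseries_ge0.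
    apply: le_lt_trans (variation_measure_ge mE tE EA) _.
    by rewrite -ge0_fin_numE// finV.
  rewrite -leeBrDr//; apply: ge_ereal_sup => _ [G [mG tG GB] <-].
  by rewrite leeBrDr// addeC; exact: H.
move=> mE tE EA mG tG GB.
have H N :
  \sum_(0 <= k < N) vn (E k) + \sum_(0 <= k <oo) vn (G k) <= V (A `|` B).
  pose H k := if (k < N)%N then E k else G (k - N)%N.
  have -> : \sum_(0 <= k < N) vn (E k) + \sum_(0 <= k <oo) vn (G k) =
      \sum_(0 <= k <oo) vn (H k).
    rewrite [RHS](@nneseries_split _ _ 0 N)// add0n; congr (_ + _).
      by apply: eq_big_nat => k /andP[_ kN]; rewrite /H kN.
    rewrite -(@nneseries_addn _ (fun k => vn (H k)) N)//.
    apply: eq_eseriesr => k _.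
    by rewrite /H ltnNge leq_addl/= addnK.
  have EG i j : E i `&` G j = set0.
    rewrite -subset0 -AB0 => x [Ex Gx]; split; [apply: EA|apply: GB].
      by exists i.
    by exists j.
  apply: variation_measure_ge.
  - by move=> k; rewrite /H; case: ifPn.
  - apply/trivIsetP => i j _ _ ij; rewrite /H.
    case: ifPn => iN; case: ifPn => jN.
    + by move/trivIsetP : tE; exact.
    + exact: EG.
    + by rewrite setIC; exact: EG.
    + move/trivIsetP : tG; apply => //; apply: contra ij => /eqP ijN.
      rewrite -leqNgt in iN; rewrite -leqNgt in jN.
      by rewrite -(subnK iN) ijN subnK.
  - move=> x [k _]; rewrite /H.
    case: ifPn => _ Hx; [left; apply: EA|right; apply: GB].
      by exists k.
    by exists (k - N)%N.
have [VAB|VAB] := eqVneq (V (A `|` B)) +oo; first by rewrite VAB leey.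
have Gfin : \sum_(0 <= k <oo) vn (G k) \is a fin_num.
  rewrite ge0_fin_numE; last exact: nneseries_ge0.
  apply: le_lt_trans (variation_measure_ge mG tG GB) _.
  by apply: le_lt_trans (V_mono (@subsetUr _ A B)) _; rewrite ltey.
rewrite -leeBrDr//; apply: lime_le; first exact: is_cvg_nneseries.
by apply: nearW => N; rewrite leeBrDr.
Qed.

Let V_sigma_additive : semi_sigma_additive V.
Proof.
move=> F mF tF mU.
suff -> : V (\bigcup_k F k) = \sum_(0 <= k <oo) V (F k).
  exact: is_cvg_nneseries.
apply/eqP; rewrite eq_le; apply/andP; split.
  apply: ge_ereal_sup => _ [E [mE tE EF] <-].
  have EE j : E j = \bigcup_k (E j `&` F k).
    rewrite -setI_bigcupr; apply/esym/setIidl.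
    by move=> x Ex; apply: EF; exists j.
  apply: (@le_trans _ _ (\sum_(0 <= j <oo) \sum_(0 <= k <oo) vn (E j `&` F k))).
    apply: lee_nneseries => [j _ _|j _]; first exact: vn_ge0.
    rewrite [leLHS](_ : _ = vn (\bigcup_k (E j `&` F k))); last by rewrite -EE.
    apply: vn_sigma_subadd => [k|]; first exact: measurableI.
    exact: trivIset_setIl.
  rewrite nneseries_interchange//; apply: lee_nneseries => [k _ _|k _].
    exact: nneseries_ge0.
  apply: variation_measure_ge => [j||]; first exact: measurableI.
    exact: trivIset_setIr.
  by move=> x [j _ []].
apply: lime_le; first exact: is_cvg_nneseries.
apply: nearW => N.
apply: (@le_trans _ _ (V (\big[setU/set0]_(k < N) F k))); last first.
  by apply: V_mono; exact: bigsetU_bigcup.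
elim: N => [|N IH]; first by rewrite big_geq// big_ord0 V0.
rewrite big_nat_recr//= big_ord_recr/=.
apply: le_trans (V_super _); first by rewrite leeD2r.
rewrite big_distrl/= big1// => i _.
move/trivIsetP : tF => /(_ i N Logic.I Logic.I); apply.
by rewrite neq_ltn ltn_ord.
Qed.

HB.instance Definition _ := isMeasure.Build _ _ _ variation_measure
  V0 V_ge0 V_sigma_additive.

Let V_fin : fin_num_fun variation_measure.
Proof.
move=> A mA; rewrite ge0_fin_numE//.
pose P i := projT1 (cid (Hahn_decomposition (D i))).
pose N i := projT1 (cid (projT2 (cid (Hahn_decomposition (D i))))).
pose H i : hahn_decomposition (D i) (P i) (N i) :=
  projT2 (cid (projT2 (cid (Hahn_decomposition (D i))))).
apply: (@le_lt_trans _ _ (\sum_(i < n) charge_variation (H i) setT));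
  last first.
  by apply: lte_sum_pinfty => i _; rewrite -ge0_fin_numE// fin_num_measure.
apply: ge_ereal_sup => _ [E [mE tE _] <-].
apply: (@le_trans _ _
  (\sum_(0 <= k <oo) \sum_(i < n) charge_variation (H i) (E k))).
  apply: lee_nneseries => [k _ _|k _]; first exact: vn_ge0.
  apply: (@le_trans _ _ (\sum_(i < n) `|D i (E k)|)).
    rewrite (_ : \sum_(i < n) _ = (\sum_i `|charge_vec (E k) ord0 i|)%:E).
      by rewrite lee_fin enorm_le_sum.
    rewrite -sumEFin; apply: eq_bigr => i _.
    by rewrite mxE -[in LHS](@fineK _ (D i (E k))) ?fin_num_measure.
  by apply: lee_sum => i _; exact: abse_charge_variation.
rewrite nneseries_sum//; apply: lee_sum => i _.
have mUE : measurable (\bigcup_k E k) by exact: bigcupT_measurable.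
have /cvg_lim := @measure_semi_sigma_additive _ _ _ (charge_variation (H i))
  E mE tE mUE.
by move=> ->//; rewrite le_measure// inE.
Qed.

HB.instance Definition _ :=
  Measure_isFinite.Build _ _ _ variation_measure V_fin.
End variation_measure_theory.

Definition charge_integral d (T : measurableType d) (R : realType)
    (nu : {charge set T -> \bar R}) (g : T -> \bar R) : \bar R :=
  let: exist P hP := cid (Hahn_decomposition nu) in
  let: exist N nuPN := cid hP in
  (\int[jordan_pos nuPN]_x g x - \int[jordan_neg nuPN]_x g x)%E.

Section bounded_variation.
Context {R : realType} {n : nat}.
Implicit Types (f phi : 'rV[R]_n -> R) (E : set 'rV[R]_n).

Definition partial (i : 'I_n) phi : 'rV[R]_n -> R := 'D_(delta_mx ord0 i) phi.

Definition smooth phi := forall s : seq 'I_n,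
  let psi := foldr partial phi s in
  continuous psi /\ forall x i, derivable psi x (delta_mx ord0 i).

Definition test_function phi :=
  smooth phi /\ compact (closure [set x | phi x != 0]).

Definition is_distr_derivative f
    (D : 'I_n -> {charge set 'rV[R]_n -> \bar R}) :=
  forall phi i, test_function phi ->
    (\int[lebesgue_rV n]_x (f x * partial i phi x)%:E)%E =
    (- charge_integral (D i) (EFin \o phi))%E.

Definition BV_space : set ('rV[R]_n -> R) := [set f : 'rV[R]_n -> R |
  (lebesgue_rV n).-integrable setT (EFin \o f) /\
  exists D, is_distr_derivative f D].

(* The components of the derivative of f; a default value outside BV_space. *)
Definition distr_derivative f : 'I_n -> {charge set 'rV[R]_n -> \bar R} :=
  if pselect (exists D, is_distr_derivative f D) is left fD
  then sval (cid fD) else fun=> czero.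

Definition distr_variation f : {finite_measure set 'rV[R]_n -> \bar R} :=
  variation_measure (distr_derivative f).

Definition polar_density f (x : 'rV[R]_n) : 'rV[R]_n :=
  \row_i fine (Radon_Nikodym (distr_derivative f i) (distr_variation f) x).

Definition directional_variation f (u : 'rV[R]_n) : \bar R :=
  (\int[distr_variation f]_x `|edot u (polar_density f x)|%:E)%E.

(* In \bar R, 0^-1 = +oo and +oo^-1 = 0. *)
Definition affine_BV_norm f : \bar R :=
  (((\int[surface_measure]_(u in unit_sphere)
      ((directional_variation f u ^+ n)^-1 / (n%:R%:E * ball_volume R n)))
    `^ n%:R^-1)^-1)%E.

(* f ranges over Borel representatives, so that f >= 1 on a neighbourhood is
   required pointwise. *)
Definition affine_BV_capacity E : \bar R :=
  ereal_inf [set affine_BV_norm f | f in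
    [set f : 'rV[R]_n -> R | BV_space f /\ set_nbhs E [set x | 1 <= f x]]].

End bounded_variation.

Definition boundary (T : topologicalType) (A : set T) : set T :=
  closure A `\` interior A.

(* Main.v *)
(* Write m_u(f) for the integral of |u . sigma_f| against |Df|, so that the norm of f
   depends on the function u |-> m_u(f) only. The difference quotients of f satisfy
     \int |f(x + t u) - f(x)| dx <= t m_u(f)   for t > 0,
   and conversely m_u(f) <= C as soon as these integrals are at most t C for small t;
   so every comparison of norms reduces to a pointwise or integral comparison of
   differences. Membership in BV follows from a domination criterion: if
   phi |-> \int f d_i phi is bounded by \int |phi| dm for a finite measure m, then it
   is represented by a charge.
   (i) If f >= 1 near the boundary of K, then max(f, 1_K) is >= 1 near K, and for small
   shifts its differences are at most those of f: a segment leaving K crosses the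
   boundary, near which max(f, 1_K) = f.
   (ii), (iii) Under x |-> x A + a the variations transform by m_u(f(. A + a)) <=
   |det A|^-1 m_(uA)(f), and in polar coordinates the norm is a power of the volume of
   {u | m_u(f) < 1}, which is invariant under unimodular maps.
   (v) follows from (vi) by compactness, and (vi) from the definition. For (vii) the
   empty set does: by (ii) its capacity is 2 times itself, hence 0 or infinite.
   (viii) If f >= 1 on the unit ball, pairing f(x + t u) - f(x) with the sign of x . u
   over a cylinder of axis u and radius r < 1 gives m_u(f) >= 2 r^(n-1) omega_(n-1);
   for a radial plateau function the same pairing without the cylinder bounds m_u(f)
   from above. The disc lies in images of the ball of arbitrarily small capacity. *)
Require Import Defs.
From HB Require Import structures.
From mathcomp Require Import all_boot all_order all_algebra.
From mathcomp Require Import all_classical all_reals all_analysis.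
From mathcomp Require Import measurable_realfun ring lra.
Set Implicit Arguments.
Unset Strict Implicit.
Unset Printing Implicit Defensive.
Import Order.TTheory GRing.Theory Num.Theory.
Import numFieldNormedType.Exports.
Local Open Scope classical_set_scope.
Local Open Scope ring_scope.

(** * Linear changes of variables for Lebesgue measure *)

(** The derivative inside [affine_BV_norm] is obtained by choice, so the measures attached to f and
    to a transformed or truncated f are not directly comparable, whereas the difference integrals
    depend on f alone; [diff_quot_norm_le] and [dir_var_le] are the passage between the two. Since
    [dir_var_le] already supposes bounded variation, membership of each new competitor is shown
    separately, by domination. The representing charge is then found by extending a functional from
    test functions to Borel indicators, which rests on the density of test functions in a weighted
    L^1. The same density makes an L^1 norm a supremum of pairings, both for Lebesgue measure and
    for |Df|. The exponent n - 1 arises from a determinant s^-n and one factor s carried by the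
    direction. For the ball, both bounds come from one identity: shifting a sign pattern across a
    hyperplane leaves twice the indicator of a slab of thickness t. In the lower bound the slab has
    to fit into the unit ball, hence r < 1; in the upper bound the competitor has to be at least 1
    beyond the ball, hence b > 1; both radii then tend to 1. *)

Section lebesgue_affine.
Context {R : realType}.
Local Notation leb := (@lebesgue_measure R).

Lemma integral_lebesgue_translate (c : R) (h : R -> \bar R) :
  measurable_fun setT h -> (forall x, 0 <= h x)%E ->
  (\int[leb]_s h ((s : R) + c)%R = \int[leb]_s h s)%E.
Proof.
move=> mh h0.
have mphi : measurable_fun setT (fun s : measurableTypeR R => (s : R) + c : measurableTypeR R).
  by apply: measurable_funD => //; exact: measurable_cst.
rewrite [RHS](@eq_measure_integral _ _ _ _ (pushforward leb
  (fun s : measurableTypeR R => (s : R) + c : measurableTypeR R))).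
  rewrite ge0_integral_pushforward//=.
move=> A mA _; apply: lebesgue_measure_unique => //= _ [[a b]] _ <-.
rewrite /pushforward (_ : _ @^-1` _ = `](a - c), (b - c)]%classic); last first.
  by apply/seteqP; split => x /=; rewrite !in_itv/= ltrBlDr lerBrDr.
rewrite !lebesgue_measure_itv/= !lte_fin ltrD2r; case: ifPn => // _.
by rewrite -!EFinB; congr EFin; ring.
Qed.

Lemma integral_lebesgue_scale (a : R) (h : R -> \bar R) :
  a != 0 -> measurable_fun setT h -> (forall x, 0 <= h x)%E ->
  (\int[leb]_s h ((s : R) * a)%R = (`|a|^-1)%:E * \int[leb]_s h s)%E.
Proof.
move=> a0 mh h0.
have pos (b : R) (g : R -> \bar R) :
    0 < b -> measurable_fun setT g -> (forall x, 0 <= g x)%E ->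
    (\int[leb]_s g ((s : R) * b)%R = (b^-1)%:E * \int[leb]_s g s)%E.
  move=> b0 mg g0.
  have mphi : measurable_fun setT
      (fun s : measurableTypeR R => (s : R) * b : measurableTypeR R).
    by apply: measurable_funM => //; exact: measurable_cst.
  have bV0 : 0 <= b^-1 by rewrite invr_ge0 ltW.
  rewrite -(ge0_integral_mscale leb measurableT (NngNum bV0))//.
  have e : forall A, measurable A -> leb A = mscale (NngNum (ltW b0)) (pushforward leb
      (fun s : measurableTypeR R => (s : R) * b : measurableTypeR R)) A.
    move=> A; apply: lebesgue_measure_unique => _ [[x y]] _ <- /=.
    rewrite /mscale/= /pushforward.
    rewrite (_ : _ @^-1` _ = `](x / b), (y / b)]%classic); last first.
      by apply/seteqP; split => z /=; rewrite !in_itv/= ltr_pdivrMr// ler_pdivlMr.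
    rewrite !lebesgue_measure_itv/= !lte_fin ltr_pM2r ?invr_gt0//.
    case: ifPn => // _; last by rewrite mule0.
    by rewrite -!EFinB -EFinM; congr EFin; field; rewrite gt_eqF.
  rewrite [RHS](@eq_measure_integral _ _ _ _ (pushforward leb
      (fun s : measurableTypeR R => (s : R) * b : measurableTypeR R))).
    by rewrite ge0_integral_pushforward.
  move=> A mA _; transitivity ((b^-1)%:E * (b%:E * pushforward leb
      (fun s : measurableTypeR R => ((s : R) * b)%R : measurableTypeR R) A))%E.
    by congr (_ * _)%E; exact: e.
  by rewrite muleA -EFinM mulVf ?gt_eqF// mul1e.
(* Negative factors reduce to positive ones by the symmetry of Lebesgue measure under s |-> -s. *)
have [a_gt0|a_le0] := ltP 0 a; first by rewrite gtr0_norm// pos.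
have aN0 : 0 < - a by rewrite oppr_gt0 lt_neqAle a0.
have mN : measurable_fun setT (fun s : measurableTypeR R => - (s : R) : measurableTypeR R).
  exact: oppr_measurable.
have neg : (\int[leb]_s h (- (s : R))%R = \int[leb]_s h s)%E.
  rewrite [RHS](@eq_measure_integral _ _ _ _ (pushforward leb
      (fun s : measurableTypeR R => - (s : R) : measurableTypeR R))).
    by rewrite ge0_integral_pushforward.
  by move=> A mA _; rewrite /= lebesgue_measureN.
rewrite ler0_norm// -neg -(pos _ (fun s => h (- s)))//.
  by apply: eq_integral => s _; rewrite mulrN opprK.
by apply: measurableT_comp.
Qed.

End lebesgue_affine.

Section lebesgue_rV_theory.
Context {R : realType}.
Local Notation leb := (@lebesgue_measure R).
Local Notation lam := (@lebesgue_rV R).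

Lemma measurable_add_rV n (a : 'rV[R]_n) : measurable_fun setT (fun x : 'rV[R]_n => x + a).
Proof.
apply: measurable_fun_mx => i j.
rewrite (_ : (fun x => _) = fun x : 'rV[R]_n => x i j + a i j).
  by apply: measurable_funD; [exact: measurable_coord|exact: measurable_cst].
by apply/funext => x; rewrite mxE.
Qed.

Lemma measurable_mul_rV m n (A : 'M[R]_(m, n)) :
  measurable_fun setT (fun x : 'rV[R]_m => x *m A).
Proof.
apply: measurable_fun_mx => i j.
rewrite (_ : (fun x => _) = fun x : 'rV[R]_m => \sum_k x i k * A k j).
  apply: measurable_sum => k; apply: measurable_funM; last exact: measurable_cst.
  exact: measurable_coord.
by apply/funext => x; rewrite mxE.
Qed.

(** Tonelli is kept in both orders: with the tail innermost, the inner integral absorbs a shear of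
    the tail by the first coordinate; with the first coordinate innermost, it absorbs the transposed
    kind of shear. *)
Lemma integral_rV_consl n (h : 'rV[R]_n.+1 -> \bar R) :
  measurable_fun setT h -> (forall x, 0 <= h x)%E ->
  (\int[lam n.+1]_x h x = \int[leb]_s \int[lam n]_x h (rV_cons (s, x)))%E.
Proof.
move=> mh h0; rewrite /= /lebesgue_cons ge0_integral_pushforward//=; last first.
  exact: measurable_rV_cons.
rewrite fubini_tonelli1//.
by apply: measurableT_comp => //; exact: measurable_rV_cons.
Qed.

Lemma integral_rV_consr n (h : 'rV[R]_n.+1 -> \bar R) :
  measurable_fun setT h -> (forall x, 0 <= h x)%E ->
  (\int[lam n.+1]_x h x = \int[lam n]_x \int[leb]_s h (rV_cons (s, x)))%E.
Proof.
move=> mh h0; rewrite /= /lebesgue_cons ge0_integral_pushforward//=; last first.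
  exact: measurable_rV_cons.
rewrite fubini_tonelli2//.
by apply: measurableT_comp => //; exact: measurable_rV_cons.
Qed.

Lemma rV_cons0 n (p : measurableTypeR R * 'rV[R]_n) : rV_cons p ord0 ord0 = p.1.
Proof.
have E : ord0 = lshift n ord0 :> 'I_(1 + n) by exact/val_inj.
apply: etrans (congr1 (row_mx (p.1 : R)%:M p.2 ord0) E) _.
by apply: etrans (row_mxEl _ _ _ _) _; rewrite mxE.
Qed.

Lemma rV_consS n (p : measurableTypeR R * 'rV[R]_n) i :
  rV_cons p ord0 (lift ord0 i) = p.2 ord0 i.
Proof. by rewrite -rshift1; exact: row_mxEr. Qed.

Lemma rV_consE n (y : 'rV[R]_n.+1) :
  rV_cons (y ord0 ord0, \row_i y ord0 (lift ord0 i)) = y.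
Proof.
apply/rowP => j; case: (unliftP ord0 j) => [k ->|->].
  by rewrite rV_consS mxE.
by rewrite rV_cons0.
Qed.

Lemma rV_consD n (s t : R) (x y : 'rV[R]_n) :
  rV_cons (s, x) + rV_cons (t, y) = rV_cons (s + t, x + y).
Proof.
apply/rowP => i; rewrite mxE; case: (unliftP ord0 i) => [j ->|->].
  by rewrite !rV_consS mxE.
by rewrite !rV_cons0.
Qed.

Lemma measurable_comp_rV_cons n (h : 'rV[R]_n.+1 -> \bar R) :
  measurable_fun setT h -> measurable_fun setT (h \o @rV_cons R n).
Proof. by move=> mh; apply: measurableT_comp => //; exact: measurable_rV_cons. Qed.

Lemma measurable_pair_rV_cons n (h : 'rV[R]_n.+1 -> \bar R) s :
  measurable_fun setT h -> measurable_fun setT (fun x => h (rV_cons (s, x))).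
Proof.
move=> /measurable_comp_rV_cons mh.
exact: (measurableT_comp mh (measurable_pair1 (s : measurableTypeR R))).
Qed.

Lemma measurable_pairr_rV_cons n (h : 'rV[R]_n.+1 -> \bar R) x :
  measurable_fun setT h ->
  measurable_fun setT (fun s : measurableTypeR R => h (rV_cons (s, x))).
Proof.
move=> /measurable_comp_rV_cons mh.
exact: (measurableT_comp mh (measurable_pair2 x)).
Qed.

Lemma det_ublock_head n (a : R) (b : 'rV[R]_n) (S : 'M[R]_n) :
  \det (block_mx a%:M b 0 S : 'M[R]_n.+1) = a * \det S.
Proof. by have := det_ublock (a%:M : 'M[R]_1) b S; rewrite det_scalar1. Qed.

Lemma rV_cons_mul_block n (s a : R) (x b : 'rV[R]_n) (c : 'cV[R]_n) (S : 'M[R]_n) :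
  rV_cons (s, x) *m (block_mx a%:M b c S : 'M[R]_n.+1) =
  rV_cons (s * a + (x *m c) ord0 ord0, s *: b + x *m S).
Proof.
have -> : rV_cons (s * a + (x *m c) ord0 ord0, s *: b + x *m S) =
    row_mx ((s%:M : 'M[R]_1) *m a%:M + x *m c) (s%:M *m b + x *m S).
  have E : (s%:M : 'M[R]_1) *m a%:M + x *m c = (s * a + (x *m c) ord0 ord0)%:M.
    by rewrite [x *m c in LHS]mx11_scalar -scalar_mxM -raddfD.
  by rewrite E mul_scalar_mx.
exact: (mul_row_block (s%:M : 'M[R]_1) x a%:M b c S).
Qed.

Lemma measurable_integral_rV_cons n (h : 'rV[R]_n.+1 -> \bar R) :
  measurable_fun setT h -> (forall x, 0 <= h x)%E ->
  measurable_fun setT (fun s : R => \int[lam n]_x h (rV_cons (s, x)))%E.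
Proof.
move=> /measurable_comp_rV_cons mh h0.
have := @measurable_fun_fubini_tonelli_F _ _ _ _ R (lam n) _ mh.
by apply => x; exact: h0.
Qed.

Lemma integral_rV_translate n (a : 'rV[R]_n) (h : 'rV[R]_n -> \bar R) :
  measurable_fun setT h -> (forall x, 0 <= h x)%E ->
  (\int[lam n]_x h (x + a)%R = \int[lam n]_x h x)%E.
Proof.
elim: n a h => [|n IH] a h mh h0.
  by apply: eq_integral => x _; congr h; apply/rowP; case.
have ma := measurable_add_rV a.
rewrite (integral_rV_consl mh h0).
rewrite (integral_rV_consl (measurableT_comp mh ma) (fun x => h0 (x + a)%R)).
rewrite -(rV_consE a) /=; move: (a ord0 ord0) (\row_i _) => b v.
under eq_integral => s _ do under eq_integral => x _ do rewrite rV_consD.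
under eq_integral => s _.
  rewrite (IH v (fun x => h (rV_cons ((s : R) + b, x)))) //; last first.
    exact: measurable_pair_rV_cons.
  over.
rewrite (@integral_lebesgue_translate _ b
  (fun s => \int[lam n]_x h (rV_cons (s, x))))%E//.
  exact: measurable_integral_rV_cons.
by move=> s; exact: integral_ge0.
Qed.

(** The change of variables formula as a predicate on the matrix: it is closed under products, so it
    has to be checked on block triangular factors only. *)
Definition scales_integral n (A : 'M[R]_n) := forall h : 'rV[R]_n -> \bar R,
  measurable_fun setT h -> (forall x, 0 <= h x)%E ->
  (\int[lam n]_x h (x *m A) = (`|\det A|^-1)%:E * \int[lam n]_x h x)%E.

Lemma scales_integralM n (A B : 'M[R]_n) :
  scales_integral A -> scales_integral B -> scales_integral (A *m B).
Proof.
move=> JA JB h mh h0.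
under eq_integral do rewrite mulmxA.
rewrite (JA (fun x => h (x *m B)))//; last first.
  by apply: measurableT_comp => //; exact: measurable_mul_rV.
by rewrite JB// muleA -EFinM det_mulmx normrM invfM.
Qed.

Lemma scales_integral_ublock n (a : R) (b : 'rV[R]_n) (S : 'M[R]_n) :
  a != 0 -> scales_integral S ->
  scales_integral (block_mx a%:M b 0 S : 'M[R]_n.+1).
Proof.
move=> a0 JS h mh h0.
rewrite !integral_rV_consl//; last first.
  by apply: measurableT_comp => //; exact: measurable_mul_rV.
under eq_integral => s _.
  under eq_integral => x _.
    rewrite rV_cons_mul_block mulmx0 mxE addr0 addrC.
    over.
  rewrite (JS (fun x => h (rV_cons ((s : R) * a, x + (s : R) *: b)))) //; last first.
    apply: (measurableT_comp (measurable_pair_rV_cons _ mh)).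
    exact: measurable_add_rV.
  rewrite (integral_rV_translate _ (h := fun x => h (rV_cons ((s : R) * a, x)))) //; last first.
    exact: measurable_pair_rV_cons.
  over.
have mF : measurable_fun setT (fun s : measurableTypeR R =>
    \int[lam n]_x h (rV_cons (s, x)))%E.
  exact: measurable_integral_rV_cons.
have F0 (s : R) : (0 <= \int[lam n]_x h (rV_cons (s, x)))%E by exact: integral_ge0.
pose F (s : R) := (\int[lam n]_x h (rV_cons (s, x)))%E.
have mFa : measurable_fun setT (fun s : R => F (s * a)).
  apply: (measurableT_comp mF).
  by apply: measurable_funM => //; exact: measurable_cst.
transitivity (\int[leb]_s (`|\det S|^-1%:E * F ((s : R) * a)%R))%E; first by [].
rewrite (@ge0_integralZl_EFin _ _ _ leb setT measurableT _ (fun s _ => F0 _) mFa); last first.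
  by rewrite invr_ge0.
rewrite (@integral_lebesgue_scale _ a F)//.
rewrite muleA -EFinM; congr (_%:E * _)%E.
by rewrite det_ublock_head normrM invfM mulrC.
Qed.

Lemma scales_integral_lblock n (c : 'cV[R]_n) :
  scales_integral (block_mx (1%:M : 'M[R]_1) 0 c 1%:M : 'M[R]_n.+1).
Proof.
move=> h mh h0.
rewrite !integral_rV_consr//; last first.
  by apply: measurableT_comp => //; exact: measurable_mul_rV.
under eq_integral => x _.
  under eq_integral => s _.
    rewrite rV_cons_mul_block mulr1 scaler0 add0r mulmx1.
    over.
  rewrite (@integral_lebesgue_translate _ _ (fun s => h (rV_cons (s, x)))) //; last first.
    exact: measurable_pairr_rV_cons.
  over.
rewrite [\det _](det_lblock (1%:M : 'M[R]_1)) !det1 mulr1 normr1 invr1 mul1e.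
by [].
Qed.

(** Gaussian elimination, by induction on the dimension: a matrix with nonzero pivot is a lower
    shear times a block upper triangular matrix whose corner is smaller by one. *)
Theorem integral_rV_mul n (A : 'M[R]_n) : A \in unitmx -> scales_integral A.
Proof.
elim: n A => [A _ h mh h0|n IH A uA].
  rewrite det_mx00 normr1 invr1 mul1e; apply: eq_integral => x _; congr h.
  by apply/rowP; case.
suff pivot (B : 'M[R]_n.+1) :
    B \in unitmx -> B ord0 ord0 != 0 -> scales_integral B.
  have [A0|A0] := eqVneq (A ord0 ord0) 0; last exact: pivot.
  have [k Ak] : exists k, A (lift ord0 k) ord0 != 0.
    apply: contrapT => /forallNP A_0.
    have : (invmx A *m A) ord0 ord0 = 0.
      rewrite mxE big1// => i _; case: (unliftP ord0 i) => [j ->|->].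
        by have /negP := A_0 j; rewrite negbK => /eqP ->; rewrite mulr0.
      by rewrite A0 mulr0.
    by rewrite mulVmx// mxE eqxx => /eqP; rewrite oner_eq0.
  (* Left multiplication by [E 1] adds row [lift ord0 k] to the first row, which makes the pivot
     nonzero; [E (-1)] undoes it. *)
  pose E (e : R) : 'M[R]_n.+1 := block_mx (1%:M : 'M[R]_1) (e *: delta_mx ord0 k) 0 1%:M.
  have EE : E (-1) *m E 1 = 1%:M.
    have := mulmx_block (1%:M : 'M[R]_1) (-1 *: delta_mx ord0 k) 0 1%:M
      (1%:M : 'M[R]_1) (1 *: delta_mx ord0 k) 0 (1%:M : 'M[R]_n).
    rewrite [X in _ = X -> _](_ : _ = 1%:M); first exact.
    rewrite !mulmx0 !mul0mx !mulmx1 !mul1mx !addr0 !add0r scale1r scaleN1r subrr.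
    by rewrite (scalar_mx_block 1 n).
  have detE e : \det (E e) = 1.
    by rewrite det_ublock_head det1 mulr1.
  rewrite -[A]mul1mx -EE -mulmxA; apply: scales_integralM.
    apply: scales_integral_ublock; first exact: oner_neq0.
    by apply: IH; exact: unitmx1.
  apply: pivot; first by rewrite unitmx_mul uA andbT unitmxE detE unitr1.
  have -> : (E 1 *m A) ord0 ord0 = A (lift ord0 k) ord0 => //.
  have E0 : ord0 = lshift n ord0 :> 'I_(1 + n) by exact/val_inj.
  rewrite mxE (bigD1 (lift ord0 k))//= [X in _ + X]big1 ?addr0.
    rewrite [E 1 ord0 (lift ord0 k)](_ : _ = 1) ?mul1r//.
    rewrite -rshift1 [in LHS]E0; apply: etrans (block_mxEur _ _ _ _ _ _) _.
    by rewrite !mxE !eqxx mulr1.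
  move=> i ik; case: (unliftP ord0 i) ik => [j -> jk|-> _]; last by rewrite A0 mulr0.
  rewrite [E 1 ord0 (lift ord0 j)](_ : _ = 0) ?mul0r//.
  rewrite -rshift1 [in LHS]E0; apply: etrans (block_mxEur _ _ _ _ _ _) _.
  rewrite !mxE eqxx/= (_ : (j == k) = false) ?mulr0//.
  by apply: contraNF jk => /eqP ->.
(* Block LU factorization: the lower right corner of the second factor is the Schur complement of
   the pivot. *)
move=> uB B0; have : B = block_mx (1%:M : 'M[R]_1) 0
      ((B ord0 ord0)^-1 *: @dlsubmx _ 1 n 1 n B) 1%:M *m
    block_mx (B ord0 ord0)%:M (@ursubmx _ 1 n 1 n B) 0
      (@drsubmx _ 1 n 1 n B - (B ord0 ord0)^-1 *: (@dlsubmx _ 1 n 1 n B *m @ursubmx _ 1 n 1 n B)) :> 'M[R]_n.+1.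
  apply: etrans (esym (@submxK _ 1 n 1 n B)) _.
  apply: esym; apply: etrans (mulmx_block _ _ _ _ _ _ _ _) _.
  rewrite !mulmx0 !mul0mx !mul1mx !addr0 -scalemxAl -scalemxAl addrC subrK.
  rewrite mul_mx_scalar scalerA mulVf// scale1r; congr block_mx.
  apply/matrixP => i j; rewrite !mxE !ord1 eqxx mulr1n.
  by congr (B _ _); exact/val_inj.
set C := block_mx (B ord0 ord0)%:M _ _ _ => BC; rewrite BC.
apply: scales_integralM; first exact: scales_integral_lblock.
apply: scales_integral_ublock => //; apply: IH.
move: uB; rewrite {1}BC unitmx_mul => /andP[_].
by rewrite unitmxE det_ublock_head unitrM => /andP[].
Qed.

Lemma measurable_affine_rV m n (A : 'M[R]_(m, n)) (a : 'rV[R]_n) :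
  measurable_fun setT (fun x : 'rV[R]_m => x *m A + a).
Proof.
exact: (measurableT_comp (measurable_add_rV a) (measurable_mul_rV A)).
Qed.

Lemma ge0_integral_rV_affine n (A : 'M[R]_n) (a : 'rV[R]_n) (h : 'rV[R]_n -> \bar R) :
  A \in unitmx -> measurable_fun setT h -> (forall x, 0 <= h x)%E ->
  (\int[lam n]_x h (x *m A + a)%R = (`|\det A|^-1)%:E * \int[lam n]_x h x)%E.
Proof.
move=> uA mh h0.
rewrite (integral_rV_mul uA (h := fun x => h (x + a)))//; last first.
  exact: (measurableT_comp mh (measurable_add_rV a)).
by rewrite integral_rV_translate.
Qed.

Lemma integrable_rV_affine n (A : 'M[R]_n) (a : 'rV[R]_n) (h : 'rV[R]_n -> \bar R) :
  A \in unitmx -> (lam n).-integrable setT h ->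
  (lam n).-integrable setT (fun x => h (x *m A + a)).
Proof.
move=> uA /integrableP[mh hoo]; apply/integrableP; split.
  exact: (measurableT_comp mh (measurable_affine_rV A a)).
rewrite (ge0_integral_rV_affine a (h := fun x => `|h x|%E) uA)//; last first.
  exact: measurableT_comp.
by rewrite lte_mul_pinfty// ?lee_fin ?invr_ge0.
Qed.

Lemma integral_rV_affine n (A : 'M[R]_n) (a : 'rV[R]_n) (h : 'rV[R]_n -> \bar R) :
  A \in unitmx -> (lam n).-integrable setT h ->
  (\int[lam n]_x h (x *m A + a)%R = (`|\det A|^-1)%:E * \int[lam n]_x h x)%E.
Proof.
move=> uA ih; have mh := measurable_int _ ih.
rewrite integralE [in RHS]integralE muleBr//; last first.
  by rewrite fin_num_adde_defr// (integrable_pos_fin_num _ ih).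
have pos := ge0_integral_rV_affine a uA (measurable_funepos mh) (funepos_ge0 h).
have neg := ge0_integral_rV_affine a uA (measurable_funeneg mh) (funeneg_ge0 h).
by congr (_ - _)%E; [rewrite -pos|rewrite -neg];
  apply: eq_integral => x _; rewrite ?funeposE ?funenegE.
Qed.

Lemma lebesgue_rV_affine n (A : 'M[R]_n) (a : 'rV[R]_n) (E : set 'rV[R]_n) :
  A \in unitmx -> measurable E ->
  (lam n [set x | E (x *m A + a)%R] = (`|\det A|^-1)%:E * lam n E)%E.
Proof.
move=> uA mE; have mE' : measurable [set x | E (x *m A + a)].
  by rewrite -[X in measurable X]setTI; exact: measurable_affine_rV.
rewrite -[in RHS](setIT E) -(integral_indic (lam n) measurableT mE).
rewrite -(ge0_integral_rV_affine a uA)//.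
  by rewrite integral_indic// setIT.
exact/measurable_EFinP/measurable_indic.
Qed.

Lemma lebesgue_rV_bounded n (M : R) :
  (lam n [set x | forall i, (`|x ord0 i| <= M)%R] < +oo)%E.
Proof.
rewrite (_ : mkset _ = [set x | forall i, `[-M, M]%classic (x ord0 i)]); last first.
  by apply/seteqP; split => x /= xM i; have := xM i; rewrite in_itv/= ler_norml.
rewrite (@lebesgue_rV_box R n (fun=> `[-M, M]%classic))//.
rewrite -ge0_fin_numE; last by apply: prode_ge0.
apply: prode_fin_num => i _.
by rewrite lebesgue_measure_itv/=; case: ifP.
Qed.

End lebesgue_rV_theory.

(** * Smooth and test functions *)

Section matrix_topology_complements.
Context {R : realType}.

Lemma continuous_rV (T : topologicalType) n (f : T -> 'rV[R]_n) :
  (forall i, continuous (fun x => f x ord0 i)) -> continuous f.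
Proof.
move=> cf x; apply/cvgrPdist_lt => e e0.
have : \forall y \near x, forall i, `|f x ord0 i - f y ord0 i| < e.
  apply: filter_forall => i.
  by move: (cf i x) => /cvgrPdist_lt /(_ e e0).
apply: filterS => y fxy.
suff : ball (f x) e (f y) by rewrite mx_norm_ball.
by split => // i j; rewrite ord1; exact: fxy.
Qed.

Lemma continuous_affine_rV m n (A : 'M[R]_(m, n)) (a : 'rV[R]_n) :
  continuous (fun x : 'rV[R]_m => x *m A + a).
Proof.
apply: continuous_rV => j.
rewrite (_ : (fun x => _) = fun x : 'rV[R]_m => \sum_k x ord0 k * A k j + a ord0 j).
  move=> x; apply: (@cvgD _ _ _ (nbhs x)); last exact: (@cvg_cst _ (a ord0 j) _ (nbhs x)).
  apply: (@cvg_big _ _ _ _ _ _ _ (nbhs x)) => [|k _]; first exact: add_continuous.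
  apply: (@cvgM _ _ (nbhs x)); last exact: cvg_cst.
  exact: coord_continuous.
by apply/funext => x; rewrite !mxE.
Qed.

Lemma continuous_measurable_rV n (f : 'rV[R]_n -> R) :
  continuous f -> measurable_fun setT f.
Proof.
move=> cf; apply: (measurability _ (RGenOpens.measurableE R)).
move=> _ [_ [a [b ->] <-]]; apply: open_measurable_mx; rewrite setTI.
by apply: open_comp; [move=> x _; exact: cf|exact: interval_open].
Qed.

End matrix_topology_complements.

Section lines.
Context {R : realType} {V : normedModType R}.
Implicit Types (f : V -> R) (x v : V).

Lemma is_derive_line f x v (s l : R) :
  is_derive (s *: v + x) v f l -> is_derive s 1 (fun t : R => f (t *: v + x)) l.
Proof.
move=> [df <-].
have E : (fun h : R => h^-1 *: (((fun t : R => f (t *: v + x)) \o shift s) (h *: 1) -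
      f (s *: v + x))) =
    (fun h : R => h^-1 *: ((f \o shift (s *: v + x)) (h *: v) - f (s *: v + x))).
  by apply/funext => h /=; rewrite [h%:A]mulr1 scalerDl addrA.
by apply: DeriveDef; rewrite /derivable/derive E.
Qed.

Lemma is_derive_dq f x v l :
  (forall e, 0 < e -> \forall h \near 0^', `|l - h^-1 * (f (h *: v + x) - f x)| <= e) ->
  is_derive x v f l.
Proof.
move=> H; have cv : h^-1 *: ((f \o shift x) (h *: v) - f x) @[h --> 0^'] --> l.
  by apply/cvgrPdist_le => e e0; exact: H.
by apply: DeriveDef; [apply/cvg_ex; exists l|exact/cvg_lim].
Qed.

Lemma MVT_line f x v (df : V -> R) (t : R) :
  (forall s : R, is_derive (s *: v + x) v f (df (s *: v + x))) ->
  exists2 c, `|c| <= `|t| & f (t *: v + x) - f x = t * df (c *: v + x).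
Proof.
move=> dfE; pose g (s : R) := f (s *: v + x).
have dg (s : R) : is_derive s (1 : R) g (df (s *: v + x)) by exact: is_derive_line.
have cg (a b : R) : {within `[a, b], continuous g}.
  apply: derivable_within_continuous => s _; exact: (@ex_derive _ _ _ _ _ _ _ (dg s)).
have g0 : g 0 = f x by rewrite /g scale0r add0r.
have [t0|t0] := leP 0 t.
  have [c] := MVT_segment t0 (fun s _ => dg s) (cg _ _).
  rewrite in_itv/= => /andP[c0 ct]; rewrite subr0 g0 => E; exists c.
    by rewrite !ger0_norm.
  by rewrite mulrC.
have [c] := MVT_segment (ltW t0) (fun s _ => dg s) (cg _ _).
rewrite in_itv/= => /andP[tc c0]; rewrite g0 => E; exists c.
  by rewrite (ltr0_norm t0) ler0_norm// lerN2.
by rewrite -[LHS]opprB E; ring.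
Qed.

End lines.

Section smooth_functions.
Context {R : realType}.
Local Notation e_ i := (delta_mx ord0 i).

(** A coinduction principle for iterated partial derivatives: any class of continuous, partially
    derivable functions that is stable under [partial] consists of smooth functions. *)
Lemma smooth_coind n (C : ('rV[R]_n -> R) -> Prop) :
  (forall f, C f -> [/\ continuous f, forall x i, derivable f x (e_ i) &
    forall i, C (partial i f)]) ->
  forall f, C f -> smooth f.
Proof.
move=> HC f Cf s; have Cs : C (foldr partial f s).
  by elim: s => //= i s IH; have [] := HC _ IH.
by have [] := HC _ Cs.
Qed.

Lemma smooth_continuous n (f : 'rV[R]_n -> R) : smooth f -> continuous f.
Proof. by move=> /(_ [::])[]. Qed.

Lemma smooth_derivable n (f : 'rV[R]_n -> R) x i : smooth f -> derivable f x (e_ i).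
Proof. by move=> /(_ [::])[]. Qed.

Lemma smooth_partial n (f : 'rV[R]_n -> R) i : smooth f -> smooth (partial i f).
Proof. by move=> sf s; have := sf (rcons s i); rewrite foldr_rcons. Qed.

Lemma smooth_is_derive_partial n (f : 'rV[R]_n -> R) x i :
  smooth f -> is_derive x (e_ i) f (partial i f x).
Proof. by move=> sf; apply: DeriveDef => //; exact: smooth_derivable. Qed.

(** Continuity of the partial derivatives yields all directional ones. The direction is built one
    coordinate at a time; the additional move along a coordinate is handled by the mean value
    theorem and the continuity of that partial derivative. *)
Lemma smooth_is_derive_seq n (f : 'rV[R]_n -> R) (c : 'I_n -> R) (s : seq 'I_n) x :
  smooth f -> is_derive x (\sum_(i <- s) c i *: e_ i) f
    (\sum_(i <- s) c i * partial i f x).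
Proof.
move=> sf; elim: s => [|i s IH].
  by rewrite !big_nil; exact: is_derive0.
rewrite !big_cons; set w := \sum_(j <- s) _ *: _; set l := \sum_(j <- s) _.
apply: is_derive_dq => e e0.
have Hw : \forall h \near 0^', `|l - h^-1 * (f (h *: w + x) - f x)| <= e / 2.
  have /cvgrPdist_le := @ex_derive _ _ _ _ _ _ _ IH.
  rewrite -/(derive f x w) (@derive_val _ _ _ _ _ _ _ IH) -/l => /(_ (e / 2)).
  by rewrite divr_gt0//; exact.
(* Chosen so that [|c i| * d] stays below half of [e]. *)
pose d := e / 2 / (`|c i| + 1).
have d0 : 0 < d by rewrite !divr_gt0// ltr_wpDl.
have /cvgrPdist_le/(_ _ d0) := smooth_continuous (smooth_partial i sf) (x := x).
move=> /nbhs_ballP[r /= r0 Hr].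
(* The intermediate point of the mean value theorem is at distance at most [|h| * M] from [x]. *)
pose M := `|c i| * `|e_ i : 'rV[R]_n| + `|w|.
have M0 : 0 <= M by rewrite addr_ge0// mulr_ge0.
have rM : 0 < r / (M + 1) by rewrite divr_gt0// ltr_wpDl.
have Hh : \forall h \near (0 : R)^', `|h| * (M + 1) < r.
  near=> h; rewrite -ltr_pdivlMr ?ltr_wpDl//; near: h.
  exact: dnbhs0_lt.
have Hn : \forall h \near (0 : R)^', h != 0 by exact: nbhs_dnbhs_neq.
near=> h.
have h0 : h != 0 by near: h.
have [t tle E] := MVT_line (h * c i) (fun u => smooth_is_derive_partial (u *: e_ i + (h *: w + x)) i sf).
have -> : c i * partial i f x + l -
    h^-1 * (f (h *: (c i *: e_ i + w) + x) - f x) =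
  c i * (partial i f x - partial i f (t *: e_ i + (h *: w + x))) +
    (l - h^-1 * (f (h *: w + x) - f x)).
  have -> : h *: (c i *: e_ i + w) + x = (h * c i) *: e_ i + (h *: w + x).
    by rewrite scalerDr scalerA addrA.
  by move/eqP : E; rewrite subr_eq => /eqP ->; field.
rewrite (splitr e) (le_trans (ler_normD _ _))// lerD//; last by near: h.
rewrite normrM.
have Hd : `|partial i f x - partial i f (t *: e_ i + (h *: w + x))| <= d.
  apply: Hr; rewrite -ball_normE /ball_/= addrA opprD addrCA subrr addr0 normrN.
  apply: le_lt_trans (_ : `|h| * (M + 1) < r); last by near: h.
  rewrite (le_trans (ler_normD _ _))// !normrZ.
  apply: (@le_trans _ _ (`|h| * M)); last by rewrite ler_wpM2l// lerDl.
  rewrite /M mulrDr lerD// mulrA -normrM ler_wpM2r//.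
rewrite (le_trans (ler_wpM2l _ Hd))//.
rewrite /d mulrA ler_pdivrMr ?ltr_wpDl// [leRHS]mulrDr mulr1 mulrC lerDl.
by rewrite divr_ge0// ltW.
Unshelve. all: by end_near. Qed.

Lemma smooth_is_derive n (f : 'rV[R]_n -> R) x v :
  smooth f -> is_derive x v f (\sum_i v ord0 i * partial i f x).
Proof.
move=> sf; rewrite [X in is_derive x X](row_sum_delta v).
exact: smooth_is_derive_seq.
Qed.

Lemma is_derive_affine m n (f : 'rV[R]_m -> R) (A : 'M[R]_(n, m)) a x v l :
  is_derive (x *m A + a) (v *m A) f l ->
  is_derive x v (fun y : 'rV[R]_n => f (y *m A + a)) l.
Proof.
move=> [df <-].
have E : (fun h : R => h^-1 *: (((fun y : 'rV[R]_n => f (y *m A + a)) \o shift x)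
      (h *: v) - f (x *m A + a))) =
    (fun h : R => h^-1 *: ((f \o shift (x *m A + a)) (h *: (v *m A)) -
      f (x *m A + a))).
  by apply/funext => h /=; rewrite mulmxDl -scalemxAl addrA.
by apply: DeriveDef; rewrite /derivable/derive E.
Qed.

(** The derivative of a product is a sum of products, and that of an affine substitution is a linear
    combination of affine substitutions. Only the class closed under all these operations at once is
    stable under [partial], as [smooth_coind] requires. *)
Inductive smooth_closure n : ('rV[R]_n -> R) -> Prop :=
| SmoothAffine m (f : 'rV[R]_m -> R) (A : 'M[R]_(n, m)) a of smooth f :
    smooth_closure (fun x => f (x *m A + a))
| SmoothCst c : smooth_closure (cst c)
| SmoothD f g of smooth_closure f & smooth_closure g : smooth_closure (f + g)
| SmoothM f g of smooth_closure f & smooth_closure g : smooth_closure (f * g).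

Lemma smooth_closure_smooth n (f : 'rV[R]_n -> R) : smooth_closure f -> smooth f.
Proof.
apply: smooth_coind => {}f; elim => {f}.
- move=> m f A a sf; split.
  + move=> x; apply: (@continuous_comp _ _ _ (fun y : 'rV[R]_n => y *m A + a) f x).
      exact: continuous_affine_rV.
    exact: smooth_continuous.
  + move=> x i.
    by have [] := is_derive_affine (smooth_is_derive (x *m A + a) (e_ i *m A) sf).
  + move=> i; pose g j : 'rV[R]_n -> R :=
      cst (((e_ i : 'rV[R]_n) *m A) ord0 j) * (fun x => partial j f (x *m A + a)).
    have -> : partial i (fun x => f (x *m A + a)) = \sum_j g j.
      apply/funext => x; rewrite /partial fct_sumE.
      by have [_ ->] := is_derive_affine (smooth_is_derive (x *m A + a) (e_ i *m A) sf).
    elim/big_ind : _ => [|h k|j _]; [|exact: SmoothD|].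
      by rewrite (_ : 0 = cst 0); [exact: SmoothCst|exact/funext].
    apply: SmoothM; first exact: SmoothCst.
    by apply: SmoothAffine; exact: smooth_partial.
- move=> c; split; first exact: cst_continuous.
    by move=> x i; exact: derivable_cst.
  move=> i; rewrite (_ : partial i _ = cst 0); first exact: SmoothCst.
  by apply/funext => x; rewrite /partial derive_cst.
- move=> f g sf [cf df pf] sg [cg dg pg]; split.
  + by move=> x; apply: continuousD; [exact: cf|exact: cg].
  + by move=> x i; exact: derivableD.
  + move=> i; rewrite (_ : partial i _ = partial i f + partial i g).
      exact: SmoothD.
    by apply/funext => x; rewrite /partial deriveD.
- move=> f g sf [cf df pf] sg [cg dg pg]; split.
  + by move=> x; apply: continuousM; [exact: cf|exact: cg].
  + by move=> x i; exact: derivableM.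
  + move=> i; rewrite (_ : partial i _ = f * partial i g + g * partial i f).
      by apply: SmoothD; exact: SmoothM.
    by apply/funext => x; rewrite /partial deriveM.
Qed.

Lemma smooth_affine m n (f : 'rV[R]_m -> R) (A : 'M[R]_(n, m)) a :
  smooth f -> smooth (fun x => f (x *m A + a)).
Proof. by move=> sf; apply: smooth_closure_smooth; exact: SmoothAffine. Qed.

Lemma smooth_smooth_closure n (f : 'rV[R]_n -> R) : smooth f -> smooth_closure f.
Proof.
move=> sf; rewrite (_ : f = fun x => f (x *m 1%:M + 0)).
  exact: SmoothAffine.
by apply/funext => x; rewrite mulmx1 addr0.
Qed.

Lemma smooth_cst n c : smooth (cst c : 'rV[R]_n -> R).
Proof. exact/smooth_closure_smooth/SmoothCst. Qed.

Lemma smoothD n (f g : 'rV[R]_n -> R) : smooth f -> smooth g -> smooth (f + g).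
Proof.
by move=> sf sg; apply/smooth_closure_smooth/SmoothD; exact: smooth_smooth_closure.
Qed.

Lemma smoothM n (f g : 'rV[R]_n -> R) : smooth f -> smooth g -> smooth (f * g).
Proof.
by move=> sf sg; apply/smooth_closure_smooth/SmoothM; exact: smooth_smooth_closure.
Qed.

Lemma smooth_prod n (I : Type) (s : seq I) (f : I -> 'rV[R]_n -> R) :
  (forall i, smooth (f i)) -> smooth (fun x => \prod_(i <- s) f i x).
Proof.
move=> sf; elim: s => [|i s IH].
  rewrite (_ : (fun x => _) = cst 1); first exact: smooth_cst.
  by apply/funext => x; rewrite big_nil.
rewrite (_ : (fun x => _) = f i * (fun x => \prod_(j <- s) f j x)).
  exact: smoothM.
by apply/funext => x; rewrite big_cons.
Qed.

End smooth_functions.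

(** * Smooth bump functions supported in boxes *)

Section bump.
Context {R : realType}.

Definition flat_exp (p : {poly R}) (x : R) : R :=
  if 0 < x then p.[x^-1] * expR (- x^-1) else 0.

Lemma exprn_expRN_le k (y : R) : 0 <= y -> y ^+ k * expR (- y) <= k`!%:R.
Proof.
move=> y0; rewrite expRN ler_pdivrMr ?expR_gt0//.
case: k => [|k]; first by rewrite expr0 mul1r -expR0 ler_expR.
rewrite -ler_pdivrMl ?ltr0n ?fact_gt0// mulrC.
by apply: le_trans (expR_ge1Dxn k y0); rewrite lerDr.
Qed.

Lemma poly_expRN_le (p : {poly R}) (y : R) : 0 <= y ->
  `|p.[y] * expR (- y)| <= \sum_(i < size p) `|p`_i| * i`!%:R.
Proof.
move=> y0; rewrite horner_coef mulr_suml (le_trans (ler_norm_sum _ _ _))//.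
apply: ler_sum => i _; rewrite -mulrA normrM ler_wpM2l// ger0_norm.
  exact: exprn_expRN_le.
by rewrite mulr_ge0 ?exprn_ge0 ?expR_ge0.
Qed.

(** The bound for [p * 'X^2] at 1/x releases a factor x^2; a quadratic bound is what makes the
    derivative at 0 vanish. *)
Lemma flat_exp_le (p : {poly R}) :
  exists2 C, 0 <= C & forall x, `|flat_exp p x| <= C * x ^+ 2.
Proof.
exists (\sum_(i < size (p * 'X^2)) `|(p * 'X^2)`_i| * i`!%:R) => [|x].
  by apply: sumr_ge0 => i _; rewrite mulr_ge0.
rewrite /flat_exp; case: ifPn => x0; last first.
  by rewrite normr0 mulr_ge0 ?sqr_ge0// sumr_ge0// => i _; rewrite mulr_ge0.
have xV0 : 0 <= x^-1 by rewrite invr_ge0 ltW.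
have := poly_expRN_le (p * 'X^2) xV0.
rewrite hornerM hornerXn exprVn mulrAC normrM (@ger0_norm _ (_ ^- 2)).
  by rewrite ler_pdivrMr// exprn_gt0.
by rewrite invr_ge0 sqr_ge0.
Qed.

Lemma is_derive_flat_exp (p : {poly R}) (x : R) :
  is_derive x (1 : R) (flat_exp p) (flat_exp ('X^2 * (p - p^`())) x).
Proof.
have [x0|x0|->] := ltgtP x 0.
- rewrite [flat_exp _ x](_ : _ = 0); last by rewrite /flat_exp ltNge (ltW x0).
  apply: (@near_eq_is_derive _ R^o R^o (cst 0)).
  near=> y; rewrite /flat_exp ltNge ltW//; near: y.
  exact: lt_nbhsl.
- rewrite /flat_exp x0.
  apply: (@near_eq_is_derive _ R^o R^o (fun y => p.[y^-1] * expR (- y^-1))).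
    near=> y; rewrite ifT//; near: y.
    exact: lt_nbhsr.
  have dV : is_derive x (1 : R) (fun y : R => y^-1) (- x ^- 2).
    have := @is_deriveV _ id x 1 1 (lt0r_neq0 x0) (is_derive_id _ _).
    by rewrite scaler1.
  have dE z : is_derive z (1 : R) (fun y : R => expR (- y)) (- expR (- z)).
    have := @is_derive1_comp _ expR -%R z _ _ (is_derive_expR _) (is_deriveNid _ _).
    by rewrite mulrN1.
  have dh := @is_derive1_comp _ _ (fun y : R => y^-1) x _ _
    (is_deriveM (is_derive_poly p x^-1) (dE x^-1)) dV.
  apply: is_derive_eq dh _.
  rewrite hornerM hornerXn hornerD hornerN exprVn /GRing.scale/=.
  by ring.
- rewrite [flat_exp _ 0](_ : _ = 0); last by rewrite /flat_exp ltxx.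
  have [C C0 HC] := flat_exp_le p.
  apply: is_derive_dq => e e0; near=> h.
  rewrite [h%:A]mulr1 addr0 [flat_exp p 0](_ : _ = 0); last by rewrite /flat_exp ltxx.
  rewrite subr0 sub0r normrN normrM normfV.
  have h0 : h != 0 by near: h; exact: nbhs_dnbhs_neq.
  rewrite ler_pdivrMl ?normr_gt0// (le_trans (HC _))//.
  rewrite -real_normK ?num_real// expr2 mulrA mulrC ler_wpM2l//.
  have he : `|h| <= e / (C + 1).
    by near: h; apply: dnbhs0_le; rewrite divr_gt0// ltr_wpDl.
  rewrite (le_trans (ler_wpM2l C0 he))// mulrA ler_pdivrMr ?ltr_wpDl//.
  by rewrite mulrDr mulr1 mulrC lerDl ltW.
Unshelve. all: by end_near. Qed.

Lemma smooth_flat_exp (p : {poly R}) :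
  smooth (fun y : 'rV[R]_1 => flat_exp p (y ord0 ord0)).
Proof.
apply: (@smooth_coind _ _ (fun g => exists p : {poly R},
  g = fun y : 'rV[R]_1 => flat_exp p (y ord0 ord0))); last by exists p.
move=> _ [{}p ->].
have dg (y : 'rV[R]_1) i : is_derive y (delta_mx ord0 i)
    (fun y : 'rV[R]_1 => flat_exp p (y ord0 ord0))
    (flat_exp ('X^2 * (p - p^`())) (y ord0 ord0)).
  have [df <-] := is_derive_flat_exp p (y ord0 ord0).
  have E : (fun h : R => h^-1 *: (((fun y : 'rV[R]_1 => flat_exp p (y ord0 ord0))
        \o shift y) (h *: delta_mx ord0 i) - flat_exp p (y ord0 ord0))) =
      (fun h : R => h^-1 *: ((flat_exp p \o shift (y ord0 ord0)) (h *: 1) -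
        flat_exp p (y ord0 ord0))).
    by apply/funext => h /=; rewrite !mxE !ord1.
  by apply: DeriveDef; rewrite /derivable/derive E.
split.
- move=> y; apply: (@continuous_comp _ _ _ (fun z : 'rV[R]_1 => z ord0 ord0) (flat_exp p) y).
    exact: coord_continuous.
  apply: differentiable_continuous; apply/derivable1_diffP.
  by have [] := is_derive_flat_exp p (y ord0 ord0).
- by move=> y i; have [] := dg y i.
- move=> i; exists ('X^2 * (p - p^`())); apply/funext => y.
  by rewrite /partial; have [_ ->] := dg y i.
Qed.

Definition flat_bump (x : R) := flat_exp 1 x.

Lemma flat_bump_ge0 x : 0 <= flat_bump x.
Proof. by rewrite /flat_bump /flat_exp hornerC mul1r; case: ifP => // _; exact: expR_ge0. Qed.

Lemma flat_bump_le1 x : flat_bump x <= 1.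
Proof.
rewrite /flat_bump /flat_exp hornerC mul1r; case: ifP => // x0.
by rewrite expR_le1 oppr_le0 invr_ge0 ltW.
Qed.

Lemma flat_bump_gt0 x : (0 < flat_bump x) = (0 < x).
Proof.
rewrite /flat_bump /flat_exp hornerC mul1r; case: ifP => [_|_]; last by rewrite ltxx.
exact: expR_gt0.
Qed.

Definition box_bump n (c : 'rV[R]_n) (r : R) (x : 'rV[R]_n) : R :=
  \prod_i (flat_bump (x ord0 i - c ord0 i + r) * flat_bump (c ord0 i - x ord0 i + r)).

Lemma smooth_box_bump n (c : 'rV[R]_n) r : smooth (box_bump c r).
Proof.
apply: smooth_prod => i.
have coord (a b : R) : smooth (fun x : 'rV[R]_n => flat_bump (a * x ord0 i + b)).
  have := @smooth_affine _ _ _ _ (a *: delta_mx i ord0) (const_mx b) (smooth_flat_exp 1).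
  rewrite (_ : (fun _ => _) = fun x : 'rV[R]_n => flat_bump (a * x ord0 i + b))//.
  apply/funext => x; rewrite /flat_bump; congr flat_exp.
  rewrite -scalemxAr !mxE (bigD1 i)//= big1 ?addr0 => [|j ji].
    by rewrite mxE !eqxx mulr1.
  by rewrite mxE (negbTE ji) mulr0.
rewrite (_ : (fun x => _) = (fun x : 'rV[R]_n => flat_bump (1 * x ord0 i + (r - c ord0 i))) *
    (fun x : 'rV[R]_n => flat_bump (-1 * x ord0 i + (c ord0 i + r)))).
  exact: smoothM.
apply/funext => x; transitivity (flat_bump (1 * x ord0 i + (r - c ord0 i)) *
  flat_bump (-1 * x ord0 i + (c ord0 i + r))) => //.
by congr (flat_bump _ * flat_bump _); ring.
Qed.

Lemma box_bump_ge0 n (c : 'rV[R]_n) r x : 0 <= box_bump c r x.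
Proof. by apply: prodr_ge0 => i _; rewrite mulr_ge0 ?flat_bump_ge0. Qed.

Lemma box_bump_le1 n (c : 'rV[R]_n) r x : box_bump c r x <= 1.
Proof.
apply: prodr_ile1 => i _; rewrite mulr_ge0 ?flat_bump_ge0//=.
by rewrite mulr_ile1 ?flat_bump_ge0 ?flat_bump_le1.
Qed.

Lemma box_bump_gt0 n (c : 'rV[R]_n) r x : 0 < r -> (0 < box_bump c r x) <-> ball c r x.
Proof.
move=> r0; rewrite lt_neqAle box_bump_ge0 andbT eq_sym.
have fact i : (flat_bump (x ord0 i - c ord0 i + r) * flat_bump (c ord0 i - x ord0 i + r) != 0)
    = (`|c ord0 i - x ord0 i| < r).
  have neq0 y : (flat_bump y != 0) = (0 < y).
    by rewrite -flat_bump_gt0 lt_neqAle flat_bump_ge0 andbT eq_sym.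
  by rewrite mulf_eq0 negb_or !neq0 ltr_norml; apply/andP/andP => -[? ?]; split; lra.
split => [/prodf_neq0 h|[_ cx]].
  by split => // i j; rewrite ord1; have := h j isT; rewrite fact.
by apply/prodf_neq0 => i _; rewrite fact; exact: cx.
Qed.

End bump.

Section test_functions.
Context {R : realType} {n : nat}.
Implicit Types phi psi : 'rV[R]_n -> R.

Lemma test_functionP phi : test_function phi <->
  smooth phi /\ exists M, forall x, phi x != 0 -> `|x| <= M.
Proof.
split => [[sphi cphi]|[sphi [M HM]]]; split => //.
  have [M [_ HM]] := compact_bounded cphi.
  exists (M + 1) => x x0; apply: (HM (M + 1)); first by rewrite ltrDl.
  exact: subset_closure.
apply: bounded_closed_compact; last exact: closed_closure.
exists M; split; first exact: num_real.
move=> N MN x xphi; apply: le_trans (ltW MN).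
have : closure [set x | phi x != 0] `<=` closed_ball_ Num.norm 0 M.
  rewrite closureE; apply: smallest_sub; first exact: closed_closed_ball_.
  by move=> y /= /HM; rewrite /closed_ball_/= sub0r normrN.
by move=> /(_ _ xphi); rewrite /closed_ball_/= sub0r normrN.
Qed.

Lemma test_function_smooth phi : test_function phi -> smooth phi.
Proof. by case. Qed.

Lemma test_functionM phi psi : test_function phi -> smooth psi -> test_function (phi * psi).
Proof.
move=> /test_functionP[sphi [M HM]] spsi; apply/test_functionP; split; first exact: smoothM.
exists M => x xn; apply: HM; apply: contra xn => /eqP.
by rewrite /GRing.mul/= => ->; rewrite mul0r.
Qed.

Lemma test_functionD phi psi : test_function phi -> test_function psi -> test_function (phi + psi).
Proof.
move=> /test_functionP[sphi [M HM]] /test_functionP[spsi [N HN]]; apply/test_functionP.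
split; first exact: smoothD.
exists (Num.max M N) => x; rewrite /GRing.add/= => xn; rewrite le_max.
have [x0|/HM ->//] := eqVneq (phi x) 0.
by rewrite HN ?orbT//; apply: contra xn => /eqP ->; rewrite x0 addr0.
Qed.

Lemma test_functionZ c phi : test_function phi -> test_function (cst c * phi).
Proof.
move=> tphi; rewrite mulrC; apply: test_functionM => //; exact: smooth_cst.
Qed.

Lemma test_function_partial i phi : test_function phi -> test_function (partial i phi).
Proof.
move=> /test_functionP[sphi [M HM]]; apply/test_functionP.
split; first exact: smooth_partial.
exists M => x; apply: contraR; rewrite -ltNge => Mx; apply/eqP.
rewrite /partial (@near_eq_derive _ _ _ phi (cst 0)) ?derive_cst//.
near=> y; apply: contrapT => /eqP /HM; apply/negP; rewrite -ltNge.
near: y.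
exact: (@cvgr_gt _ _ (nbhs x) _ _ _ (@norm_continuous _ _ x) _ Mx).
Unshelve. all: by end_near. Qed.

Lemma test_function_affine (A : 'M[R]_n) a phi : A \in unitmx -> test_function phi ->
  test_function (fun x => phi (x *m A + a)).
Proof.
move=> uA [sphi cphi]; apply/test_functionP; split; first exact: smooth_affine.
have ci : compact [set y *m invmx A + (- a *m invmx A) | y in closure [set x | phi x != 0]].
  apply: continuous_compact => //; apply: continuous_subspaceT.
  exact: continuous_affine_rV.
have [M [_ HM]] := compact_bounded ci.
exists (M + 1) => x x0; apply: (HM (M + 1)); first by rewrite ltrDl.
exists (x *m A + a); first exact: subset_closure.
by rewrite -mulmxDl addrK mulmxK.
Qed.

Lemma test_function_bounded phi : test_function phi -> exists2 C, 0 <= C & forall x, `|phi x| <= C.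
Proof.
move=> [sphi cphi].
have ci : compact (phi @` closure [set x | phi x != 0]).
  apply: continuous_compact => //; apply: continuous_subspaceT.
  exact: smooth_continuous.
have [M [_ HM]] := compact_bounded ci.
exists (`|M| + 1) => [|x]; first by rewrite addr_ge0.
have [->|x0] := eqVneq (phi x) 0; first by rewrite normr0 addr_ge0.
apply: (HM (`|M| + 1)); first by rewrite ltr_pwDr// ler_norm.
by exists x => //; exact: subset_closure.
Qed.

Lemma measurable_test_function phi : test_function phi -> measurable_fun setT phi.
Proof. by move=> [sphi _]; apply: continuous_measurable_rV; exact: smooth_continuous. Qed.

End test_functions.

(** * Approximation by test functions *)

Section approximation_by_test_functions.
Context {R : realType} {n : nat}.
Variable mu : {measure set 'rV[R]_n -> \bar R}.

Lemma open_bigcup_ball (U : set 'rV[R]_n) : open U ->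
  exists c : nat -> 'rV[R]_n, exists r : nat -> R,
    (forall k, 0 < r k) /\ exists P : set nat, U = \bigcup_(k in P) ball (c k) (r k).
Proof.
move=> oU; pose q (M : 'rV[rat]_n) : 'rV[R]_n := map_mx ratr M.
(* A number that encodes no pair decodes to the ball of centre 0 and radius 1, which enters the
   union only if it is contained in [U]. *)
pose d k := odflt (0, 0%N) (unpickle k : option ('rV[rat]_n * nat)).
pose B (p : 'rV[rat]_n * nat) := ball (q p.1) p.2.+1%:R^-1.
exists (fun k => q (d k).1), (fun k => (d k).2.+1%:R^-1); split.
  by move=> k; rewrite invr_gt0.
exists [set k | B (d k) `<=` U].
apply/seteqP; split => [x Ux|x [k]]; last exact.
have : nbhs x U by exact: open_nbhs_nbhs.
move=> /nbhs_ballP[e /= e0 eU].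
have [k _ ke] := near_infty_natSinv_lt (PosNum (divr_gt0 e0 (ltr0n R 2))).
have k0 : (0 : R) < k.+1%:R^-1 by rewrite invr_gt0.
have ex (i : 'I_1) (j : 'I_n) : exists r : rat, `|x i j - ratr r| < k.+1%:R^-1.
  have [r] : exists r : rat, ratr r \in `](x i j), (x i j + k.+1%:R^-1)[.
    by apply: rat_in_itvoo; rewrite ltrDl.
  rewrite in_itv/= => /andP[Mr rM]; exists r.
  by rewrite distrC ger0_norm ?subr_ge0 1?ltW// ltrBlDl.
pose r : 'rV[rat]_n := \matrix_(i, j) sval (cid (ex i j)).
have xr : ball (q r) k.+1%:R^-1 x.
  by split => // i j; rewrite /ball/= distrC !mxE; case: cid.
have dr : d (pickle (r, k)) = (r, k) by rewrite /d pickleK.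
exists (pickle (r, k)); rewrite /= dr// => y ry; apply: eU.
have kle : k.+1%:R^-1 <= e / 2 := ltW (ke k (leqnn k)).
rewrite (splitr e); apply: (@ball_triangle _ _ (q r)).
  by apply: ball_sym; exact: (le_ball kle).
exact: (le_ball kle).
Qed.

Variable w : 'rV[R]_n -> R.
Hypothesis w0 : forall x, 0 <= w x.
Hypothesis iw : mu.-integrable setT (EFin \o w).

Let mw : measurable_fun setT w.
Proof. by apply/measurable_EFinP; exact: measurable_int iw. Qed.

(** The integrable weight keeps distances between bounded functions finite when [mu] is infinite. It
    is |h| when a pairing with h is optimized, and 1 for a finite measure. *)
Let dist (f g : 'rV[R]_n -> R) : \bar R := (\int[mu]_x (`|f x - g x| * w x)%:E)%E.

Let dist_le (f g : 'rV[R]_n -> R) (h k : 'rV[R]_n -> R) (a b : \bar R) :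
  measurable_fun setT f -> measurable_fun setT g -> measurable_fun setT h ->
  measurable_fun setT k ->
  (forall x, `|f x - g x| <= `|h x| + `|k x|) ->
  (\int[mu]_x (`|h x| * w x)%:E <= a)%E -> (\int[mu]_x (`|k x| * w x)%:E <= b)%E ->
  (dist f g <= a + b)%E.
Proof.
move=> mf mg mh mk fg ha kb.
have mW (u : 'rV[R]_n -> R) : measurable_fun setT u ->
    measurable_fun setT (fun x => (`|u x| * w x)%:E).
  move=> mu'; apply/measurable_EFinP/measurable_funM => //.
  exact: measurableT_comp.
apply: (@le_trans _ _ (\int[mu]_x ((`|h x| * w x)%:E + (`|k x| * w x)%:E))%E); last first.
  rewrite ge0_integralD//; first exact: leeD.
  - by move=> x _; rewrite lee_fin mulr_ge0.
  - exact: mW.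
  - by move=> x _; rewrite lee_fin mulr_ge0.
  - exact: mW.
apply: ge0_le_integral => //.
- by move=> x _; rewrite lee_fin mulr_ge0.
- by apply: (mW (fun x => f x - g x)); exact: measurable_funB.
- by apply: emeasurable_funD; exact: mW.
- by move=> x _; rewrite -EFinD lee_fin -mulrDl ler_wpM2r.
Qed.

Let dist_cvg (f : nat -> 'rV[R]_n -> R) (g : 'rV[R]_n -> R) e :
  (forall k, measurable_fun setT (f k)) -> measurable_fun setT g ->
  (forall k x, `|f k x - g x| <= 1) -> (forall x, f k x @[k --> \oo] --> g x) ->
  0 < e -> exists k, (dist (f k) g <= e%:E)%E.
Proof.
move=> mf mg f1 fg e0.
have mD k : measurable_fun setT (fun x => (`|f k x - g x| * w x)%:E).
  apply/measurable_EFinP/measurable_funM => //.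
  by apply: measurableT_comp => //; exact: measurable_funB.
have := @dominated_convergence _ _ _ mu setT measurableT
  (fun k x => (`|f k x - g x| * w x)%:E) (cst 0%E) (EFin \o w) mD (measurable_cst _).
case.
- apply: aeW => x _; rewrite [X in _ --> X](_ : _ = (0 * w x)%:E); last by rewrite mul0r.
  apply: cvg_EFin.
    exact: nearW.
  apply: cvgM; last exact: cvg_cst.
  rewrite -(@normr0 R R); apply: cvg_norm; rewrite -(subrr (g x)).
  by apply: cvgB => //; exact: cvg_cst.
- exact: iw.
- apply: aeW => x k _; rewrite lee_fin ger0_norm ?mulr_ge0//.
  by rewrite -[leRHS]mul1r ler_wpM2r.
move=> _ _; rewrite integral0 => /fine_cvgP[fin /cvgrPdist_le /(_ _ e0)].
move=> [N _ HN]; move: fin => [N' _ HN'].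
exists (maxn N N'); have := HN _ (leq_maxl N N'); rewrite sub0r normrN.
have h0 : (0 <= dist (f (maxn N N')) g)%E.
  by apply: integral_ge0 => x _; rewrite lee_fin mulr_ge0.
rewrite ger0_norm ?fine_ge0// => H.
by rewrite /dist -[leLHS]fineK ?lee_fin//; exact: HN' (leq_maxr N N').
Qed.

(** The sets with this property will be seen to contain the balls and to be closed under countable
    unions and complements, hence to include all Borel sets. *)
Let approximable (A : set 'rV[R]_n) := forall e, 0 < e -> exists phi,
  [/\ test_function phi, forall x, 0 <= phi x <= 1 &
      (dist phi (\1_A) <= e%:E)%E].

Let approximable_ball c r : 0 < r -> approximable (ball c r).
Proof.
move=> r0 e e0.
(* The bump is positive exactly on the ball, so these powers converge pointwise to the indicator of
   the ball; dominated convergence does the rest. *)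
pose f k (x : 'rV[R]_n) : R := 1 - (1 - box_bump c r x) ^+ k.
have f01 k x : 0 <= f k x <= 1.
  have := box_bump_ge0 c r x; have := box_bump_le1 c r x => b1 b0.
  apply/andP; split; first by rewrite /f subr_ge0 exprn_ile1 ?subr_ge0 ?gerBl.
  by rewrite /f gerBl exprn_ge0 ?subr_ge0.
have sf k : smooth (f k).
  rewrite (_ : f k = cst 1 + cst (-1) * (fun x => \prod_(i < k) (cst 1 + cst (-1) * box_bump c r) x)).
    apply: smoothD; first exact: smooth_cst.
    apply: smoothM; first exact: smooth_cst.
    apply: smooth_prod => i; apply: smoothD; first exact: smooth_cst.
    by apply: smoothM; [exact: smooth_cst|exact: smooth_box_bump].
  apply/funext => x; rewrite /f /GRing.add /GRing.mul/= prodr_const card_ord.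
  by rewrite !mulN1r.
have mball : measurable (ball c r) by apply: open_measurable_mx; exact: ball_open.
have m1 : measurable_fun setT (\1_(ball c r) : _ -> R) by exact: measurable_indic.
have tf k : test_function (f k).
  apply/test_functionP; split=> //; exists (`|c| + r) => x.
  rewrite /f; have [bx|] := boolP (0 < box_bump c r x).
    move=> _; move/(box_bump_gt0 c x r0) : bx => cx.
    have : ball_ Num.norm c r x by rewrite -mx_norm_ball.
    rewrite /ball_/= => cxr.
    by rewrite -[x](subrK c) addrC (le_trans (ler_normD _ _))// lerD2l distrC ltW.
  rewrite -leNgt => b0; rewrite (_ : box_bump c r x = 0).
    by rewrite subr0 expr1n subrr eqxx.
  by apply/eqP; rewrite eq_le b0 box_bump_ge0.
have [|||x|k Hk] := @dist_cvg f (\1_(ball c r)) e _ _ _ _ e0.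
- by move=> k; exact: measurable_test_function.
- by [].
- move=> k x; have /andP[? ?] := f01 k x; rewrite indicE ler_norml.
  by case: (x \in _) => /=; apply/andP; split; lra.
- rewrite indicE; have [xb|xb] := pselect (ball c r x).
    rewrite mem_set//; have /(box_bump_gt0 c x r0) b0 := xb.
    rewrite -[X in _ --> X]subr0; apply: cvgB; first exact: cvg_cst.
    apply: cvg_expr; have := box_bump_le1 c r x => b1.
    by rewrite ger0_norm ?subr_ge0// gtrBl.
  rewrite memNset//.
  have fk0 k : f k x = 0.
    rewrite /f (_ : box_bump c r x = 0) ?subr0 ?expr1n ?subrr//.
    apply/eqP; rewrite eq_le box_bump_ge0 andbT leNgt; apply/negP => bx.
    by apply: xb; apply/(box_bump_gt0 c x r0).
  by rewrite (_ : (fun k => f k x) = cst 0); [exact: cvg_cst|exact/funext].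
by exists (f k).
Qed.

Let indic_m (A : set 'rV[R]_n) : measurable A -> measurable_fun setT (\1_A : _ -> R).
Proof. by move=> mA; exact: measurable_indic. Qed.

Let approximable0 : approximable set0.
Proof.
move=> e e0; exists (cst 0); split.
- apply/test_functionP; split; first exact: smooth_cst.
  by exists 0 => x; rewrite eqxx.
- by move=> x; rewrite lexx ler01.
- rewrite /dist; under eq_integral do rewrite indic0 subrr normr0 mul0r.
  by rewrite integral0 lee_fin ltW.
Qed.

Let approximableU A B : measurable A -> measurable B ->
  approximable A -> approximable B -> approximable (A `|` B).
Proof.
move=> mA mB aA aB e e0; have e20 : 0 < e / 2 by rewrite divr_gt0.
have [f [tf f01 fA]] := aA _ e20; have [g [tg g01 gB]] := aB _ e20.
(* This is 1 - (1 - f)(1 - g), which stays in [0, 1] and imitates the indicator of a union. *)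
exists (f + g + cst (-1) * (f * g)); split.
- apply: test_functionD; first exact: test_functionD.
  apply: test_functionZ; apply: test_functionM => //; exact: test_function_smooth.
- move=> x; rewrite -[(f + g + _) x]/(f x + g x + -1 * (f x * g x)).
  have /andP[? ?] := f01 x; have /andP[? ?] := g01 x.
  by apply/andP; split; nra.
- rewrite (splitr e) EFinD; apply: (dist_le _ _ _ _ _ fA gB).
  + apply: measurable_funD.
      by apply: measurable_funD; exact: measurable_test_function.
    apply: measurable_funM => //.
    by apply: measurable_funM; exact: measurable_test_function.
  + by apply: indic_m; exact: measurableU.
  + by apply: measurable_funB; [exact: measurable_test_function|exact: indic_m].
  + by apply: measurable_funB; [exact: measurable_test_function|exact: indic_m].
  + move=> x; rewrite -[(f + g + _) x]/(f x + g x + -1 * (f x * g x)) !indicE in_setU.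
    have /andP[? ?] := f01 x; have /andP[? ?] := g01 x.
    rewrite (_ : `|f x - _| = if x \in A then 1 - f x else f x); last first.
      by case: (x \in A) => /=; [rewrite ler0_norm|rewrite subr0 ger0_norm]; lra.
    rewrite (_ : `|g x - _| = if x \in B then 1 - g x else g x); last first.
      by case: (x \in B) => /=; [rewrite ler0_norm|rewrite subr0 ger0_norm]; lra.
    rewrite ler_norml.
    have fg0 : 0 <= f x * g x by rewrite mulr_ge0.
    have fgf : f x * g x <= f x by rewrite ler_piMr.
    have fgg : f x * g x <= g x by rewrite ler_piMl.
    have fg1 : 0 <= (1 - f x) * (1 - g x) by rewrite mulr_ge0 ?subr_ge0.
    by case: (x \in A); case: (x \in B) => /=; rewrite ?mulr1n ?mulr0n;
      apply/andP; split; lra.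
Qed.

Let approximable_bigcup (A : (set 'rV[R]_n)^nat) : (forall k, measurable (A k)) ->
  (forall k, approximable (A k)) -> approximable (\bigcup_k A k).
Proof.
move=> mA aA e e0; have e20 : 0 < e / 2 by rewrite divr_gt0.
pose U N := \big[setU/set0]_(k < N) A k.
have mU N : measurable (U N) by exact: bigsetU_measurable.
have aU N : approximable (U N).
  elim: N => [|N IH]; first by rewrite /U big_ord0.
  by rewrite /U big_ord_recr/=; exact: (approximableU (mU N) (mA N) IH (aA N)).
have mUU : measurable (\bigcup_k A k) by exact: bigcupT_measurable.
have [|||x|N HN] := @dist_cvg (fun N => \1_(U N)) (\1_(\bigcup_k A k)) (e / 2) _ _ _ _ e20.
- by move=> k; exact: indic_m.
- exact: indic_m.
- by move=> k x; rewrite !indicE; do 2 case: (_ \in _); rewrite /= ?subrr ?normr0 ?subr0 ?sub0r ?normrN ?normr1.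
- rewrite !indicE; have [xA|xA] := pselect ((\bigcup_k A k) x).
    rewrite mem_set//; have [k _ Ak] := xA.
    apply: cvg_near_cst; exists k.+1 => // N /= kN; rewrite indicE mem_set//.
    by rewrite /U -bigcup_mkord; exists k.
  rewrite memNset// (_ : (fun _ => _) = cst 0); first exact: cvg_cst.
  apply/funext => N; rewrite indicE memNset// => UN; apply: xA.
  exact: bigsetU_bigcup UN.
have [f [tf f01 fU]] := aU N _ e20.
exists f; split => //; rewrite (splitr e) EFinD; apply: (dist_le _ _ _ _ _ fU HN).
- exact: measurable_test_function.
- exact: indic_m.
- by apply: measurable_funB; [exact: measurable_test_function|exact: indic_m].
- by apply: measurable_funB; exact: indic_m.
- by move=> x; rewrite -{1}(subrK (\1_(U N) x) (f x)) -addrA ler_normD.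
Qed.

Let approximable_open U : open U -> approximable U.
Proof.
move=> /open_bigcup_ball[c [r [r0 [P ->]]]]; rewrite bigcup_mkcond.
apply: approximable_bigcup => k; case: ifPn => _ //.
  by apply: open_measurable_mx; exact: ball_open.
exact: approximable_ball.
Qed.

Let approximableC A : measurable A -> approximable A -> approximable (~` A).
Proof.
move=> mA aA e e0; have e20 : 0 < e / 2 by rewrite divr_gt0.
(* The function 1 - f need not have bounded support; [g] is a cutoff close to 1 in the weighted
   distance. *)
have [f [tf f01 fA]] := aA _ e20; have [g [tg g01 gT]] := approximable_open openT e20.
exists (g * (cst 1 + cst (-1) * f)); split.
- apply: test_functionM => //; apply: smoothD; first exact: smooth_cst.
  by apply: smoothM; [exact: smooth_cst|exact: test_function_smooth].
- move=> x; rewrite -[(g * _) x]/(g x * (1 + -1 * f x)).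
  have /andP[? ?] := f01 x; have /andP[? ?] := g01 x.
  by apply/andP; split; nra.
- rewrite (splitr e) EFinD; apply: (dist_le _ _ _ _ _ fA gT).
  + apply: measurable_funM; first exact: measurable_test_function.
    apply: measurable_funD => //; apply: measurable_funM => //.
    exact: measurable_test_function.
  + by apply: indic_m; exact: measurableC.
  + by apply: measurable_funB; [exact: measurable_test_function|exact: indic_m].
  + by apply: measurable_funB; [exact: measurable_test_function|exact: indic_m].
  + move=> x; rewrite -[(g * _) x]/(g x * (1 + -1 * f x)) !indicE in_setC in_setT.
    have /andP[? ?] := f01 x; have /andP[? ?] := g01 x.
    rewrite (_ : `|f x - _| = if x \in A then 1 - f x else f x); last first.
      by case: (x \in A) => /=; [rewrite ler0_norm|rewrite subr0 ger0_norm]; lra.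
    rewrite (_ : `|g x - _| = 1 - g x); last by rewrite ler0_norm//=; lra.
    rewrite ler_norml.
    have fg0 : 0 <= g x * f x by rewrite mulr_ge0.
    have fgf : g x * f x <= f x by rewrite ler_piMl.
    have fgg : g x * f x <= g x by rewrite ler_piMr.
    have fg1 : 0 <= (1 - f x) * (1 - g x) by rewrite mulr_ge0 ?subr_ge0.
    by case: (x \in A) => /=; rewrite ?mulr1n ?mulr0n; apply/andP; split; lra.
Qed.

Lemma approx_indic_test_function A e : measurable A -> 0 < e -> exists phi,
  [/\ test_function phi, forall x, 0 <= phi x <= 1 &
      (\int[mu]_x (`|phi x - \1_A x| * w x)%:E <= e%:E)%E].
Proof.
move=> mA; move: e; suff : measurable A /\ approximable A by case.
have : [set B | measurable B /\ approximable B] A => //.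
apply: (smallest_sub _ _ mA); last first.
  by move=> U oU; split; [exact: open_measurable_mx|exact: approximable_open].
split => /=.
- by split; [exact: measurable0|exact: approximable0].
- by move=> B [mB aB]; rewrite setTD; split; [exact: measurableC|exact: approximableC].
- move=> F HF; split; first by apply: bigcupT_measurable => k; have [] := HF k.
  by apply: approximable_bigcup => k; have [] := HF k.
Qed.

End approximation_by_test_functions.

Section integrable_bounded_factor.
Context d (T : measurableType d) (R : realType).
Variable mu : {measure set T -> \bar R}.

Lemma integrable_mul_bounded (h g : T -> R) C :
  mu.-integrable setT (EFin \o h) -> measurable_fun setT g ->
  (forall x, `|g x| <= C) -> mu.-integrable setT (fun x => (h x * g x)%:E).
Proof.
move=> ih mg gC; apply: (@le_integrable _ _ _ mu setT measurableT _ (fun x => C%:E * (h x)%:E)%E).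
- apply/measurable_EFinP; apply: measurable_funM => //.
  by apply/measurable_EFinP; exact: measurable_int ih.
- move=> x _; rewrite -EFinM !abse_EFin lee_fin !normrM mulrC ler_wpM2r//.
  exact: le_trans (gC x) (ler_norm _).
- exact: (integrableZl measurableT C ih).
Qed.

End integrable_bounded_factor.

Section duality.
Context {R : realType} {n : nat}.
Variable mu : {measure set 'rV[R]_n -> \bar R}.

(** The test function imitates the sign of [h]: it is the difference of approximations of the
    indicators of {h >= 0} and of its complement, for the weight |h|. Bounds on pairings thereby
    become bounds on L^1 norms. *)
Lemma integral_abs_le_test_function (h : 'rV[R]_n -> R) e :
  mu.-integrable setT (EFin \o h) -> 0 < e -> exists phi,
  [/\ test_function phi, forall x, `|phi x| <= 1 &
      (\int[mu]_x (`|h x|%:E) <= \int[mu]_x (h x * phi x)%:E + e%:E)%E].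
Proof.
move=> ih e0; have e20 : 0 < e / 2 by rewrite divr_gt0.
have mh : measurable_fun setT h by apply/measurable_EFinP; exact: measurable_int ih.
have iw : mu.-integrable setT (EFin \o (fun x => `|h x|)) by exact: integrable_norm.
have w0 x : 0 <= `|h x| by [].
pose P := [set x | 0 <= h x].
have mP : measurable P.
  rewrite (_ : P = h @^-1` `[0, +oo[); last first.
    by apply/seteqP; split => x /=; rewrite in_itv/= andbT.
  by rewrite -[X in measurable X]setTI; exact: mh.
have [f [tf f01 fP]] := approx_indic_test_function w0 iw mP e20.
have [g [tg g01 gP]] := approx_indic_test_function w0 iw (measurableC mP) e20.
have mf := measurable_test_function tf; have mg := measurable_test_function tg.
exists (f + cst (-1) * g); split.
- by apply: test_functionD => //; exact: test_functionZ.
- move=> x; rewrite -[(f + _) x]/(f x + -1 * g x) ler_norml.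
  have /andP[? ?] := f01 x; have /andP[? ?] := g01 x.
  by apply/andP; split; lra.
have bnd (a : 'rV[R]_n -> R) (A : set 'rV[R]_n) : (forall x, 0 <= a x <= 1) ->
    forall x, `| `|a x - \1_A x| | <= 1.
  move=> a01 x; have /andP[? ?] := a01 x; rewrite normr_id indicE ler_norml.
  by case: (x \in A) => /=; rewrite ?mulr1n ?mulr0n; apply/andP; split; lra.
have mdiff (a : 'rV[R]_n -> R) (A : set 'rV[R]_n) : measurable_fun setT a ->
    measurable A -> measurable_fun setT (fun x => `|a x - \1_A x|).
  move=> ma mA; apply: measurableT_comp => //; apply: measurable_funB => //.
have if_ : mu.-integrable setT (fun x => (`|f x - \1_P x| * `|h x|)%:E).
  under eq_fun do rewrite mulrC.
  by apply: (integrable_mul_bounded iw (mdiff _ _ mf mP)) (bnd _ _ f01).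
have ig_ : mu.-integrable setT (fun x => (`|g x - \1_(~` P) x| * `|h x|)%:E).
  under eq_fun do rewrite mulrC.
  by apply: (integrable_mul_bounded iw (mdiff _ _ mg (measurableC mP))) (bnd _ _ g01).
have ihphi : mu.-integrable setT (fun x => (h x * (f + cst (-1) * g) x)%:E).
  apply: (@integrable_mul_bounded _ _ _ mu h _ 1 ih).
    apply: measurable_funD => //; exact: measurable_funM.
  move=> x; rewrite -[(f + _) x]/(f x + -1 * g x) ler_norml.
  have /andP[? ?] := f01 x; have /andP[? ?] := g01 x.
  by apply/andP; split; lra.
rewrite (splitr e) EFinD.
apply: (@le_trans _ _ (\int[mu]_x ((h x * (f + cst (-1) * g) x)%:E +
  ((`|f x - \1_P x| * `|h x|)%:E + (`|g x - \1_(~` P) x| * `|h x|)%:E)))%E); last first.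
  rewrite integralD//; last exact: integrableD.
  by rewrite leeD2l// integralD//; exact: leeD.
apply: le_integral => //.
- by apply: integrableD => //; exact: integrableD.
- move=> x _; rewrite -!EFinD lee_fin -[(f + _) x]/(f x + -1 * g x) !indicE in_setC.
  have /andP[? ?] := f01 x; have /andP[? ?] := g01 x.
  have [hx|hx] := leP 0 (h x).
    rewrite mem_set//= ger0_norm// ler0_norm ?subr_le0// subr0 ger0_norm//.
    by lra.
  rewrite memNset/=; last by rewrite /P/=; apply/negP; rewrite -ltNge.
  rewrite ltr0_norm// subr0 ger0_norm// ler0_norm ?subr_le0//.
  by lra.
Qed.

End duality.

(** * Induction on bounded measurable functions and integration against charges *)

Section bounded_measurable.
Context d (T : measurableType d) (R : realType).

(** The sum is [e] times the minimum of [K] and the integer part of y / e; the third claim is what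
    carries the induction. *)
Lemma layer_sum_approx (e y : R) K : 0 < e -> 0 <= y ->
  let S := (\sum_(k < K) e * ((k.+1%:R * e <= y)%R)%:R)%R in
  [/\ S <= y, y <= K%:R * e -> y - e <= S & K%:R * e <= y -> S = K%:R * e].
Proof.
move=> e0 y0; elim: K => [|K [IH1 IH2 IH3]] /=.
  rewrite big_ord0 mul0r; split => // h; lra.
rewrite big_ord_recr/=; have eK : K.+1%:R * e = K%:R * e + e.
  by rewrite -natr1 mulrDl mul1r.
have [h|h] := leP (K.+1%:R * e) y.
  have -> : \sum_(k < K) e * ((k.+1%:R * e <= y)%R)%:R = K%:R * e.
    by apply: IH3; lra.
  by rewrite mulr1; split; lra.
rewrite mulr0 addr0; split=> [//|_|h']; last by exfalso; lra.
have [h2|h2] := leP y (K%:R * e); first exact: IH2.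
by rewrite IH3; lra.
Qed.

(** Layer sums approximate a bounded function uniformly. The function is first raised by the bound
    [C] to make it nonnegative, and the constant is subtracted again through [\1_setT]. *)
Lemma bounded_measurable_ind (P : (T -> R) -> Prop) :
  (forall A, measurable A -> P (\1_A)) ->
  (forall f g, P f -> P g -> P (fun x => f x + g x)) ->
  (forall c f, P f -> P (fun x => c * f x)) ->
  (forall f : T -> R, measurable_fun setT f -> (forall e, 0 < e -> exists2 g, P g &
     forall x, `|f x - g x| <= e) -> P f) ->
  forall (f : T -> R) C, measurable_fun setT f -> (forall x, `|f x| <= C) -> P f.
Proof.
move=> Pind PD PZ Plim f C mf fC; apply: Plim => // e e0.
pose A (k : nat) := [set x | k.+1%:R * e <= f x + C].
have mA k : measurable (A k).
  rewrite (_ : A k = (fun x => f x + C) @^-1` `[k.+1%:R * e, +oo[).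
    by rewrite -[X in measurable X]setTI; exact: measurable_funD.
  by apply/seteqP; split => x /=; rewrite in_itv/= andbT.
(* Since [f x + C] is at most 2C, this many layers of height [e] reach above it. *)
pose K := (Num.truncn (2 * C / e)).+1.
exists (fun x => (fun x => \sum_(k < K) (e * \1_(A k) x)) x + - C * \1_setT x).
  apply: (PD); last by apply: (PZ); exact: Pind.
  elim: K => [|K IH].
    rewrite (_ : (fun x => _) = fun x => 0 * \1_set0 x); first by apply: (PZ); exact: Pind.
    by apply/funext => x; rewrite big_ord0 mul0r.
  rewrite (_ : (fun x => _) = fun x => (fun x => \sum_(k < K) (e * \1_(A k) x)) x +
      (fun x => e * \1_(A K) x) x).
    by apply: (PD) => //; apply: (PZ); exact: Pind.
  by apply/funext => x; rewrite big_ord_recr.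
move=> x; have := fC x; rewrite ler_norml => /andP[C1 C2].
have y0 : 0 <= f x + C by lra.
have yK : f x + C <= K%:R * e.
  rewrite -ler_pdivrMr//; apply: (@le_trans _ _ (2 * C / e)); last first.
    exact/ltW/truncnS_gt.
  by rewrite ler_pM2r ?invr_gt0//; lra.
have [S1 /(_ yK) S2 _] := layer_sum_approx K e0 y0.
rewrite indicT mulr1 (_ : \sum_(k < K) _ = \sum_(k < K) e * ((k.+1%:R * e <= f x + C)%R)%:R).
  by rewrite ler_norml; apply/andP; split; lra.
apply: eq_bigr => k _; rewrite indicE.
have [h|/negP h] := boolP (k.+1%:R * e <= f x + C); first by rewrite mem_set.
by rewrite memNset.
Qed.

End bounded_measurable.

Section charge_integral_theory.
Context d (T : measurableType d) (R : realType).

(** Hides the Hahn decomposition selected inside [charge_integral]: afterwards the integral is a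
    difference of integrals against two finite measures, whatever the selection. *)
Lemma charge_integral_jordan (nu : {charge set T -> \bar R}) :
  exists p q : {finite_measure set T -> \bar R},
    (forall g, charge_integral nu g = \int[p]_x g x - \int[q]_x g x)%E /\
    (forall A, measurable A -> nu A = p A - q A)%E.
Proof.
rewrite /charge_integral; case: cid => P hP; case: cid => N nuPN.
exists (jordan_pos nuPN), (jordan_neg nuPN); split => // A mA.
by rewrite (jordan_decomp nuPN mA) /cadd/= cscaleN1.
Qed.

Definition cintegral (nu : {charge set T -> \bar R}) (g : T -> R) : R :=
  fine (charge_integral nu (EFin \o g)).

Lemma bounded_integrable (p : {finite_measure set T -> \bar R}) (g : T -> R) C :
  measurable_fun setT g -> (forall x, `|g x| <= C) -> p.-integrable setT (EFin \o g).
Proof.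
move=> mg gC; apply: measurable_bounded_integrable => //.
  by rewrite -ge0_fin_numE// fin_num_measure.
exists C; split; first exact: num_real.
by move=> M CM x _ /=; apply: le_trans (gC x) (ltW CM).
Qed.

Definition bmeas (f : T -> R) := measurable_fun setT f /\ exists C, forall x, `|f x| <= C.

Lemma bmeas_indic (A : set T) : measurable A -> bmeas \1_A.
Proof.
move=> mA; split; first exact: measurable_indic.
by exists 1 => x; rewrite indicE; case: (_ \in _); rewrite ?normr1 ?normr0.
Qed.

Lemma bmeasD f g : bmeas f -> bmeas g -> bmeas (fun x => f x + g x).
Proof.
move=> [mf [C HC]] [mg [D HD]]; split; first exact: measurable_funD.
by exists (C + D) => x; rewrite (le_trans (ler_normD _ _))// lerD.
Qed.

Lemma bmeasZ c f : bmeas f -> bmeas (fun x => c * f x).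
Proof.
move=> [mf [C HC]]; split; first by apply: measurable_funM => //; exact: measurable_cst.
by exists (`|c| * C) => x; rewrite normrM ler_wpM2l.
Qed.

Lemma bmeasB f g : bmeas f -> bmeas g -> bmeas (fun x => f x - g x).
Proof.
move=> bf bg; rewrite (_ : (fun x => _) = fun x => f x + (-1 * g x)).
  by apply: bmeasD => //; exact: bmeasZ.
by apply/funext => x; rewrite mulN1r.
Qed.

Lemma bmeas_norm f : bmeas f -> bmeas (fun x => `|f x|).
Proof.
move=> [mf [C HC]]; split; first exact: measurableT_comp.
by exists C => x; rewrite normr_id.
Qed.

Lemma bmeas_integrable (p : {finite_measure set T -> \bar R}) f :
  bmeas f -> p.-integrable setT (EFin \o f).
Proof. by move=> [mf [C HC]]; exact: bounded_integrable HC. Qed.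

Lemma bmeas_integrableM (mu : {measure set T -> \bar R}) f s :
  bmeas f -> mu.-integrable setT (EFin \o s) ->
  mu.-integrable setT (EFin \o (fun x => f x * s x)).
Proof.
move=> [mf [C HC]] is_; have := integrable_mul_bounded is_ mf HC.
by congr (_.-integrable _ _); apply/funext => x /=; rewrite mulrC.
Qed.

Lemma Rintegral_lipschitz (mu : {measure set T -> \bar R}) f s e :
  bmeas f -> mu.-integrable setT (EFin \o s) -> (forall x, `|f x| <= e) ->
  `|\int[mu]_x (f x * s x)| <= e * \int[mu]_x `|s x|.
Proof.
move=> bf is_ fe; have ifs := bmeas_integrableM bf is_.
have in_ := @integrable_norm _ _ _ mu _ _ is_.
rewrite (le_trans (le_normr_Rintegral measurableT ifs))//.
rewrite -RintegralZl//; apply: le_Rintegral => //.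
- exact: (@integrable_norm _ _ _ mu _ _ ifs).
- exact: (integrableZl measurableT e in_).
- by move=> x _; rewrite normrM ler_wpM2r.
Qed.

Section cintegral.
Variable nu : {charge set T -> \bar R}.

Lemma charge_integral_cintegral f : bmeas f ->
  charge_integral nu (EFin \o f) = (cintegral nu f)%:E.
Proof.
move=> bf; rewrite /cintegral fineK//.
have [p [q [-> _]]] := charge_integral_jordan nu.
by rewrite fin_numB !integrable_fin_num//; exact: bmeas_integrable.
Qed.

Let cintegralE : exists p q : {finite_measure set T -> \bar R},
  (forall f, bmeas f -> cintegral nu f = \int[p]_x f x - \int[q]_x f x) /\
  (forall A, measurable A -> nu A = p A - q A)%E.
Proof.
have [p [q [E HA]]] := charge_integral_jordan nu; exists p, q; split => // f bf.
rewrite /cintegral E fineB// ?integrable_fin_num//; exact: bmeas_integrable.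
Qed.

Lemma cintegralD f g : bmeas f -> bmeas g ->
  cintegral nu (fun x => f x + g x) = cintegral nu f + cintegral nu g.
Proof.
move=> bf bg; have [p [q [E _]]] := cintegralE.
rewrite !E//; last exact: bmeasD.
rewrite !RintegralD//; first ring.
all: exact: bmeas_integrable.
Qed.

Lemma cintegralZ c f : bmeas f ->
  cintegral nu (fun x => c * f x) = c * cintegral nu f.
Proof.
move=> bf; have [p [q [E _]]] := cintegralE.
rewrite !E//; last exact: bmeasZ.
rewrite !RintegralZl//; first ring.
all: exact: bmeas_integrable.
Qed.

Lemma cintegral_indic A : measurable A -> cintegral nu \1_A = fine (nu A).
Proof.
move=> mA; have [p [q [E ->//]]] := cintegralE.
rewrite E; last exact: bmeas_indic.
by rewrite /Rintegral !integral_indic// !setIT fineB// fin_num_measure.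
Qed.

(** The constant is the total mass of the two Jordan parts. This is the continuity that the uniform
    limit case of [bounded_measurable_ind] asks for. *)
Lemma cintegral_lipschitz : exists2 C, 0 <= C &
  forall f e, bmeas f -> (forall x, `|f x| <= e) -> `|cintegral nu f| <= C * e.
Proof.
have [p [q [E _]]] := cintegralE.
have bnd (r : {finite_measure set T -> \bar R}) f e : bmeas f -> (forall x, `|f x| <= e) ->
    `|\int[r]_x f x| <= fine (r setT) * e.
  move=> bf fe; have i1 : r.-integrable setT (EFin \o (cst 1)).
    by apply: bmeas_integrable; split => //; exists 1 => x; rewrite normr1.
  have := Rintegral_lipschitz bf i1 fe.
  rewrite (_ : \int[r]_x `|cst 1 x| = fine (r setT)).
    by under eq_Rintegral do rewrite mulr1; rewrite mulrC.
  by under eq_Rintegral do rewrite normr1; rewrite Rintegral_cst// mul1r.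
exists (fine (p setT) + fine (q setT)); first by rewrite addr_ge0// fine_ge0.
move=> f e bf fe; rewrite E// (le_trans (ler_normB _ _))// mulrDl lerD//; exact: bnd.
Qed.

(** Transfers a density from sets to functions by induction on bounded measurable functions; with
    Radon-Nikodym it turns integrals against the components of Df into integrals against |Df|. *)
Lemma cintegral_density (mu : {measure set T -> \bar R}) (s : T -> R) :
  mu.-integrable setT (EFin \o s) ->
  (forall A, measurable A -> nu A = \int[mu]_(x in A) (s x)%:E)%E ->
  forall f, bmeas f -> cintegral nu f = \int[mu]_x (f x * s x).
Proof.
move=> is_ nuE f bf; have [mf [C HC]] := bf.
suff [] : bmeas f /\ cintegral nu f = \int[mu]_x (f x * s x) by [].
apply: (@bounded_measurable_ind _ _ _ (fun f => bmeas f /\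
  cintegral nu f = \int[mu]_x (f x * s x)) _ _ _ _ f C mf HC) => {bf f C mf HC}.
- move=> A mA; split; first exact: bmeas_indic.
  rewrite cintegral_indic// nuE// /Rintegral integral_mkcond.
  congr fine; apply: eq_integral => x _; rewrite patchE indicE.
  by case: (x \in A); rewrite ?mul1r ?mul0r.
- move=> f g [bf ef] [bg eg]; split; first exact: bmeasD.
  rewrite cintegralD// ef eg -RintegralD//; [|exact: bmeas_integrableM..].
  by apply: eq_Rintegral => x _; rewrite mulrDl.
- move=> c f [bf ef]; split; first exact: bmeasZ.
  rewrite cintegralZ// ef -RintegralZl//; last exact: bmeas_integrableM.
  by apply: eq_Rintegral => x _; rewrite mulrA.
- move=> f mf H; have bf : bmeas f.
    split => //; have [g [[_ [C HC]] _] fg] := H _ ltr01.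
    exists (1 + C) => x; rewrite -[f x](subrK (g x)).
    by rewrite (le_trans (ler_normD _ _))// lerD.
  split => //; have [C C0 HC] := cintegral_lipschitz.
  pose M := C + \int[mu]_x `|s x|.
  have M0 : 0 <= M by rewrite addr_ge0// Rintegral_ge0.
  apply/eqP; rewrite -subr_eq0 -normr_eq0; apply/eqP.
  apply/le_anti; rewrite normr_ge0 andbT; apply/ler_addgt0Pl => e e0; rewrite addr0.
  have [g [bg eg] fg] := H (e / (M + 1)) (divr_gt0 e0 (ltr_wpDl M0 ltr01)).
  have bh := bmeasB bf bg.
  have -> : cintegral nu f - \int[mu]_x (f x * s x) =
      cintegral nu (fun x => f x - g x) - \int[mu]_x ((f x - g x) * s x).
    have -> : cintegral nu f = cintegral nu (fun x => f x - g x) + cintegral nu g.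
      by rewrite -cintegralD//; congr cintegral; apply/funext => x; rewrite subrK.
    have -> : \int[mu]_x (f x * s x) = \int[mu]_x ((f x - g x) * s x) + \int[mu]_x (g x * s x).
      rewrite -RintegralD//; [|exact: bmeas_integrableM..].
      by apply: eq_Rintegral => x _; rewrite -mulrDl subrK.
    by rewrite eg; ring.
  rewrite (le_trans (ler_normB _ _))//.
  apply: (@le_trans _ _ (e / (M + 1) * M)); last first.
    by rewrite mulrAC ler_pdivrMr ?ltr_wpDl// ler_pM2l// lerDl.
  rewrite [leRHS]mulrDr lerD//; first by rewrite mulrC; exact: HC.
  exact: Rintegral_lipschitz.
Qed.

End cintegral.

End charge_integral_theory.

(** * Functionals dominated by finite measures *)

Section dominated_functional.
Context {R : realType} {n : nat}.
Variable m : {finite_measure set 'rV[R]_n -> \bar R}.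
Variable L : ('rV[R]_n -> R) -> R.
Hypothesis LD : forall phi psi, test_function phi -> test_function psi ->
  L (phi + psi) = L phi + L psi.
Hypothesis LZ : forall c phi, test_function phi -> L (cst c * phi) = c * L phi.
Hypothesis Lm : forall phi, test_function phi -> `|L phi| <= \int[m]_x `|phi x|.

Lemma test_function_bmeas (phi : 'rV[R]_n -> R) : test_function phi -> bmeas phi.
Proof.
move=> tphi; split; first exact: measurable_test_function.
by have [C _ HC] := test_function_bounded tphi; exists C.
Qed.

Let dist (f g : 'rV[R]_n -> R) : R := \int[m]_x `|f x - g x|.

Let dist_le f g h k : bmeas f -> bmeas g -> bmeas h -> bmeas k ->
  (forall x, `|f x - g x| <= `|h x| + `|k x|) ->
  dist f g <= \int[m]_x `|h x| + \int[m]_x `|k x|.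
Proof.
move=> bf bg bh bk fghk; rewrite -RintegralD//; last 2 first.
  exact/bmeas_integrable/bmeas_norm.
  exact/bmeas_integrable/bmeas_norm.
apply: le_Rintegral => //.
  exact/bmeas_integrable/bmeas_norm/bmeasB.
by apply: bmeas_integrable; apply: bmeasD; exact: bmeas_norm.
Qed.

Let distC f g : dist f g = dist g f.
Proof. by apply: eq_Rintegral => x _; rewrite distrC. Qed.

Let dist_tri f g h : bmeas f -> bmeas g -> bmeas h -> dist f h <= dist f g + dist g h.
Proof.
move=> bf bg bh; apply: dist_le => //; [exact: bmeasB|exact: bmeasB|].
by move=> x; rewrite (le_trans _ (ler_normD _ _))// addrA subrK.
Qed.

Let L_lip (phi psi : 'rV[R]_n -> R) : test_function phi -> test_function psi ->
  `|L phi - L psi| <= dist phi psi.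
Proof.
move=> tphi tpsi; have tN := test_functionZ (-1) tpsi.
have -> : L phi - L psi = L (phi + cst (-1) * psi) by rewrite LD// LZ// mulN1r.
rewrite (le_trans (Lm (test_functionD tphi tN)))//.
rewrite le_eqVlt; apply/orP; left; apply/eqP; apply: eq_Rintegral => x _.
by rewrite -[(phi + _) x]/(phi x + -1 * psi x) mulN1r.
Qed.

Let approx A e : measurable A -> 0 < e ->
  exists2 phi, test_function phi & dist phi \1_A <= e.
Proof.
move=> mA e0; have i1 : m.-integrable setT (EFin \o (cst 1)).
  by apply: bmeas_integrable; split => //; exists 1 => x; rewrite normr1.
have [phi [tphi _ H]] := approx_indic_test_function (fun=> ler01) i1 mA e0.
exists phi => //; rewrite -lee_fin; apply: le_trans H.
rewrite /dist /Rintegral fineK; last first.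
  apply: integrable_fin_num => //; apply: bmeas_integrable; apply: bmeas_norm.
  by apply: bmeasB; [exact: test_function_bmeas|exact: bmeas_indic].
by under [leRHS]eq_integral do rewrite mulr1.
Qed.

(* McShane's formula for the extension of the 1-Lipschitz functional L from the
   test functions to the indicators, in the L^1(m) distance. *)
Let ext (A : set 'rV[R]_n) : R :=
  sup [set L phi - dist phi \1_A | phi in test_function].

Let test0 : test_function (cst 0 : 'rV[R]_n -> R).
Proof.
apply/test_functionP; split; first exact: smooth_cst.
by exists 0 => x; rewrite eqxx.
Qed.

(** By the Lipschitz bound on [L] and the triangle inequality through the indicator, every term of
    the supremum is at most [L phi + dist phi \1_A]; the term of [phi] itself gives the lower
    bound. *)
Let ext_approx A phi : measurable A -> test_function phi ->
  `|ext A - L phi| <= dist phi \1_A.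
Proof.
move=> mA tphi; have bA := bmeas_indic R mA.
have ubA : ubound [set L psi - dist psi \1_A | psi in test_function] (L phi + dist phi \1_A).
  move=> _ [psi tpsi <-]; rewrite lerBlDr.
  have : L psi - L phi <= dist psi phi by rewrite (le_trans (ler_norm _))// L_lip.
  have := dist_tri (test_function_bmeas tpsi) bA (test_function_bmeas tphi).
  by rewrite [dist \1_A phi]distC; lra.
rewrite ler_norml; apply/andP; split.
  rewrite lerBrDr addrC; apply: ub_le_sup; first by exists (L phi + dist phi \1_A).
  by exists phi.
rewrite lerBlDl; apply: ge_sup => //.
by exists (L (cst 0) - dist (cst 0) \1_A); exists (cst 0).
Qed.

(** The domination survives the extension. Countable additivity will be inherited from [m] through
    it. *)
Let ext_le A : measurable A -> `|ext A| <= fine (m A).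
Proof.
move=> mA; apply/ler_addgt0Pl => e e0; have e20 : 0 < e / 2 by rewrite divr_gt0.
have [phi tphi Hphi] := approx mA e20.
have h1 := ext_approx mA tphi; have h2 := Lm tphi.
have h3 : \int[m]_x `|phi x| <= dist phi \1_A + fine (m A).
  have -> : fine (m A) = \int[m]_x `|\1_A x|.
    rewrite /Rintegral -[in LHS](setIT A) -integral_indic//; congr fine.
    by apply: eq_integral => x _; rewrite ger0_norm.
  have := @dist_le phi (cst 0) (fun x => phi x - \1_A x) \1_A.
  rewrite [dist phi (cst 0)](_ : _ = \int[m]_x `|phi x|); last first.
    by apply: eq_Rintegral => x _; rewrite subr0.
  apply.
  - exact: test_function_bmeas.
  - exact: test_function_bmeas.
  - by apply: bmeasB; [exact: test_function_bmeas|exact: bmeas_indic].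
  - exact: bmeas_indic.
  - by move=> x; rewrite subr0 -{1}(subrK (\1_A x) (phi x)) ler_normD.
have -> : ext A = (ext A - L phi) + L phi by rewrite subrK.
by rewrite (le_trans (ler_normD _ _))//; lra.
Qed.

Let ext0 : ext set0 = 0.
Proof.
by apply/eqP; rewrite -normr_le0 (le_trans (ext_le measurable0))// measure0.
Qed.

(** For disjoint sets the sum of two approximants approximates the indicator of the union, and [L]
    is additive on test functions. *)
Let extU A B : measurable A -> measurable B -> A `&` B = set0 ->
  ext (A `|` B) = ext A + ext B.
Proof.
move=> mA mB AB; apply/eqP; rewrite -subr_eq0 -normr_le0; apply/ler_addgt0Pl => e e0.
have e40 : 0 < e / 4 by rewrite divr_gt0.
have [f tf fA] := approx mA e40; have [g tg gB] := approx mB e40.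
have h1 := ext_approx mA tf; have h2 := ext_approx mB tg.
have h3 := ext_approx (measurableU _ _ mA mB) (test_functionD tf tg).
have h4 : dist (f + g) \1_(A `|` B) <= dist f \1_A + dist g \1_B.
  apply: dist_le.
  - exact/test_function_bmeas/test_functionD.
  - exact/bmeas_indic/measurableU.
  - by apply: bmeasB; [exact: test_function_bmeas|exact: bmeas_indic].
  - by apply: bmeasB; [exact: test_function_bmeas|exact: bmeas_indic].
  - move=> x; rewrite -[(f + g) x]/(f x + g x).
    have -> : \1_(A `|` B) x = \1_A x + \1_B x :> R.
      rewrite !indicE in_setU; case: (boolP (x \in A)) => xA; case: (boolP (x \in B)) => xB //=;
        rewrite ?addr0 ?add0r//.
      by move: xA xB; rewrite !inE => xA xB; have : (A `&` B) x by []; rewrite AB.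
    by rewrite opprD addrACA ler_normD.
rewrite LD// in h3.
have -> : ext (A `|` B) - (ext A + ext B) = (ext (A `|` B) - (L f + L g)) -
   ((ext A - L f) + (ext B - L g)) by ring.
rewrite addr0 (le_trans (ler_normB _ _))//.
rewrite (splitr e) lerD//; first by lra.
by rewrite (le_trans (ler_normD _ _))//; lra.
Qed.

Let D (A : set 'rV[R]_n) : \bar R := (ext A)%:E.

Let D0 : D set0 = 0%E.
Proof. by rewrite /D ext0. Qed.

Let D_fin : fin_num_fun D.
Proof. by []. Qed.

(** By finite additivity the error after [k] terms is the value on the remaining set, which [m]
    bounds and which has measure tending to 0. *)
Let D_sigma : semi_sigma_additive D.
Proof.
move=> F mF tF mU; pose U k := \big[setU/set0]_(i < k) F i.
have mUk k : measurable (U k) by exact: bigsetU_measurable.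
have sumE k : (\sum_(0 <= i < k) D (F i))%E = (ext (U k))%:E.
  elim: k => [|k IH]; first by rewrite big_geq// /U big_ord0 ext0.
  rewrite big_nat_recr//= IH /U big_ord_recr/= extU//; first exact: mUk.
  rewrite big_distrl/= big1// => i _.
  by move/trivIsetP : tF => /(_ i k Logic.I Logic.I); apply; rewrite neq_ltn ltn_ord.
have splitU k : ext (\bigcup_i F i) = ext (U k) + ext (\bigcup_i F i `\` U k).
  rewrite -extU//; [|exact: measurableD|by rewrite setIDA setIC -setIDA setDv setI0].
  congr ext; rewrite setDUK//; exact: bigsetU_bigcup.
have cvm : fine (m (U k)) @[k --> \oo] --> fine (m (\bigcup_i F i)).
  apply: fine_cvg; rewrite fineK ?fin_num_measure//.
  rewrite (_ : \bigcup_i F i = \bigcup_k U k); last first.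
    apply/seteqP; split => x [k _ xk]; last exact: bigsetU_bigcup xk.
    by exists k.+1 => //; rewrite /U big_ord_recr/=; right.
  apply: nondecreasing_cvg_mu => //; first exact: bigcupT_measurable.
  by move=> j k jk; apply/subsetPset; exact: subset_bigsetU.
rewrite (_ : (fun k => _) = (fun k => (ext (U k))%:E)); last exact/funext.
apply: cvg_EFin; first exact: nearW.
apply/cvgrPdist_le => e e0; have /cvgrPdist_le/(_ _ e0) := cvm.
apply: filterS => k /=; rewrite (splitU k) addrAC subrr add0r => H.
rewrite (le_trans (ext_le _))//; first exact: measurableD.
rewrite measureD//; last by rewrite ltey_eq fin_num_measure.
rewrite setIidr; last exact: bigsetU_bigcup.
by rewrite fineB ?fin_num_measure// (le_trans (ler_norm _)).
Qed.

(** A Riesz representation: a linear functional that is Lipschitz for the L^1(m) distance extends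
    from the dense test functions to indicators, where it is a charge. *)
Lemma dominated_functional_charge : exists nu : {charge set 'rV[R]_n -> \bar R},
  forall phi, test_function phi -> charge_integral nu (EFin \o phi) = (L phi)%:E.
Proof.
pose nu : {charge set 'rV[R]_n -> \bar R} :=
  HB.pack D (isCharge.Build _ _ _ D D0 D_fin D_sigma).
exists nu => phi tphi; have bphi := test_function_bmeas tphi.
rewrite charge_integral_cintegral//; congr EFin.
(* One and the same [psi] is close to [h] in L^1(m) and has [L psi] close to the integral of [h].
   For a test function [h], the Lipschitz bound then compares [L psi] with [L h]. *)
pose good (h : 'rV[R]_n -> R) := bmeas h /\ forall e, 0 < e ->
  exists2 psi, test_function psi & dist psi h <= e /\ `|cintegral nu h - L psi| <= e.
suff [_ H] : good phi.
  apply/eqP; rewrite -subr_eq0 -normr_le0; apply/ler_addgt0Pl => e e0; rewrite addr0.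
  have e20 : 0 < e / 2 by rewrite divr_gt0.
  have [psi tpsi [h1 h2]] := H _ e20.
  have h3 := L_lip tpsi tphi.
  have -> : cintegral nu phi - L phi = (cintegral nu phi - L psi) + (L psi - L phi) by ring.
  by rewrite (le_trans (ler_normD _ _))//; lra.
have [mphi [C HC]] := bphi.
apply: (@bounded_measurable_ind _ _ _ good _ _ _ _ phi C mphi HC) => {phi tphi bphi C mphi HC}.
- move=> A mA; split=> [|e e0]; first exact: bmeas_indic.
  have [psi tpsi Hpsi] := approx mA e0; exists psi => //; split => //.
  by rewrite cintegral_indic//= (le_trans (ext_approx mA tpsi)).
- move=> f g [bf Hf] [bg Hg]; split=> [|e e0]; first exact: bmeasD.
  have e20 : 0 < e / 2 by rewrite divr_gt0.
  have [psi tpsi [h1 h2]] := Hf _ e20; have [psi' tpsi' [h1' h2']] := Hg _ e20.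
  exists (psi + psi'); first exact: test_functionD.
  split.
    rewrite (splitr e) (le_trans (dist_le (h := fun x => psi x - f x) (k := fun x => psi' x - g x)  _ _ _ _ _))//.
    + exact/test_function_bmeas/test_functionD.
    + exact: bmeasD.
    + by apply: bmeasB => //; exact: test_function_bmeas.
    + by apply: bmeasB => //; exact: test_function_bmeas.
    + by move=> x; rewrite -[(psi + psi') x]/(psi x + psi' x) opprD addrACA ler_normD.
    + exact: lerD.
  rewrite cintegralD// LD// opprD addrACA (le_trans (ler_normD _ _))//.
  by rewrite (splitr e) lerD.
- move=> c f [bf Hf]; split=> [|e e0]; first exact: bmeasZ.
  have c0 : 0 < e / (`|c| + 1) by rewrite divr_gt0// ltr_wpDl.
  have ce : `|c| * (e / (`|c| + 1)) <= e.
    by rewrite mulrA ler_pdivrMr ?ltr_wpDl// mulrC ler_pM2l// lerDl.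
  have [psi tpsi [h1 h2]] := Hf _ c0.
  exists (cst c * psi); first exact: test_functionZ.
  split.
    rewrite (le_trans _ ce)// (le_trans _ (ler_wpM2l _ h1))// -RintegralZl//.
      rewrite le_eqVlt; apply/orP; left; apply/eqP; apply: eq_Rintegral => x _.
      by rewrite -[(cst c * psi) x]/(c * psi x) -mulrBr normrM.
    by apply/bmeas_integrable/bmeas_norm/bmeasB => //; exact: test_function_bmeas.
  by rewrite cintegralZ// LZ// -mulrBr normrM (le_trans _ ce)// ler_wpM2l.
- move=> f mf H; have bf : bmeas f.
    split => //; have [g [[_ [C HC]] _] fg] := H _ ltr01.
    exists (1 + C) => x; rewrite -[f x](subrK (g x)).
    by rewrite (le_trans (ler_normD _ _))// lerD.
  split => // e e0; have [C C0 HC] := cintegral_lipschitz nu.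
  pose M := 1 + C + fine (m setT).
  have M0 : 0 < M by rewrite !ltr_wpDr ?fine_ge0.
  pose d := e / 2 / M; have d0 : 0 < d by rewrite !divr_gt0.
  have [g [bg Hg] fg] := H _ d0.
  have [psi tpsi [h1 h2]] := Hg (e / 2) (divr_gt0 e0 (ltr0n _ 2)).
  exists psi => //.
  have dM c : 0 <= c <= M -> c * d <= e / 2.
    move=> /andP[c0 cM]; rewrite /d mulrA ler_pdivrMr// mulrC ler_wpM2l//.
    by rewrite divr_ge0// ltW.
  split.
    rewrite (splitr e) (le_trans (dist_tri (test_function_bmeas tpsi) bg bf))// lerD//.
    rewrite distC.
    have fgd : dist f g <= \int[m]_x d.
      apply: le_Rintegral => //; first exact/bmeas_integrable/bmeas_norm/bmeasB.
      by apply: bmeas_integrable; split => //; exists `|d|.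
    rewrite (le_trans fgd)// Rintegral_cst//.
    rewrite mulrC dM// fine_ge0//= /M lerDr addr_ge0//.
  have -> : cintegral nu f - L psi = cintegral nu (fun x => f x - g x) + (cintegral nu g - L psi).
    rewrite addrA; congr (_ - _); rewrite -cintegralD//; last exact: bmeasB.
    by congr cintegral; apply/funext => x; rewrite subrK.
  rewrite (le_trans (ler_normD _ _))// (splitr e) lerD//.
  rewrite (le_trans (HC _ _ (bmeasB bf bg) fg))// dM// C0/= /M.
  by rewrite -addrA addrCA lerDl addr_ge0// fine_ge0.
Qed.

End dominated_functional.

(** * Directional variation and difference quotients *)

Section variation_measure_dominates.
Context d (T : measurableType d) {R : realType} {n : nat}.
Variable D : 'I_n -> {charge set T -> \bar R}.

Lemma charge_dominated_variation_measure i : D i `<< variation_measure D.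
Proof.
apply/null_content_dominatesP => A mA VA0.
(* The set [A] padded with empty sets is an admissible family, so the norm of the vector of charges
   of [A] is at most its variation. *)
pose E (k : nat) := if k is 0 then A else set0.
have : (\sum_(0 <= k <oo) (enorm (charge_vec D (E k)))%:E <= variation_measure D A)%E.
  apply: variation_measure_ge.
  - by case=> [|k]; [exact: mA|exact: measurable0].
  - by apply/trivIsetP => -[|j] [|k] //= _ _ _; rewrite ?setI0 ?set0I.
  - by move=> x [[|k]].
rewrite VA0 => h0.
have {h0} h : enorm (charge_vec D A) <= 0.
  rewrite -lee_fin; apply: le_trans h0.
  apply: le_trans (@nneseries_lim_ge _ _ xpredT 0 1 _).
    by rewrite big_nat1.
  by move=> k _ _; rewrite lee_fin enorm_ge0.
have : fine (D i A) = 0.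
  have h2 := edot_le (charge_vec D A) (charge_vec D A).
  have E0 : enorm (charge_vec D A) = 0 by apply/le_anti; rewrite h enorm_ge0.
  have : edot (charge_vec D A) (charge_vec D A) = 0.
    by apply/le_anti; rewrite edot_ge0 andbT (le_trans h2)// E0 mulr0.
  move/eqP; rewrite /edot psumr_eq0 => [|j _]; last by rewrite -expr2 sqr_ge0.
  move=> /allP /(_ i); rewrite mem_index_enum => /(_ isT).
  by rewrite mulf_eq0 orbb mxE => /eqP.
by rewrite -[in X in _ -> X](@fineK _ (D i A)) ?fin_num_measure// => ->.
Qed.

End variation_measure_dominates.

Section BV_core.
Context {R : realType} {n : nat}.
Local Notation lam := (@lebesgue_rV R n).
Implicit Types (f g phi psi : 'rV[R]_n -> R) (u : 'rV[R]_n).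

(** The integral is not divided by [t]: estimates compare it with [t] times a variation. *)
Definition diff_quot_norm f u (t : R) : R := \int[lam]_x `|f (x + t *: u) - f x|.

Lemma integrable_translate f u : lam.-integrable setT (EFin \o f) ->
  lam.-integrable setT (EFin \o (fun x => f (x + u))).
Proof.
move=> if_; have := integrable_rV_affine u (unitmx1 R n) if_.
by congr (_.-integrable _ _); apply/funext => x /=; rewrite mulmx1.
Qed.

Lemma Rintegral_translate f u : lam.-integrable setT (EFin \o f) ->
  \int[lam]_x f (x + u) = \int[lam]_x f x.
Proof.
move=> if_; have := integral_rV_affine u (unitmx1 R n) if_.
rewrite det1 normr1 invr1 mul1e /Rintegral => <-.
by congr fine; apply: eq_integral => x _; rewrite /= mulmx1.
Qed.

Lemma test_function_translate phi u : test_function phi ->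
  test_function (fun x => phi (x + u)).
Proof.
move=> tphi; have := test_function_affine u (unitmx1 R n) tphi.
by congr test_function; apply/funext => x; rewrite mulmx1.
Qed.

Lemma derive_translate phi u v x : smooth phi ->
  'D_v (fun y => phi (y + u)) x = 'D_v phi (x + u).
Proof.
move=> sphi; have [df e] := smooth_is_derive (x + u) v sphi.
rewrite e.
have : is_derive x v (fun y : 'rV[R]_n => phi (y *m 1%:M + u))
    (\sum_i v ord0 i * partial i phi (x + u)).
  by apply: is_derive_affine; rewrite !mulmx1; split.
have -> : (fun y : 'rV[R]_n => phi (y *m 1%:M + u)) = (fun y => phi (y + u)).
  by apply/funext => y; rewrite mulmx1.
by case.
Qed.

Lemma derive_sum_partial phi u : smooth phi ->
  'D_u phi = fun x => \sum_i u ord0 i * partial i phi x.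
Proof. by move=> sphi; apply/funext => x; have [_ ->] := smooth_is_derive x u sphi. Qed.

Lemma test_function_derive phi u : test_function phi -> test_function ('D_u phi).
Proof.
move=> tphi; rewrite derive_sum_partial//; last exact: test_function_smooth.
have -> : (fun x => \sum_i u ord0 i * partial i phi x) =
    \sum_i (cst (u ord0 i) * partial i phi).
  by apply/funext => x; rewrite fct_sumE.
elim/big_ind : _ => [|h k|i _]; [|exact: test_functionD|].
  rewrite (_ : 0 = cst 0); last exact/funext.
  apply/test_functionP; split; first exact: smooth_cst.
  by exists 0 => x; rewrite eqxx.
by apply: test_functionZ; exact: test_function_partial.
Qed.

(** Moving the test function instead of [f] makes the pairing differentiable in the shift: the
    integrand is differentiated under the integral sign, dominated by |f| times a bound of the
    derivative of [phi]. *)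
Lemma is_derive_pairing f phi u (s : R) : lam.-integrable setT (EFin \o f) ->
  test_function phi ->
  is_derive s (1 : R) (fun t : R => \int[lam]_x (f x * phi (x + t *: u)))
    (\int[lam]_x (f x * 'D_u phi (x + s *: u))).
Proof.
move=> if_ tphi; pose h (t : R) (x : 'rV[R]_n) := f x * phi (x + t *: u).
have sphi := test_function_smooth tphi.
have mf : measurable_fun setT f by apply/measurable_EFinP; exact: measurable_int if_.
have [C C0 HC] := test_function_bounded (test_function_derive u tphi).
have dphi x t : is_derive t (1 : R) (fun t : R => phi (x + t *: u)) ('D_u phi (x + t *: u)).
  have -> : (fun t : R => phi (x + t *: u)) = (fun t : R => phi (t *: u + x)).
    by apply/funext => r; rewrite addrC.
  rewrite [x + _]addrC; apply: is_derive_line.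
  by have [df e] := smooth_is_derive (t *: u + x) u sphi; split.
have dh x t : is_derive t (1 : R) (h ^~ x) (f x * 'D_u phi (x + t *: u)).
  have -> : h ^~ x = f x \*: (fun t : R => phi (x + t *: u)) by [].
  exact: is_deriveZ.
have ih t : lam.-integrable setT (EFin \o h t).
  have tt := test_function_translate (t *: u) tphi.
  have [C' _ HC'] := test_function_bounded tt.
  exact: (integrable_mul_bounded if_ (measurable_test_function tt) HC').
have sI : `](s - 1), (s + 1)[%classic s by rewrite /= in_itv/=; apply/andP; split; lra.
pose G x := `|f x| * C.
have iG : lam.-integrable setT (EFin \o G).
  exact: (@integrable_mul_bounded _ _ _ lam _ (cst C) `|C| (integrable_norm if_)).
have G0 x : 0 <= G x by rewrite mulr_ge0.
have d1E x t : partial1of2 h t x = f x * 'D_u phi (x + t *: u).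
  by rewrite partial1of2E; have [_ ->] := dh x t.
have Gub t x : `](s - 1), (s + 1)[%classic t -> setT x -> `|partial1of2 h t x| <= G x.
  by move=> _ _; rewrite d1E normrM ler_wpM2l.
have dF := @derivable_under_integral R _ _ lam h setT measurableT s (s - 1) (s + 1) sI
  (fun t _ => ih t) (fun t x _ _ => @ex_derive _ _ _ _ _ _ _ (dh x t)) G G0 iG Gub.
have eF := @differentiation_under_integral R _ _ lam h setT measurableT s (s - 1) (s + 1) sI
  (fun t _ => ih t) (fun t x _ _ => @ex_derive _ _ _ _ _ _ _ (dh x t)) G G0 iG Gub.
apply: DeriveDef => //; rewrite -derive1E eF.
by apply: eq_Rintegral => x _; rewrite d1E.
Qed.

Section pairing.
Variable f : 'rV[R]_n -> R.
Hypothesis BVf : BV_space f.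
Local Notation D := (distr_derivative f).
Local Notation mu := (distr_variation f).

Let if_ : lam.-integrable setT (EFin \o f).
Proof. by have [] := BVf. Qed.

Lemma distr_derivativeP : is_distr_derivative f D.
Proof.
rewrite /distr_derivative; case: pselect => [h|]; first by case: cid.
by have [] := BVf.
Qed.

Definition dir_density u (x : 'rV[R]_n) : R := edot u (polar_density f x).

Let s_ i (x : 'rV[R]_n) : R := fine (Radon_Nikodym (D i) mu x).

Let s_int i : mu.-integrable setT (EFin \o s_ i).
Proof.
have := Radon_Nikodym_integrable (@charge_dominated_variation_measure _ _ _ _ D i).
apply: eq_integrable => // x _ /=; rewrite fineK//.
exact/Radon_Nikodym_fin_num/charge_dominated_variation_measure.
Qed.

Let D_s i A : measurable A -> (D i A = \int[mu]_(x in A) (s_ i x)%:E)%E.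
Proof.
move=> mA; rewrite (Radon_Nikodym_integral (@charge_dominated_variation_measure _ _ _ _ D i) mA).
apply: eq_integral => x _; rewrite fineK//.
exact/Radon_Nikodym_fin_num/charge_dominated_variation_measure.
Qed.

Lemma dir_densityE u x : dir_density u x = \sum_i u ord0 i * s_ i x.
Proof. by apply: eq_bigr => i _; rewrite mxE. Qed.

Lemma integrable_dir_density u : mu.-integrable setT (EFin \o dir_density u).
Proof.
have -> : EFin \o dir_density u = (fun x => \sum_i (u ord0 i)%:E * (s_ i x)%:E)%E.
  by apply/funext => x /=; rewrite dir_densityE -sumEFin.
apply: integrable_sum => // i _; exact: (integrableZl measurableT _ (s_int i)).
Qed.

(** Integration by parts in an arbitrary direction: the defining identity of the coordinate
    derivatives is extended linearly, with each charge replaced by its density against |Df|. *)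
Lemma pairingE phi u : test_function phi ->
  \int[lam]_x (f x * 'D_u phi x) = - \int[mu]_x (phi x * dir_density u x).
Proof.
move=> tphi; have bphi := test_function_bmeas tphi.
have Rsum (I : finType) (d' : measure_display) (T : measurableType d')
    (m : {measure set T -> \bar R}) (F : I -> T -> R) :
    (forall i, m.-integrable setT (EFin \o F i)) ->
    \int[m]_x (\sum_i F i x) = \sum_i \int[m]_x F i x.
  move=> iF; rewrite /Rintegral; under eq_integral do rewrite -sumEFin.
  rewrite integral_sum// sum_fine// => i _.
  exact: (integrable_fin_num measurableT (iF i)).
transitivity (\sum_i u ord0 i * \int[lam]_x (f x * partial i phi x)).
  have sphi := test_function_smooth tphi.
  under eq_Rintegral => x _.
    have [_ ->] := smooth_is_derive x u sphi; rewrite mulr_sumr.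
    over.
  have ifp i : lam.-integrable setT (EFin \o (fun x => f x * partial i phi x)).
    have tp := test_function_partial i tphi.
    have [C _ HC] := test_function_bounded tp.
    by apply: (integrable_mul_bounded if_) HC; exact: measurable_test_function.
  rewrite (Rsum _ _ _ _ (fun i x => f x * (u ord0 i * partial i phi x))).
    apply: eq_bigr => i _; rewrite -RintegralZl//.
    by apply: eq_Rintegral => x _; rewrite mulrCA.
  move=> i; have := integrableZl measurableT (u ord0 i) (ifp i).
  by congr (_.-integrable _ _); apply/funext => x /=; rewrite -EFinM mulrCA.
rewrite (_ : \int[mu]_x _ = \sum_i u ord0 i * \int[mu]_x (phi x * s_ i x)).
  rewrite -sumrN; apply: eq_bigr => i _; rewrite -mulrN; congr (_ * _).
  rewrite /Rintegral distr_derivativeP// charge_integral_cintegral//=.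
  by rewrite (cintegral_density (s_int i) (@D_s i)).
under eq_Rintegral do rewrite dir_densityE mulr_sumr.
rewrite (Rsum _ _ _ _ (fun i x => phi x * (u ord0 i * s_ i x))).
  apply: eq_bigr => i _; rewrite -RintegralZl//; last exact: bmeas_integrableM.
  by apply: eq_Rintegral => x _; rewrite mulrCA.
move=> i; have := integrableZl measurableT (u ord0 i) (bmeas_integrableM bphi (s_int i)).
by congr (_.-integrable _ _); apply/funext => x /=; rewrite -EFinM mulrCA.
Qed.

Definition dir_var u : R := \int[mu]_x `|dir_density u x|.

Lemma directional_variationE u : directional_variation f u = (dir_var u)%:E.
Proof.
rewrite /dir_var /Rintegral fineK//; apply: integrable_fin_num => //.
exact: integrable_norm (integrable_dir_density u).
Qed.

End pairing.
End BV_core.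

Section difference_quotients.
Context {R : realType} {n : nat}.
Local Notation lam := (@lebesgue_rV R n).
Implicit Types (f g phi psi : 'rV[R]_n -> R) (u : 'rV[R]_n).

Lemma integrable_mul_test f phi : lam.-integrable setT (EFin \o f) -> test_function phi ->
  lam.-integrable setT (EFin \o (fun x => f x * phi x)).
Proof.
move=> if_ tphi; have [C _ HC] := test_function_bounded tphi.
exact: (integrable_mul_bounded if_ (measurable_test_function tphi) HC).
Qed.

Lemma integrable_diff f u : lam.-integrable setT (EFin \o f) ->
  lam.-integrable setT (EFin \o (fun x => f (x + u) - f x)).
Proof.
move=> if_; exact: (integrableB measurableT (integrable_translate u if_) if_).
Qed.

(** Translation invariance moves the difference onto the test function. The shift by [0 *: u] is
    kept so that both terms are values of the function differentiated in [is_derive_pairing]. *)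
Lemma diff_pairing f phi u (t : R) : lam.-integrable setT (EFin \o f) -> test_function phi ->
  \int[lam]_x ((f (x + t *: u) - f x) * phi x) =
  \int[lam]_x (f x * phi (x + - t *: u)) - \int[lam]_x (f x * phi (x + 0 *: u)).
Proof.
move=> if_ tphi.
have i1 := integrable_mul_test if_ (test_function_translate (- t *: u) tphi).
rewrite -(Rintegral_translate (t *: u) i1).
under [X in _ = _ - X]eq_Rintegral do rewrite scale0r addr0.
rewrite -RintegralB//; last 2 first.
- exact: (integrable_translate (t *: u) i1).
- exact: (integrable_mul_test if_ tphi).
by apply: eq_Rintegral => x _; rewrite scaleNr addrK mulrBl.
Qed.

Section BV.
Variable f : 'rV[R]_n -> R.
Hypothesis BVf : BV_space f.
Local Notation mu := (distr_variation f).

Let if_ : lam.-integrable setT (EFin \o f).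
Proof. by have [] := BVf. Qed.

(** Mean value theorem on [-t, 0] for the pairing as a function of the shift; by [pairingE] its
    derivative is a pairing with |Df| in which the test function is shifted by some s between 0 and
    t. *)
Lemma abs_diff_pairing_le phi u (t B : R) : test_function phi -> 0 < t ->
  (forall s, 0 <= s <= t ->
    \int[mu]_x (`|phi (x - s *: u)| * `|dir_density f u x|) <= B) ->
  `|\int[lam]_x ((f (x + t *: u) - f x) * phi x)| <= t * B.
Proof.
move=> tphi t0 HB; rewrite diff_pairing//.
have dF s := is_derive_pairing u s if_ tphi.
set F := (fun s : R => \int[lam]_x (f x * phi (x + s *: u))) in dF.
have cF : {within `[- t, 0], continuous F}.
  by apply: derivable_within_continuous => s _; exact: (@ex_derive _ _ _ _ _ _ _ (dF s)).
have t0' : - t <= 0 by rewrite oppr_le0 ltW.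
have [c] := MVT_segment t0' (fun s _ => dF s) cF.
rewrite in_itv/= => /andP[tc c0]; rewrite -/(F (- t)) -/(F 0) -normrN opprB => ->.
rewrite sub0r opprK normrM (gtr0_norm t0) mulrC ler_pM2l//.
have tc' := test_function_translate (c *: u) tphi.
have -> : \int[lam]_x (f x * 'D_u phi (x + c *: u)) =
    - \int[mu]_x (phi (x + c *: u) * dir_density f u x).
  rewrite -(pairingE BVf u tc'); apply: eq_Rintegral => x _.
  by rewrite derive_translate//; exact: test_function_smooth.
have ifd := bmeas_integrableM (test_function_bmeas tc') (integrable_dir_density f u).
rewrite normrN (le_trans (le_normr_Rintegral measurableT ifd))//.
have := HB (- c); rewrite oppr_ge0 c0 lerNl tc => /(_ isT); apply: le_trans.
rewrite le_eqVlt; apply/orP; left; apply/eqP; apply: eq_Rintegral => x _.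
by rewrite normrM scaleNr opprK.
Qed.

Lemma dir_var_ge0 u : 0 <= dir_var f u.
Proof. exact: Rintegral_ge0. Qed.

(** Duality applied to the difference times [phi]. The weight keeps track of where the variation of
    [f] sits, so that the resulting bound is by a measure and not only by a total mass. *)
Lemma diff_quot_norm_weighted_le phi u (t B : R) : test_function phi -> 0 < t ->
  (forall s, 0 <= s <= t ->
    \int[mu]_x (`|phi (x - s *: u)| * `|dir_density f u x|) <= B) ->
  \int[lam]_x (`|f (x + t *: u) - f x| * `|phi x|) <= t * B.
Proof.
move=> tphi t0 HB; apply/ler_addgt0Pl => e e0.
have ih := integrable_mul_test (integrable_diff (t *: u) if_) tphi.
have [psi [tpsi psi1 H]] := integral_abs_le_test_function ih e0.
have tpp := test_functionM tphi (test_function_smooth tpsi).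
have ihp := integrable_mul_test ih tpsi.
have {}H : \int[lam]_x `|(f (x + t *: u) - f x) * phi x| <=
    \int[lam]_x ((f (x + t *: u) - f x) * phi x * psi x) + e.
  rewrite -lee_fin EFinD /Rintegral !fineK//.
    exact: (integrable_fin_num measurableT ihp).
  exact: (integrable_fin_num measurableT (integrable_norm ih)).
under eq_Rintegral do rewrite -normrM.
rewrite addrC (le_trans H)// lerD2r.
have /(_ _) := @abs_diff_pairing_le (phi * psi) u t B tpp t0.
rewrite (_ : \int[lam]_x _ = \int[lam]_x ((f (x + t *: u) - f x) * phi x * psi x)); last first.
  by apply: eq_Rintegral => x _; rewrite -mulrA.
move=> H2; rewrite (le_trans (ler_norm _))// H2// => s st.
apply: le_trans (HB s st); apply: le_Rintegral => //.
- have ts := test_function_translate (- (s *: u)) tpp.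
  exact: (bmeas_integrableM (bmeas_norm (test_function_bmeas ts))
    (integrable_norm (integrable_dir_density f u))).
- have ts := test_function_translate (- (s *: u)) tphi.
  exact: (bmeas_integrableM (bmeas_norm (test_function_bmeas ts))
    (integrable_norm (integrable_dir_density f u))).
- move=> x _; rewrite ler_wpM2r//.
  rewrite -[(phi * psi) _]/(phi _ * psi _) normrM ler_piMr//.
Qed.

Lemma diff_quot_norm_le u (t : R) : 0 < t -> diff_quot_norm f u t <= t * dir_var f u.
Proof.
move=> t0; apply/ler_addgt0Pl => e e0.
have ih := integrable_diff (t *: u) if_.
have [psi [tpsi psi1 H]] := integral_abs_le_test_function ih e0.
have ihp := integrable_mul_test ih tpsi.
have {}H : diff_quot_norm f u t <=
    \int[lam]_x ((f (x + t *: u) - f x) * psi x) + e.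
  rewrite -lee_fin EFinD /diff_quot_norm /Rintegral !fineK//.
    exact: (integrable_fin_num measurableT ihp).
  exact: (integrable_fin_num measurableT (integrable_norm ih)).
rewrite addrC (le_trans H)// lerD2r (le_trans (ler_norm _))//.
apply: abs_diff_pairing_le => // s _; apply: le_Rintegral => //.
- have ts := test_function_translate (- (s *: u)) tpsi.
  exact: (bmeas_integrableM (bmeas_norm (test_function_bmeas ts))
    (integrable_norm (integrable_dir_density f u))).
- exact: (integrable_norm (integrable_dir_density f u)).
- by move=> x _; rewrite ler_piMl.
Qed.

(** Duality on the |Df| side: some test function nearly attains the variation, its pairing is minus
    a derivative at shift 0, and the difference quotients of that derivative are bounded by the
    hypothesis. *)
Lemma dir_var_le u (d C : R) : 0 < d ->
  (forall t, 0 < t < d -> diff_quot_norm f u t <= t * C) -> dir_var f u <= C.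
Proof.
move=> d0 HC; apply/ler_addgt0Pl => e e0.
have is_ := integrable_dir_density f u.
have [psi [tpsi psi1 H]] := integral_abs_le_test_function is_ e0.
have ihp := bmeas_integrableM (test_function_bmeas tpsi) is_.
have {}H : dir_var f u <= \int[mu]_x (psi x * dir_density f u x) + e.
  rewrite -lee_fin EFinD /dir_var /Rintegral !fineK//.
  - under [X in (_ <= X + _)%E]eq_integral do rewrite mulrC.
    exact: H.
  - exact: (integrable_fin_num measurableT ihp).
  - exact: (integrable_fin_num measurableT (integrable_norm is_)).
rewrite addrC (le_trans H)// lerD2r.
have -> : \int[mu]_x (psi x * dir_density f u x) = - \int[lam]_x (f x * 'D_u psi x).
  by rewrite pairingE// opprK.
rewrite leNgt; apply/negP => Hlt.
have := is_derive_pairing u 0 if_ tpsi.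
set F := (fun s : R => _) => -[dF].
rewrite (_ : \int[lam]_x _ = \int[lam]_x (f x * 'D_u psi x)); last first.
  by apply: eq_Rintegral => x _; rewrite scale0r addr0.
set l := \int[lam]_x _ in Hlt * => lE.
(* Half the gap by which -l is supposed to exceed [C]; a quotient within [eps] of [l] closes the
   contradiction. *)
pose eps := (- l - C) / 2; have eps0 : 0 < eps by rewrite divr_gt0// subr_gt0.
have /cvgrPdist_le/(_ _ eps0) := dF; rewrite -/(derive F 0 1) lE => Hnear.
have [t [t0 td Ht]] : exists t : R, [/\ 0 < t, t < d & `|l - (- t)^-1 * (F (- t) - F 0)| <= eps].
  move: Hnear => [r /= r0 Hr].
  pose t := Num.min r d / 2.
  have m0 : 0 < Num.min r d by rewrite lt_min r0.
  have t0 : 0 < t by rewrite divr_gt0.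
  have tm : t < Num.min r d by rewrite /t ltr_pdivrMr// mulr_natr mulr2n ltrDl.
  exists t; split => //; first by rewrite (lt_le_trans tm)// ge_min lexx orbT.
  have := Hr (- t); rewrite /ball/= sub0r opprK gtr0_norm// => /(_ _ _).
  rewrite (_ : - t *: 1 + 0 = - t); last by rewrite addr0 [_%:A]mulr1.
  apply; last by rewrite oppr_eq0 gt_eqF.
  by rewrite (lt_le_trans tm)// ge_min lexx.
have := HC t; rewrite t0 td => /(_ isT) Hq.
have ih := integrable_diff (t *: u) if_.
have Fq : F (- t) - F 0 <= t * C.
  rewrite /F -diff_pairing// (le_trans _ Hq)// (le_trans (ler_norm _))//.
  have ihq := integrable_mul_test ih tpsi.
  rewrite (le_trans (le_normr_Rintegral measurableT ihq))//.
  apply: le_Rintegral => //; first exact: (integrable_norm ihq).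
    exact: (integrable_norm ih).
  by move=> x _; rewrite normrM ler_piMr.
move: Ht; rewrite ler_norml => /andP[Ht1 Ht2].
have : - (- t)^-1 * (F (- t) - F 0) <= C.
  by rewrite invrN opprK ler_pdivrMl.
rewrite mulNr; move: eps0 Ht1 Ht2; rewrite /eps; lra.
Qed.

End BV.

Lemma BV_of_dominated f (m : 'I_n -> {finite_measure set 'rV[R]_n -> \bar R}) :
  lam.-integrable setT (EFin \o f) ->
  (forall i phi, test_function phi ->
    `|\int[lam]_x (f x * partial i phi x)| <= \int[m i]_x `|phi x|) ->
  BV_space f.
Proof.
move=> if_ Hm; split => //.
pose L i phi := - \int[lam]_x (f x * partial i phi x).
have LD i phi psi : test_function phi -> test_function psi ->
    L i (phi + psi) = L i phi + L i psi.
  move=> tphi tpsi; rewrite /L -opprD -RintegralD//; last 2 first.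
  - exact/integrable_mul_test/test_function_partial.
  - exact/integrable_mul_test/test_function_partial.
  congr (- _); apply: eq_Rintegral => x _; rewrite /partial deriveD ?mulrDr//.
  + exact/smooth_derivable/test_function_smooth.
  + exact/smooth_derivable/test_function_smooth.
have LZ i c phi : test_function phi -> L i (cst c * phi) = c * L i phi.
  move=> tphi; rewrite /L mulrN -RintegralZl//; last first.
    exact/integrable_mul_test/test_function_partial.
  congr (- _); apply: eq_Rintegral => x _; rewrite mulrCA; congr (_ * _).
  have -> : cst c * phi = c \*: phi by [].
  by rewrite /partial deriveZ//; exact/smooth_derivable/test_function_smooth.
have Lm i phi : test_function phi -> `|L i phi| <= \int[m i]_x `|phi x|.
  by move=> tphi; rewrite normrN Hm.
have H i := dominated_functional_charge (LD i) (LZ i) (Lm i).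
exists (fun i => sval (cid (H i))) => phi i tphi.
case: cid => nu /= ->//; rewrite -EFinN opprK /Rintegral fineK//.
apply: (integrable_fin_num measurableT).
exact/integrable_mul_test/test_function_partial.
Qed.

End difference_quotients.

(** * Polar coordinates and the affine norm *)

Section euclidean_complements.
Context {R : realType} {n : nat}.
Implicit Types u : 'rV[R]_n.

Lemma enormZ (a : R) (u : 'rV[R]_n) : enorm (a *: u) = `|a| * enorm u.
Proof.
by rewrite /enorm edotZl edotC edotZl mulrA -expr2 sqrtrM ?sqr_ge0// sqrtr_sqr.
Qed.

Lemma enorm_eq0 u : (enorm u == 0) = (u == 0).
Proof.
apply/eqP/eqP => [|->]; last exact: enorm0.
move=> u0; have : edot u u = 0.
  by apply/le_anti; rewrite edot_ge0 (le_trans (edot_le _ _))// u0 mulr0.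
move/eqP; rewrite /edot psumr_eq0 => [|j _]; last by rewrite -expr2 sqr_ge0.
move=> /allP h; apply/rowP => i; have := h i; rewrite mem_index_enum => /(_ isT).
by rewrite mulf_eq0 orbb mxE => /eqP.
Qed.

Lemma radial_projZ (a : R) u : 0 < a -> radial_proj (a *: u) = radial_proj u.
Proof.
move=> a0; rewrite /radial_proj enormZ gtr0_norm// scalerA invfM mulrAC.
by rewrite mulVf ?mul1r// gt_eqF.
Qed.

Lemma enorm_radial_proj u : 0 < enorm u -> enorm (radial_proj u) = 1.
Proof.
move=> u0; rewrite /radial_proj enormZ ger0_norm ?invr_ge0 ?enorm_ge0//.
by rewrite mulVf// gt_eqF.
Qed.

Lemma coord_le_enorm u i : `|u ord0 i| <= enorm u.
Proof.
rewrite -sqrtr_sqr ler_sqrt ?edot_ge0// /edot (bigD1 i)//= -expr2 lerDl.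
by apply: sumr_ge0 => j _; rewrite -expr2 sqr_ge0.
Qed.

Lemma measurable_unit_ball : measurable (@unit_ball R n).
Proof.
rewrite (_ : unit_ball = enorm @^-1` `]-oo, 1]).
  by rewrite -[X in measurable X]setTI; apply: measurable_enorm.
by apply/seteqP; split => x /=; rewrite in_itv.
Qed.

Lemma measurable_unit_sphere : measurable (@unit_sphere R n).
Proof.
rewrite (_ : unit_sphere = enorm @^-1` [set 1]); last by [].
by rewrite -[X in measurable X]setTI; apply: measurable_enorm.
Qed.

Lemma measurable_box (M : R) : measurable [set x : 'rV[R]_n | forall i, `|x ord0 i| <= M].
Proof.
have -> : [set x : 'rV[R]_n | forall i, `|x ord0 i| <= M] =
    \bigcap_(i in [set: 'I_n]) (fun x : 'rV[R]_n => x ord0 i) @^-1` `[-M, M]%classic.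
  apply/seteqP; split => x /= h i.
    by move=> _; have := h i; rewrite /= in_itv/= ler_norml.
  by have := h i Logic.I; rewrite /= in_itv/= ler_norml.
apply: fin_bigcap_measurable => // i _.
by rewrite -[X in measurable X]setTI; apply: measurable_coord.
Qed.

Lemma ball_volume_lty : (ball_volume R n < +oo)%E.
Proof.
apply: le_lt_trans (lebesgue_rV_bounded n 1); apply: le_measure.
- by rewrite inE; exact: measurable_unit_ball.
- by rewrite inE; exact: measurable_box.
- by move=> x x1 i; exact: le_trans (coord_le_enorm x i) x1.
Qed.

Lemma ball_volume_gt0 : (0 < ball_volume R n)%E.
Proof.
(* The cube with this side lies in the unit ball, since [n * a <= 1] bounds the sum of its
   coordinates; the successor covers n = 0. *)
pose a : R := n.+1%:R^-1; have a0 : 0 < a by rewrite invr_gt0.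
apply: (@lt_le_trans _ _ (lebesgue_rV n [set x | forall i, `[0, a]%classic (x ord0 i)])).
  rewrite (@lebesgue_rV_box R n (fun=> `[0, a]%classic))//.
  elim/big_ind : _ => [|x y x0 y0|i _]; [by []|exact: mule_gt0|].
  by rewrite lebesgue_measure_itv/= lte_fin a0 sube0 lte_fin.
have E : [set x : 'rV[R]_n | forall i, `[0, a]%classic (x ord0 i)] =
    \bigcap_(i in [set: 'I_n]) (fun x : 'rV[R]_n => x ord0 i) @^-1` `[0, a]%classic.
  by apply/seteqP; split => x /= h i; [move=> _; exact: h|exact: h].
have mE : measurable [set x : 'rV[R]_n | forall i, `[0, a]%classic (x ord0 i)].
  rewrite E; apply: fin_bigcap_measurable => // i _.
  by rewrite -[X in measurable X]setTI; apply: measurable_coord.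
apply: le_measure.
- by rewrite inE; exact: mE.
- by rewrite inE; exact: measurable_unit_ball.
- move=> x /= xa; rewrite /unit_ball/=; apply: le_trans (enorm_le_sum x) _.
  apply: (@le_trans _ _ (\sum_(i < n) a)).
    by apply: ler_sum => i _; have := xa i; rewrite in_itv/= => /andP[x0 ?]; rewrite ger0_norm.
  rewrite sumr_const card_ord -mulr_natr mulrC ler_pdivrMr// mul1r ler_nat//.
Qed.

End euclidean_complements.

Section polar_coordinates.
Context {R : realType}.
Variable n' : nat.
Local Notation n := n'.+1.
Local Notation lam := (@lebesgue_rV R n).
Implicit Types (x u : 'rV[R]_n) (A : set 'rV[R]_n).

Lemma lebesgue_rV_scale (r : R) A : 0 < r -> measurable A ->
  (lam [set x | A (r^-1 *: x)] = (r ^+ n)%:E * lam A)%E.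
Proof.
move=> r0 mA.
have ur : (r^-1)%:M \in @unitmx R n.
  by rewrite unitmxE det_scalar unitrX// unitfE gt_eqF// invr_gt0.
rewrite (_ : mkset _ = [set x | A (x *m (r^-1)%:M + 0)]); last first.
  by apply/seteqP; split => x /=; rewrite mul_mx_scalar addr0.
rewrite lebesgue_rV_affine// det_scalar exprVn normfV invrK.
by rewrite ger0_norm// exprn_ge0// ltW.
Qed.

Lemma measurable_sector A (D : set R) : measurable A -> measurable D ->
  measurable [set x | A (radial_proj x) /\ D (enorm x)].
Proof.
move=> mA mD; apply: (@measurableI _ _ (radial_proj @^-1` A) (enorm @^-1` D)).
  by rewrite -[X in measurable X]setTI; exact: measurable_radial_proj.
by rewrite -[X in measurable X]setTI; exact: measurable_enorm.
Qed.

(** The part of the cone over [A] up to radius [r], the sphere of radius [r] being excluded when [b]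
    is true. The origin is left out because it has no direction. *)
Definition sector A (b : bool) (r : R) : set 'rV[R]_n :=
  [set x | A (radial_proj x) /\ [set` Interval (BRight 0) (BSide b r)] (enorm x)].

Lemma sectorP A b r x :
  sector A b r x <-> [/\ A (radial_proj x), 0 < enorm x & enorm x < r ?<= if ~~ b].
Proof.
by rewrite /sector/= in_itv/=; split => [[? /andP[]]|[? ? ?]]; [|split => //; apply/andP].
Qed.

Lemma lebesgue_sector_lty A : measurable A -> (lam (sector A false 1) < +oo)%E.
Proof.
move=> mA; apply: le_lt_trans (lebesgue_rV_bounded n 1); apply: le_measure.
- by rewrite inE; exact: measurable_sector.
- by rewrite inE; exact: measurable_box.
- by move=> x /sectorP[_ _ x1] i; exact: le_trans (coord_le_enorm x i) x1.
Qed.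

Lemma lebesgue_sectorZ A (r : R) b : 0 < r -> measurable A ->
  (lam (sector A b r) = (r ^+ n)%:E * lam (sector A b 1%R))%E.
Proof.
move=> r0 mA; rewrite -(lebesgue_rV_scale r0 (@measurable_sector A _ mA (measurable_itv _))).
congr (lam _).
have rV0 : 0 < r^-1 by rewrite invr_gt0.
apply/seteqP; split => x /=.
  move=> /sectorP[Ax x0 xr]; apply/sectorP; rewrite radial_projZ// enormZ gtr0_norm//.
  rewrite pmulr_rgt0//; split => //; case: b xr => /= xr.
    by rewrite ltr_pdivrMl// mulr1.
  by rewrite ler_pdivrMl// mulr1.
move=> /sectorP[]; rewrite radial_projZ// enormZ gtr0_norm// pmulr_rgt0// => Ax x0 xr.
apply/sectorP; split => //; case: b xr => /=.
  by rewrite ltr_pdivrMl// mulr1.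
by rewrite ler_pdivrMl// mulr1.
Qed.

Lemma sub_sector A b r c s : (forall y : R, y < r ?<= if ~~ b -> y < s ?<= if ~~ c) ->
  sector A b r `<=` sector A c s.
Proof. by move=> h x /sectorP[? ? /h ?]; apply/sectorP. Qed.

Lemma le_lebesgue_sector A b r c s : measurable A ->
  (forall y : R, y < r ?<= if ~~ b -> y < s ?<= if ~~ c) ->
  (lam (sector A b r) <= lam (sector A c s))%E.
Proof.
by move=> mA h; apply: le_measure; rewrite ?inE; [exact: measurable_sector..|exact: sub_sector].
Qed.

(** The outer shell is null: the closed sector scaled by t < 1 fits into the open one, and its
    volume is t^n times the full one, with t tending to 1. *)
Lemma lebesgue_sector_open A : measurable A ->
  lam (sector A true 1) = lam (sector A false 1).
Proof.
move=> mA; have le01 : (lam (sector A true 1) <= lam (sector A false 1))%E.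
  by apply: le_lebesgue_sector => // y /= /ltW.
apply/eqP; rewrite eq_le le01/=.
have fin1 : lam (sector A false 1) \is a fin_num.
  by rewrite ge0_fin_numE// lebesgue_sector_lty.
have fin2 : lam (sector A true 1) \is a fin_num.
  by rewrite ge0_fin_numE//; apply: le_lt_trans (lebesgue_sector_lty mA).
have H t : 0 < t -> t < 1 ->
    t ^+ n * fine (lam (sector A false 1)) <= fine (lam (sector A true 1)).
  move=> t0 t1; rewrite -lee_fin EFinM (fineK fin1) (fineK fin2) -(lebesgue_sectorZ false t0 mA).
  by apply: le_lebesgue_sector => // y /= /le_lt_trans; apply.
rewrite -(fineK fin1) -(fineK fin2) lee_fin.
set a := fine _ in H *; set b := fine _ in H *.
(* The shift to k + 2 keeps the scale 1 - 1/(k + 2) positive at k = 0. *)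
have cv : (fun k : nat => (1 - k.+2%:R^-1) ^+ n * a) @ \oo --> (1 - 0) ^+ n * a.
  apply: cvgM; last exact: cvg_cst.
  apply: (@continuous_cvg _ _ _ _ _ _ (fun y : R => y ^+ n)); first exact: exprn_continuous.
  apply: cvgB; first exact: cvg_cst.
  have := @cvg_harmonic R; rewrite -cvg_shiftS.
  exact.
rewrite subr0 expr1n mul1r in cv; apply: (cvgr_to_le cv); apply: nearW => k; apply: H.
  by rewrite subr_gt0 invf_lt1// ltr1n.
by rewrite gtrBl invr_gt0.
Qed.

(** The condition is a radius below c^(1/n). Bounding the n-th power of the radius makes the volume
    linear in [c], as the integral of a simple function requires. *)
Lemma lebesgue_sector_pow A (c : R) : 0 <= c -> measurable A ->
  (lam [set x | [/\ A (radial_proj x), 0 < enorm x & enorm x ^+ n < c]%R] =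
   c%:E * lam (sector A false 1%R))%E.
Proof.
rewrite le_eqVlt => /predU1P[<- mA|c0 mA].
  rewrite mul0e (_ : mkset _ = set0) ?measure0//.
  by apply/seteqP; split => x //= -[_ x0]; rewrite ltNge exprn_ge0// ltW.
pose r := c `^ n%:R^-1.
have r0 : 0 < r by rewrite powR_gt0.
have rc : r ^+ n = c.
  by rewrite -powR_mulrn ?powR_ge0// /r -powRrM mulVf// powRr1// ltW.
rewrite -lebesgue_sector_open// -rc -lebesgue_sectorZ//; congr (lam _).
apply/seteqP; split => x /=.
  move=> [Ax x0]; rewrite ltr_pXn2r ?nnegrE ?(ltW r0) ?enorm_ge0// => xr.
  by apply/sectorP; split.
move=> /sectorP[Ax x0 /= xr]; split => //.
by rewrite ltr_pXn2r ?nnegrE ?(ltW r0) ?enorm_ge0.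
Qed.

Lemma surface_measureE A :
  surface_measure A = (n%:R%:E * lam (sector A false 1%R))%E.
Proof.
by rewrite /surface_measure /pushforward /mscale/= /mrestr; congr (_ * lam _)%E.
Qed.

Import HBNNSimple.

(* Polar coordinates: both sides are additive and continuous along increasing
   sequences in H, and agree for the indicators of cones by scaling. *)
Lemma integral_surface_measure (H : 'rV[R]_n -> \bar R) :
  measurable_fun setT H -> (forall u, 0 <= H u)%E ->
  (\int[surface_measure]_u H u = n%:R%:E *
   lam [set x | (0 < enorm x)%R /\ ((enorm x ^+ n)%:E < H (radial_proj x))%E])%E.
Proof.
move=> mH H0; pose s := nnsfun_approx measurableT mH.
pose G k := [set x : 'rV[R]_n | 0 < enorm x /\ enorm x ^+ n < s k (radial_proj x)].
have sind k : (\int[surface_measure]_u (s k u)%:E = n%:R%:E * lam (G k))%E.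
  rewrite integralT_nnsfun sintegralE.
  pose F r := [set x : 'rV[R]_n | [/\ (s k @^-1` [set r]) (radial_proj x),
    0 < enorm x & enorm x ^+ n < r]].
  have mF r : 0 <= r -> measurable (F r).
    move=> r0.
    rewrite (_ : F r = [set x | (s k @^-1` [set r]) (radial_proj x) /\
        [set y | 0 < y /\ y ^+ n < r] (enorm x)]).
      apply: measurable_sector => //.
      rewrite (_ : mkset _ = `]0, +oo[ `&` (fun y : R => y ^+ n) @^-1` `]-oo, r[).
        apply: measurableI => //; rewrite -[X in measurable X]setTI.
        apply: (exprn_measurable n) => //.
      by apply/seteqP; split => y /=; rewrite !in_itv/= andbT.
    by apply/seteqP; split => x [] => [|?] [].
  transitivity (\sum_(r \in range (s k)) (n%:R%:E * lam (F r)))%E.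
    apply: eq_fsbigr => r; rewrite inE => -[u _ ur].
    have r0 : 0 <= r by rewrite -ur.
    transitivity (r%:E * (n%:R%:E * lam (sector (s k @^-1` [set r]) false 1)))%E.
      by congr (_ * _)%E; exact: surface_measureE.
    by rewrite muleCA -lebesgue_sector_pow.
  rewrite -ge0_mule_fsumr//; congr (_ * _)%E.
  rewrite -measure_fin_bigcup//.
  - congr (lam _); apply/seteqP; split => x.
      by move=> [r _ [/= sr x0 xr]]; split => //; rewrite sr.
    by move=> [x0 xr]; exists (s k (radial_proj x)).
  - apply/trivIsetP => r r' _ _ /eqP rr'; apply/seteqP; split => x //.
    by move=> [] [/= er _ _] [/= er' _ _]; apply: rr'; rewrite -er -er'.
  - by move=> r [u _ <-]; exact: mF.
have -> : (\int[surface_measure]_u H u = limn (fun k => \int[surface_measure]_u (s k u)%:E))%E.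
  rewrite -monotone_convergence//.
  - apply: eq_integral => u _; apply/esym/cvg_lim => //.
    exact: cvg_nnsfun_approx.
  - by move=> k; exact/measurable_EFinP.
  - by move=> k u _; rewrite lee_fin.
  - by move=> u _ i j ij; rewrite lee_fin; exact/lefP/nd_nnsfun_approx.
under eq_fun do rewrite sind.
apply/cvg_lim => //; apply: cvgeZl => //.
have mG k : measurable (G k).
  rewrite (_ : G k = [set x | 0 < enorm x] `&` (fun x => s k (radial_proj x) - enorm x ^+ n) @^-1` `]0, +oo[).
    apply: measurableI.
      rewrite (_ : mkset _ = enorm @^-1` `]0, +oo[).
        by rewrite -[X in measurable X]setTI; exact: measurable_enorm.
      by apply/seteqP; split => x /=; rewrite in_itv/= andbT.
    rewrite -[X in measurable X]setTI.
    have : measurable_fun setT (fun x : 'rV[R]_n => s k (radial_proj x) - enorm x ^+ n).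
      apply: measurable_funB.
        exact: (measurableT_comp (measurable_funP (s k)) measurable_radial_proj).
      by apply: measurable_funX; exact: measurable_enorm.
    exact.
  by apply/seteqP; split => x /= [x0]; rewrite in_itv/= andbT subr_gt0.
rewrite (_ : mkset _ = \bigcup_k G k).
  apply: (nondecreasing_cvg_mu mG); first exact: bigcupT_measurable.
  move=> i j ij; apply/subsetPset => x [x0 xs]; split => //; apply: lt_le_trans xs _.
  by have /lefP := nd_nnsfun_approx measurableT mH ij; exact.
have HE u : H u = ereal_sup (range (fun k => (s k u)%:E)).
  have cv := cvg_nnsfun_approx measurableT mH (fun u _ => H0 u) (Logic.I : setT u).
  rewrite -(cvg_lim _ cv)//; apply/cvg_lim => //; apply: ereal_nondecreasing_cvgn.
  move=> i j ij; rewrite lee_fin.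
  by have /lefP := nd_nnsfun_approx measurableT mH ij; exact.
apply/seteqP; split => x /=.
  move=> [x0]; rewrite HE => /ereal_sup_gt[_ [k _ <-]]; rewrite lte_fin => xk.
  by exists k.
move=> [k _ [x0 xs]]; split => //; rewrite HE.
apply: (@lt_le_trans _ _ (s k (radial_proj x))%:E); first by rewrite lte_fin.
by apply: ereal_sup_ubound; exists k.
Qed.

Lemma lebesgue_rV_set0 : lam [set 0] = 0%E.
Proof.
rewrite (_ : [set 0] = [set x : 'rV[R]_n | forall i, [set 0] (x ord0 i)]).
  rewrite (@lebesgue_rV_box R n (fun=> [set 0]))// big_ord_recl lebesgue_measure_set1.
  by rewrite mul0e.
apply/seteqP; split => x /=; first by move=> -> i; rewrite mxE.
by move=> h; apply/rowP => i; rewrite mxE; exact: h.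
Qed.

Lemma surface_measure_sphere :
  surface_measure (@unit_sphere R n) = (n%:R%:E * ball_volume R n)%E.
Proof.
rewrite surface_measureE; congr (_ * _)%E; apply/eqP; rewrite eq_le; apply/andP; split.
  apply: le_measure; rewrite ?inE.
  - by apply: measurable_sector => //; exact: measurable_unit_sphere.
  - exact: measurable_unit_ball.
  - by move=> x /sectorP[].
rewrite -[leRHS]adde0 -lebesgue_rV_set0.
have m0 : measurable [set 0 : 'rV[R]_n].
  rewrite (_ : [set 0] = enorm @^-1` [set 0]).
    by rewrite -[X in measurable X]setTI; apply: measurable_enorm.
  by apply/seteqP; split => x /=; [move=> ->; exact: enorm0|move/eqP; rewrite enorm_eq0 => /eqP].
have mS : measurable (sector unit_sphere false 1).
  by apply: measurable_sector => //; exact: measurable_unit_sphere.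
apply: le_trans (measureU2 _ mS m0); apply: le_measure; rewrite ?inE.
- exact: measurable_unit_ball.
- exact: measurableU.
- move=> x x1; have [x0|x0] := eqVneq x 0; first by right.
  have x0' : 0 < enorm x by rewrite lt_neqAle enorm_ge0 eq_sym enorm_eq0 x0.
  by left; apply/sectorP; split => //; exact: enorm_radial_proj.
Qed.

End polar_coordinates.

(** * The affine norm as a functional of the directional variation *)

Section gauge_norm.
Context {R : realType}.
Variable n' : nat.
Local Notation n := n'.+1.
Local Notation lam := (@lebesgue_rV R n).
Implicit Types V W : 'rV[R]_n -> R.

Let S := @unit_sphere R n.
Let mS : measurable S := @measurable_unit_sphere R n.

Definition gauge_norm V : \bar R :=
  (((\int[surface_measure]_(u in unit_sphere)
      ((((V u)%:E ^+ n)^-1) / (n%:R%:E * ball_volume R n)))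
    `^ n%:R^-1)^-1)%E.

Let kap : R := n%:R * fine (ball_volume R n).

Let kapE : (n%:R%:E * ball_volume R n)%E = kap%:E.
Proof. by rewrite EFinM fineK// ge0_fin_numE ?ball_volume_lty// ltW ?ball_volume_gt0. Qed.

Let kap0 : 0 < kap.
Proof.
rewrite mulr_gt0// fine_gt0// ball_volume_gt0 ball_volume_lty//.
Qed.

Let hV V (u : 'rV[R]_n) : \bar R := ((((V u)%:E ^+ n)^-1) / kap%:E)%E.

Lemma inve_antitone (x y : \bar R) : (0 <= x)%E -> (x <= y)%E -> (y^-1 <= x^-1)%E.
Proof.
move=> x0 xy; have y0 := le_trans x0 xy.
case: x x0 xy => [x| |]//; last first.
  by move=> _; rewrite leye_eq => /eqP ->.
rewrite lee_fin le_eqVlt => /predU1P[<- _|x0 xy]; first by rewrite inve0 leey.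
case: y xy y0 => [y| |]//; last by move=> _ _; rewrite invey inve_ge0 lee_fin ltW.
rewrite !lee_fin => xy y0; rewrite !inver !gt_eqF//; last exact: lt_le_trans xy.
by rewrite lee_fin lef_pV2// posrE (lt_le_trans x0 xy).
Qed.

Let expe_EFin (a : R) k : (a%:E ^+ k = (a ^+ k)%:E)%E.
Proof. by rewrite EFin_expe. Qed.

Lemma ge0_hV V u : (forall u, 0 <= V u) -> (0 <= hV V u)%E.
Proof.
move=> V0; rewrite mule_ge0// ?inve_ge0 ?lee_fin ?(ltW kap0)//.
by rewrite expe_EFin lee_fin exprn_ge0.
Qed.

(** Isolates the zeros of [V], where the convention for 0^-n gives +oo; measurability follows by
    cases. *)
Let hVE V u : (forall u, 0 <= V u) ->
  hV V u = if V u == 0 then +oo%E else ((V u ^+ n) `^ (-1) / kap)%:E.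
Proof.
move=> V0; rewrite /hV expe_EFin [(kap%:E)^-1%E]inver gt_eqF// inver expf_eq0/=.
case: ifPn => Vu; first by rewrite gt0_mulye// lte_fin invr_gt0.
by rewrite powR_inv1 ?exprn_ge0.
Qed.

Let measurable_hV V : (forall u, 0 <= V u) -> measurable_fun setT V ->
  measurable_fun setT (hV V).
Proof.
move=> V0 mV; rewrite (_ : hV V = fun u => if V u == 0 then +oo%E else
  ((V u ^+ n) `^ (-1) / kap)%:E); last by apply/funext => u; exact: hVE.
apply: measurable_fun_ifT => //.
  by apply: measurable_fun_eqr => //; exact: measurable_cst.
apply/measurable_EFinP; apply: measurable_funM; last exact: measurable_cst.
apply: (measurableT_comp (measurable_powR _)).
by apply: measurable_funX.
Qed.

Let J V : \bar R := (\int[surface_measure]_(u in S) hV V u)%E.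

Let J_ge0 V : (forall u, 0 <= V u) -> (0 <= J V)%E.
Proof. by move=> V0; apply: integral_ge0 => u _; exact: ge0_hV. Qed.

Let gauge_normE V : gauge_norm V = ((J V `^ n%:R^-1)^-1)%E.
Proof. by rewrite /gauge_norm kapE. Qed.

Let gauge_norm_antitone V W : (forall u, 0 <= W u) ->
  (J W <= J V)%E -> (gauge_norm V <= gauge_norm W)%E.
Proof.
move=> W0 JWV; have JW0 := J_ge0 W0; rewrite !gauge_normE; apply: inve_antitone.
  exact: poweR_ge0.
have JV0 := le_trans JW0 JWV.
by apply: gt0_ler_poweR JWV; rewrite ?invr_ge0 ?in_itv/= ?leey ?JW0 ?JV0 ?ler0n.
Qed.

Lemma le_gauge_norm V W : (forall u, 0 <= V u) -> measurable_fun setT V ->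
  measurable_fun setT W -> (forall u, enorm u = 1 -> V u <= W u) ->
  (forall u, 0 <= W u) -> (gauge_norm V <= gauge_norm W)%E.
Proof.
move=> V0 mV mW VW W0; apply: (gauge_norm_antitone W0); apply: ge0_le_integral => //.
- by move=> u _; exact: ge0_hV.
- exact: (measurable_funTS (measurable_hV W0 mW)).
- exact: (measurable_funTS (measurable_hV V0 mV)).
- move=> u Su; rewrite /hV lee_wpmul2r ?inve_ge0 ?lee_fin ?(ltW kap0)//.
  apply: inve_antitone; rewrite !expe_EFin lee_fin ?exprn_ge0//.
  by rewrite lerXn2r ?nnegrE//; exact: VW.
Qed.

Lemma gauge_normZ (c : R) V : 0 < c -> (forall u, 0 <= V u) -> measurable_fun setT V ->
  gauge_norm (fun u => c * V u) = (c%:E * gauge_norm V)%E.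
Proof.
move=> c0 V0 mV; rewrite !gauge_normE.
have -> : J (fun u => c * V u) = (((c ^+ n)^-1)%:E * J V)%E.
  rewrite /J -ge0_integralZl_EFin//.
  - apply: eq_integral => u _; rewrite /hV muleA; congr (_ * _)%E.
    rewrite !expe_EFin exprMn !inver mulf_eq0 !expf_eq0/= gt_eqF//=.
    case: ifPn => _; first by rewrite gt0_muley// lte_fin invr_gt0 exprn_gt0.
    by rewrite -EFinM invfM.
  - by move=> u _; exact: ge0_hV.
  - exact: (measurable_funTS (measurable_hV V0 mV)).
  - by rewrite invr_ge0 exprn_ge0// ltW.
rewrite poweRM ?J_ge0//; last by rewrite lee_fin invr_ge0 exprn_ge0// ltW.
have -> : ((c ^+ n)^-1%:E `^ n%:R^-1 = (c^-1)%:E)%E.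
  rewrite poweR_EFin -exprVn -powR_mulrn ?invr_ge0 ?ltW// -powRrM mulfV// powRr1//.
  by rewrite invr_ge0 ltW.
(* The inverse on extended reals exchanges 0 and +oo, so these two values of the power are separate
   cases. *)
have := poweR_ge0 (J V) n%:R^-1; move: (J V `^ _)%E => y.
have cV0 : 0 < c^-1 by rewrite invr_gt0.
case: y => [y| |]//; last first.
  by move=> _; rewrite gt0_muley ?lte_fin// invey mule0.
rewrite lee_fin le_eqVlt => /predU1P[<-|y0].
  by rewrite mule0 inve0 gt0_muley ?lte_fin.
rewrite -EFinM !inver !gt_eqF ?mulr_gt0//= -EFinM.
by rewrite invfM invrK.
Qed.

Lemma gauge_norm1 : gauge_norm (fun=> 1) = 1%E.
Proof.
rewrite gauge_normE (_ : J _ = 1%E) ?poweR1r ?inve1//.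
rewrite /J (_ : (fun u => _) = (fun=> (kap^-1)%:E)); last first.
  by apply/funext => u; rewrite /hV expe_EFin expr1n inve1 mul1e inver gt_eqF.
rewrite (integral_cst _ mS).
transitivity ((kap^-1)%:E * (n%:R%:E * ball_volume R n))%E.
  by congr (_ * _)%E; exact: surface_measure_sphere.
by rewrite kapE -EFinM mulVf// gt_eqF.
Qed.

(** By homogeneity, |x|^n < V(x/|x|)^-n says exactly that V x < 1, so polar coordinates turn the
    integral over the sphere into the volume of a sublevel set. *)
Let J_lebesgue V : (forall u, 0 <= V u) -> measurable_fun setT V ->
  (forall a u, 0 < a -> V (a *: u) = a * V u) ->
  J V = (n%:R%:E * ((kap^-1)%:E * lam [set x | 0 < enorm x /\ V x < 1]%R))%E.
Proof.
move=> V0 mV hom.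
pose h u := (((V u)%:E ^+ n)^-1)%E.
have h0 u : (0 <= h u)%E by rewrite inve_ge0 expe_EFin lee_fin exprn_ge0.
have mh : measurable_fun setT h.
  rewrite (_ : h = fun u => kap%:E * hV V u)%E; first exact: (measurable_funeM _ (measurable_hV V0 mV)).
  apply/funext => u; rewrite /hV [(kap%:E)^-1%E]inver gt_eqF// muleCA -EFinM mulfV ?gt_eqF//.
  by rewrite mule1.
have -> : J V = ((kap^-1)%:E * \int[surface_measure]_(u in S) h u)%E.
  rewrite /J -ge0_integralZl_EFin//.
  - by apply: eq_integral => u _; rewrite /hV [(kap%:E)^-1%E]inver gt_eqF// muleC.
  - exact: measurable_funTS.
  - by rewrite invr_ge0 ltW.
rewrite [RHS]muleCA; congr (_ * _)%E; rewrite integral_mkcond.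
rewrite integral_surface_measure; last 2 first.
- exact: ((measurable_restrictT h mS).1 (measurable_funTS mh)).
- by move=> u; exact: erestrict_ge0.
congr (_ * lam _)%E; apply/seteqP.
have key x : 0 < enorm x -> (((enorm x ^+ n)%:E < (h \_ S) (radial_proj x))%E : Prop) <-> V x < 1.
  move=> x0; rewrite patchE mem_set; last exact: enorm_radial_proj.
  have Vx : V (radial_proj x) = (enorm x)^-1 * V x by rewrite hom// invr_gt0.
  rewrite /h expe_EFin inver expf_eq0/= Vx mulf_eq0 invr_eq0 (gt_eqF x0)/=.
  case: ifPn => [/eqP Vx0|Vx0]; first by rewrite ltry Vx0 ltr01.
  have Vxp : 0 < V x by rewrite lt_neqAle eq_sym Vx0 V0.
  rewrite lte_fin exprMn invfM exprVn invrK ltr_pMr ?exprn_gt0//.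
  by rewrite invf_gt1 ?exprn_gt0// expr_lt1 ?V0.
by split => y /= [y0 /(key _ y0)].
Qed.

Lemma gauge_norm_linear V (B : 'M[R]_n) : `|\det B| = 1 ->
  (forall u, 0 <= V u) -> measurable_fun setT V ->
  (forall a u, 0 < a -> V (a *: u) = a * V u) ->
  gauge_norm (fun u => V (u *m B)) = gauge_norm V.
Proof.
move=> detB V0 mV hom; rewrite !gauge_normE.
suff -> : J (fun u => V (u *m B)) = J V by [].
have uB : B \in unitmx.
  by rewrite unitmxE unitfE -normr_eq0 detB oner_eq0.
rewrite !J_lebesgue//; last 2 first.
- exact: (measurableT_comp mV (measurable_mul_rV B)).
- by move=> a u a0; rewrite -scalemxAl hom.
do 2 congr (_ * _)%E.
pose E := [set x : 'rV[R]_n | 0 < enorm x /\ V x < 1].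
have mE : measurable E.
  rewrite (_ : E = enorm @^-1` `]0, +oo[ `&` V @^-1` `]-oo, 1[).
    apply: measurableI; rewrite -[X in measurable X]setTI; first exact: measurable_enorm.
    exact: mV.
  by apply/seteqP; split => x /=; rewrite !in_itv/= andbT.
have := lebesgue_rV_affine 0 uB mE; rewrite detB invr1 mul1e => <-.
congr (lam _); apply/seteqP; split => x /=; rewrite addr0 => -[x0 Vx]; split => //.
  rewrite lt_neqAle enorm_ge0 eq_sym enorm_eq0 andbT.
  apply: contraTneq x0 => xB; have -> : x = 0 by rewrite -(mulmxK uB x) xB mul0mx.
  by rewrite enorm0 ltxx.
rewrite lt_neqAle enorm_ge0 eq_sym enorm_eq0 andbT.
by apply: contraTneq x0 => ->; rewrite mul0mx enorm0 ltxx.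
Qed.

End gauge_norm.

(** * Affine changes of variables *)

Section weighted_pushforward.
Context d d' (X : measurableType d) (Y : measurableType d') (R : realType).
Variables (mu : {measure set X -> \bar R}) (T : X -> Y) (w : X -> R).
Hypothesis mT : measurable_fun setT T.
Hypothesis w0 : forall x, 0 <= w x.
Hypothesis iw : mu.-integrable setT (EFin \o w).

Let mw : measurable_fun setT (EFin \o w).
Proof. exact: measurable_int iw. Qed.

Let mpre (B : set Y) : measurable B -> measurable (T @^-1` B).
Proof. by move=> mB; rewrite -[X in measurable X]setTI; exact: mT. Qed.

Let m (B : set Y) : \bar R := (\int[mu]_(x in T @^-1` B) (w x)%:E)%E.

Let m0 : m set0 = 0%E.
Proof. by rewrite /m preimage_set0 integral_set0. Qed.

Let m_ge0 B : (0 <= m B)%E.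
Proof. by apply: integral_ge0 => x _; rewrite lee_fin. Qed.

Let m_sigma : semi_sigma_additive m.
Proof.
move=> F mF tF mU; rewrite {2}/m preimage_bigcup ge0_integral_bigcup//=.
- exact: is_cvg_nneseries.
- by move=> k; exact: mpre.
- exact: measurable_funTS.
- by move=> x _; rewrite lee_fin.
- apply/trivIsetP => i j _ _ ij; rewrite -preimage_setI.
  by move/trivIsetP : tF => ->//; rewrite preimage_set0.
Qed.

Let m_fin : fin_num_fun m.
Proof.
move=> B mB; apply: integrable_fin_num; first exact: mpre.
by apply: (integrableS measurableT) iw => //; exact: mpre.
Qed.

(** The measure is the image under [T] of the density [w] against [mu]; the measures that dominate a
    distributional derivative below are all of this form. *)
Lemma weighted_pushforward : exists m : {finite_measure set Y -> \bar R},
  forall h, bmeas h -> \int[m]_y h y = \int[mu]_x (h (T x) * w x).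
Proof.
pose mm : {measure set Y -> \bar R} :=
  HB.pack m (isMeasure.Build _ _ _ m m0 m_ge0 m_sigma).
pose mf : {finite_measure set Y -> \bar R} :=
  HB.pack m mm (Measure_isFinite.Build _ _ _ mm m_fin).
exists mf => h bh; have [mh [C HC]] := bh.
have bT (f : Y -> R) : bmeas f -> bmeas (fun x => f (T x)).
  move=> [mf' [D HD]]; split; last by exists D.
  exact: (measurableT_comp mf' mT).
suff [] : bmeas h /\ \int[mf]_y h y = \int[mu]_x (h (T x) * w x) by [].
apply: (@bounded_measurable_ind _ _ _ (fun h => bmeas h /\
  \int[mf]_y h y = \int[mu]_x (h (T x) * w x)) _ _ _ _ h C mh HC) => {h C bh mh HC}.
- move=> A mA; split; first exact: bmeas_indic.
  transitivity (fine (m A)); first by rewrite /Rintegral integral_indic// setIT.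
  rewrite /m integral_mkcond; congr fine; apply: eq_integral => x _; rewrite patchE indicE.
  have [xA|xA] := pselect (A (T x)).
    by rewrite !mem_set// mul1r.
  by rewrite !memNset// mul0r.
- move=> f g [bf ef] [bg eg]; split; first exact: bmeasD.
  rewrite RintegralD//; [|exact: bmeas_integrable..].
  rewrite ef eg -RintegralD//; [|exact: (bmeas_integrableM (bT _ _) iw)..].
  by apply: eq_Rintegral => x _; rewrite mulrDl.
- move=> c f [bf ef]; split; first exact: bmeasZ.
  rewrite RintegralZl//; last exact: bmeas_integrable.
  rewrite ef -RintegralZl//; last exact: (bmeas_integrableM (bT _ _) iw).
  by apply: eq_Rintegral => x _; rewrite mulrA.
- move=> f mf' H; have bf : bmeas f.
    split => //; have [g [[_ [C HC]] _] fg] := H _ ltr01.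
    exists (1 + C) => x; rewrite -[f x](subrK (g x)).
    by rewrite (le_trans (ler_normD _ _))// lerD.
  split => //.
  pose M := fine (mf setT) + \int[mu]_x `|w x|.
  have M0 : 0 <= M by rewrite addr_ge0// ?Rintegral_ge0// fine_ge0.
  apply/eqP; rewrite -subr_eq0 -normr_le0; apply/ler_addgt0Pl => e e0; rewrite addr0.
  have d0 : 0 < e / (M + 1) by rewrite divr_gt0// ltr_wpDl.
  have [g [bg eg] fg] := H _ d0.
  have bh := bmeasB bf bg.
  have i1 : mf.-integrable setT (EFin \o cst 1).
    by apply: bmeas_integrable; split => //; exists 1 => x; rewrite normr1.
  have -> : \int[mf]_x f x - \int[mu]_x (f (T x) * w x) =
      \int[mf]_x ((f x - g x) * cst 1 x) - \int[mu]_x ((f (T x) - g (T x)) * w x).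
    have -> : \int[mf]_x ((f x - g x) * cst 1 x) = \int[mf]_x f x - \int[mf]_x g x.
      rewrite -(RintegralB measurableT (bmeas_integrable mf bf) (bmeas_integrable mf bg)).
      by apply: eq_Rintegral => x _; rewrite mulr1.
    have -> : \int[mu]_x ((f (T x) - g (T x)) * w x) =
        \int[mu]_x (f (T x) * w x) - \int[mu]_x (g (T x) * w x).
      rewrite -(RintegralB measurableT (bmeas_integrableM (bT _ bf) iw)
        (bmeas_integrableM (bT _ bg) iw)).
      by apply: eq_Rintegral => x _; rewrite mulrBl.
    by rewrite eg; ring.
  rewrite (le_trans (ler_normB _ _))//.
  apply: (@le_trans _ _ (e / (M + 1) * M)); last first.
    by rewrite mulrAC ler_pdivrMr ?ltr_wpDl// ler_pM2l// lerDl.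
  rewrite [leRHS]mulrDr lerD//.
    have := Rintegral_lipschitz bh i1 fg.
    rewrite [X in _ <= _ * X -> _](_ : _ = fine (mf setT))//.
    by under eq_Rintegral do rewrite normr1; rewrite Rintegral_cst// mul1r.
  apply: (Rintegral_lipschitz (bmeasB (bT _ bf) (bT _ bg)) iw) => x; exact: fg.
Qed.

End weighted_pushforward.

Section BV_affine.
Context {R : realType} {n : nat}.
Local Notation lam := (@lebesgue_rV R n).
Implicit Types (f g phi : 'rV[R]_n -> R).

Lemma Rintegral_affine f (A : 'M[R]_n) a : A \in unitmx -> lam.-integrable setT (EFin \o f) ->
  \int[lam]_x f (x *m A + a) = `|\det A|^-1 * \int[lam]_x f x.
Proof.
move=> uA if_; have := integral_rV_affine a uA if_; rewrite /Rintegral => /= ->.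
by rewrite fineM//; exact: (integrable_fin_num measurableT if_).
Qed.

(** Three choices will occur: the inverse of an affine map with a rescaled density of |Df|, the
    identity with such a density, and the identity with a density against Lebesgue measure. *)
Lemma BV_of_weighted f d (X : 'I_n -> measurableType d)
    (mu : forall i, {measure set (X i) -> \bar R})
    (T : forall i, X i -> 'rV[R]_n) (w : forall i, X i -> R) :
  (forall i, measurable_fun setT (T i)) -> (forall i x, 0 <= w i x) ->
  (forall i, (mu i).-integrable setT (EFin \o w i)) ->
  lam.-integrable setT (EFin \o f) ->
  (forall i phi, test_function phi -> `|\int[lam]_x (f x * partial i phi x)| <=
     \int[mu i]_x (`|phi (T i x)| * w i x)) ->
  BV_space f.
Proof.
move=> mT w0 iw if_ H.
pose P i := weighted_pushforward (mT i) (w0 i) (iw i).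
apply: (@BV_of_dominated _ _ _ (fun i => sval (cid (P i)))) => // i phi tphi.
case: cid => m /= ->; last exact/bmeas_norm/test_function_bmeas.
exact: H.
Qed.

Section affine.
Variables (f : 'rV[R]_n -> R) (A : 'M[R]_n) (a : 'rV[R]_n).
Hypothesis BVf : BV_space f.
Hypothesis uA : A \in unitmx.

Let g x := f (x *m A + a).
Let if_ : lam.-integrable setT (EFin \o f).
Proof. by have [] := BVf. Qed.

(** Substituting the inverse map [T] turns a partial derivative of [phi] into the derivative of the
    transported test function in the direction [v i], where integration by parts for [f] applies. *)
Lemma BV_affine : BV_space g.
Proof.
pose T (y : 'rV[R]_n) := y *m invmx A + (- a *m invmx A).
have TK x : T (x *m A + a) = x by rewrite /T -mulmxDl addrK mulmxK.
have dA0 : 0 <= `|\det A|^-1 by rewrite invr_ge0.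
pose v i := delta_mx ord0 i *m A : 'rV[R]_n.
have uV : invmx A \in unitmx by rewrite unitmx_inv.
apply: (@BV_of_weighted g _ (fun=> 'rV[R]_n) (fun=> distr_variation f) (fun=> T)
  (fun i y => `|\det A|^-1 * `|dir_density f (v i) y|)).
- by move=> i; exact: measurable_affine_rV.
- by move=> i y; rewrite mulr_ge0.
- move=> i; have := integrableZl measurableT (`|\det A|^-1)
    (integrable_norm (integrable_dir_density f (v i))).
  by congr (_.-integrable _ _); apply/funext => x /=; rewrite EFinM.
- exact: (integrable_rV_affine a uA if_).
move=> i phi tphi.
have tT : test_function (fun y => phi (T y)) by exact: test_function_affine.
have DT y : 'D_(v i) (fun y => phi (T y)) y = partial i phi (T y).
  have sphi := test_function_smooth tphi.
  have := smooth_is_derive_partial (T y) i sphi.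
  rewrite -[delta_mx ord0 i](mulmxK uA) -/(v i) => H.
  by have [_ ->] := is_derive_affine H.
have -> : \int[lam]_x (g x * partial i phi x) =
    `|\det A|^-1 * \int[lam]_y (f y * 'D_(v i) (fun y => phi (T y)) y).
  have ifD := integrable_mul_test if_ (test_function_derive (v i) tT).
  rewrite -(Rintegral_affine a uA ifD).
  by apply: eq_Rintegral => x _; rewrite DT TK.
rewrite pairingE// mulrN normrN normrM (ger0_norm dA0).
have ii := bmeas_integrableM (test_function_bmeas tT) (integrable_dir_density f (v i)).
have bn := bmeas_integrableM (bmeas_norm (test_function_bmeas tT))
  (integrable_norm (integrable_dir_density f (v i))).
have -> : \int[distr_variation f]_x
      (`|phi (T x)| * (`|\det A|^-1 * `|dir_density f (v i) x|)) =
    `|\det A|^-1 * \int[distr_variation f]_x (`|phi (T x)| * `|dir_density f (v i) x|).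
  by rewrite -RintegralZl//; apply: eq_Rintegral => x _; rewrite mulrCA.
rewrite ler_wpM2l// (le_trans (le_normr_Rintegral measurableT ii))//.
rewrite le_eqVlt; apply/orP; left; apply/eqP; apply: eq_Rintegral => x _.
by rewrite normrM.
Qed.

(** Differences of [g] along [u] are differences of [f] along [u *m A]. One inequality suffices,
    since the inverse map supplies the other when capacities are compared. *)
Lemma dir_var_affine_le u : dir_var g u <= `|\det A|^-1 * dir_var f (u *m A).
Proof.
apply: (@dir_var_le _ _ _ BV_affine u 1) => // t /andP[t0 _].
have -> : diff_quot_norm g u t = `|\det A|^-1 * diff_quot_norm f (u *m A) t.
  have ifd := integrable_norm (integrable_diff (t *: (u *m A)) if_).
  rewrite /diff_quot_norm -(Rintegral_affine a uA ifd).
  apply: eq_Rintegral => x _; rewrite /g mulmxDl -scalemxAl.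
  by rewrite addrAC.
by rewrite mulrCA ler_wpM2l ?invr_ge0//; exact: diff_quot_norm_le.
Qed.

End affine.
End BV_affine.

(** * Criteria for bounded variation *)

Lemma integrable_indic_lty d (T : measurableType d) (R : realType)
    (mu : {measure set T -> \bar R}) (A : set T) : measurable A -> (mu A < +oo)%E ->
  mu.-integrable setT (EFin \o (\1_A : T -> R)).
Proof.
move=> mA Aoo; apply/integrableP; split; first exact/measurable_EFinP.
rewrite (eq_integral (fun x => (\1_A x)%:E)); last by move=> x _; rewrite /= ger0_norm.
by rewrite integral_indic// setIT.
Qed.

Section BV_norm.
Context {R : realType}.
Variable n' : nat.
Local Notation n := n'.+1.
Local Notation lam := (@lebesgue_rV R n).
Implicit Types (f g phi : 'rV[R]_n -> R) (u : 'rV[R]_n).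

Lemma dir_density_sum f u x :
  dir_density f u x = \sum_i u ord0 i * dir_density f (delta_mx ord0 i) x.
Proof.
rewrite /dir_density /edot; apply: eq_bigr => i _; congr (_ * _).
rewrite (bigD1 i)//= [delta_mx _ _ _ _]mxE !eqxx mul1r big1 ?addr0// => j ji.
by rewrite [delta_mx _ _ _ _]mxE (negbTE ji) andbF mul0r.
Qed.

(** The integrand is jointly measurable in the direction and the point, being a sum of products; its
    integral over the point is then measurable by Tonelli. *)
Lemma measurable_dir_var f : measurable_fun setT (dir_var f).
Proof.
pose h (p : 'rV[R]_n * 'rV[R]_n) : \bar R := `|dir_density f p.1 p.2|%:E.
have mh : measurable_fun setT h.
  apply/measurable_EFinP; apply: measurableT_comp => //.
  rewrite (_ : (fun p => _) = fun p : 'rV[R]_n * 'rV[R]_n =>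
    \sum_i p.1 ord0 i * dir_density f (delta_mx ord0 i) p.2); last first.
    by apply/funext => p; exact: dir_density_sum.
  apply: measurable_sum => i; apply: measurable_funM.
    by apply: (measurableT_comp (@measurable_coord R 1 n ord0 i)); exact: measurable_fst.
  have md : measurable_fun setT (dir_density f (delta_mx ord0 i)).
    by apply/measurable_EFinP; exact: measurable_int (integrable_dir_density f _).
  exact: (measurableT_comp md measurable_snd).
have H : measurable_fun setT (fubini_F (distr_variation f) h).
  have := @measurable_fun_fubini_tonelli_F _ _ _ _ R (distr_variation f) h mh.
  by apply => p; rewrite lee_fin.
exact: (measurableT_comp (@fine_measurable R setT measurableT) H).
Qed.

Lemma dir_varZ f (a : R) u : dir_var f (a *: u) = `|a| * dir_var f u.
Proof.
rewrite /dir_var -RintegralZl//; last exact: (integrable_norm (integrable_dir_density f u)).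
by apply: eq_Rintegral => x _; rewrite -normrM /dir_density edotZl.
Qed.

Lemma affine_BV_normE f : affine_BV_norm f = gauge_norm (dir_var f).
Proof.
rewrite /affine_BV_norm /gauge_norm; congr ((_ `^ _)^-1)%E.
by apply: eq_integral => u _; rewrite directional_variationE.
Qed.

Lemma affine_BV_norm_ge0 f : (0 <= affine_BV_norm f)%E.
Proof. by rewrite inve_ge0 poweR_ge0. Qed.

End BV_norm.

Section BV_criteria.
Context {R : realType} {n : nat}.
Local Notation lam := (@lebesgue_rV R n).
Implicit Types (f g phi : 'rV[R]_n -> R) (u : 'rV[R]_n).

(** Only negative arguments are tested, because shifting a function forward by [t] shifts the test
    function backward in [diff_pairing]. *)
Lemma is_derive_abs_le (F : R -> R) (l B : R) : is_derive (0 : R) (1 : R) F l ->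
  (forall e, 0 < e -> exists2 d, 0 < d &
     forall t, 0 < t < d -> `|F (- t) - F 0| <= t * (B + e)) -> `|l| <= B.
Proof.
move=> [dF lE] H; apply/ler_addgt0Pl => e e0.
have e20 : 0 < e / 2 by rewrite divr_gt0.
have [d d0 Hd] := H _ e20.
have /cvgrPdist_le/(_ _ e20) := dF; rewrite -/(derive F 0 1) lE => -[r /= r0 Hr].
have m0 : 0 < Num.min r d by rewrite lt_min r0.
pose t := Num.min r d / 2.
have t0 : 0 < t by rewrite divr_gt0.
have tm : t < Num.min r d by rewrite /t ltr_pdivrMr// mulr_natr mulr2n ltrDl.
have := Hr (- t); rewrite /ball/= sub0r opprK gtr0_norm// => /(_ _ _).
rewrite (_ : - t *: 1 + 0 = - t); last by rewrite addr0 [_%:A]mulr1.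
move=> Hl; have {}Hl : `|l - (- t)^-1 *: (F (- t) - F 0)| <= e / 2.
  apply: Hl; last by rewrite oppr_eq0 gt_eqF.
  by rewrite (lt_le_trans tm)// ge_min lexx.
have td : 0 < t < d by rewrite t0 (lt_le_trans tm)// ge_min lexx orbT.
have {}Hd : `|(- t)^-1 *: (F (- t) - F 0)| <= B + e / 2.
  rewrite normrM normfV normrN (gtr0_norm t0) mulrC ler_pdivrMr// mulrC; exact: Hd.
rewrite -(subrK ((- t)^-1 *: (F (- t) - F 0)) l) (le_trans (ler_normD _ _))//.
rewrite [leRHS](_ : _ = e / 2 + (B + e / 2)); first exact: lerD.
by field.
Qed.

(** The pairing of [phi] with a difference of [g] is at most the weighted difference integral of
    [f], hence [t] times an integral of a shifted [phi] against |Df|. Removing the shift costs an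
    error of order [t], which vanishes in the derivative. *)
Lemma BV_of_diff_le f g : BV_space f -> lam.-integrable setT (EFin \o g) ->
  (forall i, exists2 d, 0 < d & forall t x, 0 < t < d ->
    `|g (x + t *: delta_mx ord0 i) - g x| <= `|f (x + t *: delta_mx ord0 i) - f x|) ->
  BV_space g.
Proof.
move=> BVf ig H; have [if_ _] := BVf.
pose e_ i : 'rV[R]_n := delta_mx ord0 i.
apply: (@BV_of_weighted R n g _ (fun=> 'rV[R]_n) (fun=> distr_variation f) (fun=> id)
  (fun i x => `|dir_density f (e_ i) x|)) => //.
  by move=> i; exact: (integrable_norm (integrable_dir_density f (e_ i))).
move=> i phi tphi; have [d d0 Hd] := H i.
have := is_derive_pairing (e_ i) 0 ig tphi.
rewrite (_ : \int[lam]_x (g x * _) = \int[lam]_x (g x * partial i phi x)); last first.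
  by apply: eq_Rintegral => x _; rewrite scale0r addr0.
move=> /is_derive_abs_le; apply => e e0.
have [C C0 HC] := test_function_bounded (test_function_derive (e_ i) tphi).
pose V := dir_var f (e_ i).
have V0 : 0 <= V by exact: dir_var_ge0.
(* For t < e / M the shift error, at most t * C * V, is below [e]; the summand 1 keeps [M]
   positive. *)
pose M := C * V + 1; have M0 : 0 < M by rewrite ltr_wpDl// mulr_ge0.
exists (Num.min d (e / M)); first by rewrite lt_min d0 divr_gt0.
move=> t; rewrite lt_min => /andP[t0 /andP[td te]].
rewrite -diff_pairing//.
have id := integrable_diff (t *: e_ i) ig.
have idp := integrable_mul_test id tphi.
rewrite (le_trans (le_normr_Rintegral measurableT idp))//.
have idf := integrable_mul_test (integrable_diff (t *: e_ i) if_) tphi.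
apply: (@le_trans _ _ (\int[lam]_x (`|f (x + t *: e_ i) - f x| * `|phi x|))).
  apply: le_Rintegral => //; first exact: (integrable_norm idp).
    have := integrable_norm idf.
    by congr (_.-integrable _ _); apply/funext => x /=; rewrite normrM.
  by move=> x _; rewrite normrM ler_wpM2r// Hd// t0.
apply: diff_quot_norm_weighted_le => // s /andP[s0 st].
have bp := bmeas_norm (test_function_bmeas tphi).
have idn := integrable_norm (integrable_dir_density f (e_ i)).
apply: (@le_trans _ _ (\int[distr_variation f]_x (`|phi x| * `|dir_density f (e_ i) x| +
    t * C * `|dir_density f (e_ i) x|))).
  have ts := test_function_translate (- (s *: e_ i)) tphi.
  apply: le_Rintegral => //.
  - exact: (bmeas_integrableM (bmeas_norm (test_function_bmeas ts)) idn).
  - have := integrableD measurableT (bmeas_integrableM bp idn)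
      (integrableZl measurableT (t * C) idn).
    by congr (_.-integrable _ _); apply/funext => x /=; rewrite EFinD.
  - move=> x _; rewrite -mulrDl ler_wpM2r//.
    have dphi (r : R) : is_derive (r *: e_ i + x : 'rV[R]_n) (e_ i) phi
        ((fun y => 'D_(e_ i) phi y) (r *: e_ i + x)).
      have [p1 p2] := smooth_is_derive (r *: e_ i + x) (e_ i) (test_function_smooth tphi).
      by split.
    have [c _ Ec] := @MVT_line R _ phi x (e_ i) (fun y => 'D_(e_ i) phi y) (- s) dphi.
    rewrite (_ : x - s *: e_ i = - s *: e_ i + x); last by rewrite scaleNr addrC.
    rewrite -[phi (_ + x)](subrK (phi x)) (le_trans (ler_normD _ _))// addrC lerD2l.
    rewrite Ec normrM normrN (ger0_norm s0).
    by rewrite ler_pM.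
rewrite RintegralD//; last 2 first.
  - exact: (bmeas_integrableM bp idn).
  - exact: (integrableZl measurableT (t * C) idn).
rewrite lerD2l RintegralZl// -/(dir_var f (e_ i)) -/V -mulrA.
apply: (@le_trans _ _ (t * M)); first by rewrite ler_pM2l// lerDl.
by rewrite -ler_pdivlMr// ltW.
Qed.

Lemma BV_of_lipschitz g w : lam.-integrable setT (EFin \o g) ->
  (forall x, 0 <= w x) -> lam.-integrable setT (EFin \o w) ->
  (forall i t x, 0 < t < 1 -> `|g (x + t *: delta_mx ord0 i) - g x| <= t * w x) ->
  BV_space g.
Proof.
move=> ig w0 iw H.
pose e_ i : 'rV[R]_n := delta_mx ord0 i.
apply: (@BV_of_weighted R n g _ (fun=> 'rV[R]_n) (fun=> lam) (fun=> id)
  (fun=> w)) => //.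
move=> i phi tphi.
have := is_derive_pairing (e_ i) 0 ig tphi.
rewrite (_ : \int[lam]_x (g x * _) = \int[lam]_x (g x * partial i phi x)); last first.
  by apply: eq_Rintegral => x _; rewrite scale0r addr0.
move=> /is_derive_abs_le; apply => e e0; exists 1 => // t t01.
have /andP[t0 t1] := t01.
rewrite -diff_pairing//.
have id := integrable_diff (t *: e_ i) ig.
have idp := integrable_mul_test id tphi.
have bw := bmeas_integrableM (bmeas_norm (test_function_bmeas tphi)) iw.
rewrite (le_trans (le_normr_Rintegral measurableT idp))//.
apply: (@le_trans _ _ (t * \int[lam]_x (`|phi x| * w x))); last first.
  by rewrite ler_pM2l// lerDl ltW.
rewrite -RintegralZl//; apply: le_Rintegral => //; first exact: (integrable_norm idp).
  exact: (integrableZl measurableT t bw).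
move=> x _; rewrite normrM mulrC mulrCA ler_wpM2l//; exact: H.
Qed.

End BV_criteria.

(** * Capacity under linear maps and limits *)

Section capacity.
Context {R : realType}.
Local Open Scope ereal_scope.

Lemma affine_BV_capacity_le n (E F : set 'rV[R]_n) (c : R) : (0 < c)%R ->
  (forall f, BV_space f -> set_nbhs E [set x | 1 <= f x]%R ->
    exists g, [/\ BV_space g, set_nbhs F [set x | 1 <= g x]%R &
      affine_BV_norm g <= c%:E * affine_BV_norm f]) ->
  affine_BV_capacity F <= c%:E * affine_BV_capacity E.
Proof.
move=> c0 H; rewrite -lee_pdivrMl//; apply: le_ereal_inf_tmp => _ [f [BVf Ef] <-].
rewrite lee_pdivrMl//; have [g [BVg Fg]] := H f BVf Ef.
by apply: le_trans; apply: ereal_inf_lbound; exists g.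
Qed.

Lemma le_affine_BV_capacity n (E F : set 'rV[R]_n) : E `<=` F ->
  affine_BV_capacity E <= affine_BV_capacity F.
Proof.
move=> EF; apply: ereal_inf_le_tmp => _ [f [BVf Ff] <-]; exists f => //; split => //.
by move=> x /EF; exact: Ff.
Qed.

End capacity.

Section capacity_transformations.
Context {R : realType}.
Variable n' : nat.
Local Notation n := n'.+1.
Implicit Types K F : set 'rV[R]_n.

Lemma affine_BV_capacity_ge0 F : (0 <= affine_BV_capacity F)%E.
Proof. by apply: le_ereal_inf_tmp => _ [f _ <-]; exact: affine_BV_norm_ge0. Qed.

(** Common source of dilations, unimodular maps and the disc. Composing [f] with the map multiplies
    variations by s^-n, evaluating them at [s *: (u *m A)] gives back one factor s, and the
    unimodular part is absorbed by [gauge_norm_linear]. *)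
Lemma affine_BV_capacity_affine K F (A : 'M[R]_n) (s : R) a : `|\det A| = 1 -> 0 < s ->
  (forall x, F x -> K (x *m (s *: A) + a)) ->
  (affine_BV_capacity F <= (s^-1 ^+ n')%:E * affine_BV_capacity K)%E.
Proof.
move=> dA s0 FK.
have dsA : `|\det (s *: A)| = s ^+ n.
  by rewrite detZ normrM dA mulr1 ger0_norm// exprn_ge0// ltW.
have usA : s *: A \in unitmx.
  by rewrite unitmxE unitfE -normr_eq0 dsA expf_eq0/= gt_eqF.
have c0 : 0 < s^-1 ^+ n' by rewrite exprn_gt0// invr_gt0.
apply: affine_BV_capacity_le => // f BVf Kf.
exists (fun x => f (x *m (s *: A) + a)); split.
- exact: BV_affine.
- move=> x /FK /Kf.
  by apply: (@continuous_affine_rV R n n (s *: A) a x).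
- rewrite !affine_BV_normE.
  pose c := s^-1 ^+ n'; pose V u := c * dir_var f u.
  have V0 u : 0 <= dir_var f u by exact: dir_var_ge0.
  have mV : measurable_fun setT (dir_var f) by exact: measurable_dir_var.
  have cV0 u : 0 <= V u by rewrite mulr_ge0// ltW.
  have mcV : measurable_fun setT V by exact: measurable_funM.
  rewrite -(gauge_normZ c0 V0 mV) -(gauge_norm_linear dA cV0 mcV); last first.
    by move=> r u r0; rewrite /V dir_varZ gtr0_norm// mulrCA.
  apply: le_gauge_norm.
  + by move=> u; apply: dir_var_ge0; exact: BV_affine.
  + exact: measurable_dir_var.
  + exact: (measurableT_comp mcV (measurable_mul_rV A)).
  + move=> u _; rewrite (le_trans (dir_var_affine_le a BVf usA u))//.
    rewrite dsA -scalemxAr dir_varZ (gtr0_norm s0) mulrA.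
    have -> // : (s ^+ n)^-1 * s = c.
    by rewrite exprS invfM mulrAC mulVf ?gt_eqF// mul1r /c exprVn.
  + by move=> u; exact: cV0.
Qed.

Lemma affine_BV_capacityZ K (x0 : 'rV[R]_n) (r : R) : 0 < r ->
  affine_BV_capacity [set x0 + r *: x | x in K] =
  ((r ^+ n')%:E * affine_BV_capacity K)%E.
Proof.
move=> r0; apply/eqP; rewrite eq_le; apply/andP; split.
  rewrite -{2}(invrK r).
  apply: (@affine_BV_capacity_affine _ _ 1%:M _ (- (r^-1 *: x0))).
  - by rewrite det1 normr1.
  - by rewrite invr_gt0.
  move=> _ [x Kx <-]; rewrite scalemx1 mul_mx_scalar scalerDr scalerA mulVf ?gt_eqF//.
  by rewrite scale1r addrAC subrr add0r.
rewrite -lee_pdivlMl ?exprn_gt0// -exprVn.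
apply: (@affine_BV_capacity_affine _ _ 1%:M _ x0) => //; first by rewrite det1 normr1.
by move=> x Kx; exists x => //; rewrite scalemx1 mul_mx_scalar addrC.
Qed.

Lemma affine_BV_capacity_SL K (Phi : 'M[R]_n) (x : 'rV[R]_n) : \det Phi = 1 ->
  affine_BV_capacity K = affine_BV_capacity [set y *m Phi^T + x | y in K].
Proof.
move=> dP; have dPT : \det Phi^T = 1 by rewrite det_tr.
have uP : Phi^T \in unitmx by rewrite unitmxE dPT unitr1.
have c1 : ((1^-1 : R) ^+ n')%:E = 1%E by rewrite invr1 expr1n.
apply/eqP; rewrite eq_le; apply/andP; split; rewrite -[leRHS]mul1e -c1.
  apply: (@affine_BV_capacity_affine _ _ Phi^T 1 x) => //; first by rewrite dPT normr1.
  by move=> y Ky; exists y => //; rewrite scale1r.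
apply: (@affine_BV_capacity_affine _ _ (invmx Phi^T) 1 (- (x *m invmx Phi^T))) => //.
  by rewrite det_inv dPT invr1 normr1.
by move=> _ [y Ky <-]; rewrite scale1r mulmxDl mulmxK// addrK.
Qed.

Lemma affine_BV_capacity_set0 : n' != 0%N ->
  (affine_BV_capacity (@set0 'rV[R]_n) + affine_BV_capacity (@set0 'rV[R]_n) <=
   affine_BV_capacity (@set0 'rV[R]_n))%E.
Proof.
move=> n0; have := @affine_BV_capacityZ set0 0 2 (ltr0Sn _ _); rewrite image_set0.
have := affine_BV_capacity_ge0 set0; case: (affine_BV_capacity set0) => [c| |]//.
rewrite lee_fin => c0 [E]; rewrite -EFinD lee_fin.
have : 2 * c <= 2 ^+ n' * c.
  by rewrite ler_wpM2r// -[leLHS]expr1 ler_weXn2l ?lt0n// ler1n.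
by rewrite -E mulr_natl mulr2n.
Qed.

(** A nearly optimal f for [K] is at least 1 on an open set around [K], so it competes for every
    subset of that open set. If the capacity is infinite, the whole space serves. *)
Lemma affine_BV_capacity_outer_open K (eps : R) : 0 < eps ->
  exists O : set 'rV[R]_n, [/\ open O, K `<=` O &
    forall F : set 'rV[R]_n, F `<=` O ->
      (affine_BV_capacity F <= affine_BV_capacity K + eps%:E)%E].
Proof.
move=> eps0; have [Kfin|Koo] := boolP (affine_BV_capacity K < +oo)%E; last first.
  exists setT; split => //; [exact: openT|move=> F _].
  suff -> : affine_BV_capacity K = +oo%E by rewrite leey.
  by apply/eqP; rewrite eq_le leey/= leNgt.
have fK : affine_BV_capacity K \is a fin_num by rewrite ge0_fin_numE ?affine_BV_capacity_ge0.
have [y [f [BVf Kf] fy] fK'] := lb_ereal_inf_adherent eps0 fK.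
rewrite -{y}fy in fK'.
have [U [oU KU Uf]] := (set_nbhsP K _).1 Kf.
exists U; split => // F FU; rewrite (le_trans _ (ltW fK'))//.
apply: ereal_inf_lbound; exists f => //; split => // x /FU Ux.
by apply: filterS Uf _; exact: open_nbhs_nbhs.
Qed.

Lemma affine_BV_capacity_bigcap (K : (set 'rV[R]_n)^nat) : (forall j, compact (K j)) ->
  (forall j, K j.+1 `<=` K j) ->
  affine_BV_capacity (K j) @[j --> \oo] --> affine_BV_capacity (\bigcap_j K j).
Proof.
move=> cK dK.
have ndK i j : (i <= j)%N -> K j `<=` K i.
  by elim: j => [|j IH]; [rewrite leqn0 => /eqP ->|rewrite leq_eqVlt => /predU1P[->//|/IH KK x /dK/KK]].
have niC : nonincreasing_seq (fun j => affine_BV_capacity (K j)).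
  by move=> i j ij; apply: le_affine_BV_capacity; exact: ndK.
suff <- : ereal_inf (range (fun j => affine_BV_capacity (K j))) =
    affine_BV_capacity (\bigcap_j K j) by exact: ereal_nonincreasing_cvgn.
apply/eqP; rewrite eq_le; apply/andP; split; last first.
  apply: le_ereal_inf_tmp => _ [j _ <-]; apply: le_affine_BV_capacity.
  by move=> x; apply.
apply/lee_addgt0Pr => e e0.
have [U [oU KU HU]] := affine_BV_capacity_outer_open (\bigcap_j K j) e0.
have [j KjU] : exists j, K j `<=` U.
  apply: contrapT => /forallNP H.
  have cI : closed (~` U) by exact: open_closedC.
  have H' j : K j `\` U !=set0 by apply/set0P/eqP; rewrite setD_eq0; exact: H.
  (* If no [K j] were contained in [U], the nested sets K j minus [U] would generate a proper
     filter; a cluster point would lie in the intersection but outside [U]. *)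
  pose B : set_system 'rV[R]_n := filter_from setT (fun j => K j `\` U).
  have PB : ProperFilter B.
    apply: filter_from_proper => //; apply: filter_from_filter; first by exists 0%N.
    move=> i j _ _; exists (maxn i j) => // x [Kx Ox]; split; split => //.
      exact: ndK (leq_maxl i j) _ Kx.
    exact: ndK (leq_maxr i j) _ Kx.
  have [x [_ clx]] := cK 0%N B PB (ex_intro2 _ _ 0%N I (fun x (h : (K 0%N `\` U) x) => h.1)).
  have clKO j : closed (K j `\` U).
    by apply: closedI cI; apply: compact_closed => //; exact: norm_hausdorff.
  have xKO j : (K j `\` U) x.
    apply: (clKO j) => A nA.
    by apply: clx nA; exists j.
  by have [_] := xKO 0%N; apply; apply: KU => j _; have [] := xKO j.
by apply: le_trans (HU _ KjU); apply: ereal_inf_lbound; exists j.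
Qed.

End capacity_transformations.

(** * Capacity of the boundary *)

Section filling.
Context {R : realType}.

Lemma coord_le_norm n (x : 'rV[R]_n) i : `|x ord0 i| <= `|x|.
Proof.
apply/ler_addgt0Pl => e e0; have : ball 0 (e + `|x|) x.
  by rewrite mx_norm_ball /ball_/= sub0r normrN ltrDr.
by move=> [_ /(_ ord0 i)]; rewrite /ball/= mxE sub0r normrN => /ltW.
Qed.

Lemma compact_measurable_rV n (K : set 'rV[R]_n) : compact K -> measurable K.
Proof.
move=> cK; have clK : closed K by apply: compact_closed => //; exact: norm_hausdorff.
by rewrite -[K]setCK; apply: measurableC; apply: open_measurable_mx; exact: closed_openC.
Qed.

Lemma compact_lebesgue_rV_lty n (K : set 'rV[R]_n) : compact K ->
  (lebesgue_rV n K < +oo)%E.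
Proof.
move=> cK; have [M [_ HM]] := compact_bounded cK.
apply: le_lt_trans (lebesgue_rV_bounded n (M + 1)); apply: le_measure.
- by rewrite inE; exact: compact_measurable_rV.
- by rewrite inE; exact: measurable_box.
- move=> x Kx i; apply: le_trans (coord_le_norm x i) _.
  by apply: (HM (M + 1)) Kx; rewrite ltrDl.
Qed.

(** Connectedness of [0, 1]: on a segment that misses the boundary, the parameters of points of [K]
    coincide with those of interior points, so they form a nonempty open and closed set and reach
    1. *)
Lemma segment_meets_boundary n (K : set 'rV[R]_n) x v : closed K -> K x -> ~ K (x + v) ->
  exists2 s : R, 0 <= s <= 1 & boundary K (x + s *: v).
Proof.
move=> cK Kx nK; apply: contrapT => /forall2NP H.
pose p (s : R) : 'rV[R]_n := x + s *: v.
have cp : continuous p.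
  move=> s; apply: (@cvgD _ _ _ (nbhs s)); first exact: cvg_cst.
  by apply: (@cvgZr_tmp _ _ _ (nbhs s)); exact: cvg_id.
have := @segment_connected R 0 1 (`[0, 1]%classic `&` p @^-1` K).
have p0 : p 0 = x by rewrite /p scale0r addr0.
have p1 : p 1 = x + v by rewrite /p scale1r.
move=> C; have : (`[0, 1]%classic `&` p @^-1` K) 1; last by rewrite /= p1 => -[].
rewrite C; first by rewrite /= in_itv/= ler01 lexx.
- by exists 0; split => /=; [rewrite in_itv/= lexx ler01|rewrite p0].
- exists (p @^-1` K°).
    by apply: open_comp; [move=> s _; exact: cp|exact: open_interior].
  apply/seteqP; split => s [s01 ps]; split => //; last exact: interior_subset ps.
  have [|] := H s; first by move: s01; rewrite /= in_itv.
  move=> nb; apply: contrapT => ni; apply: nb; split => //.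
  exact: subset_closure.
- exists (p @^-1` K) => //.
  by apply: closed_comp => // s _; exact: cp.
Qed.

End filling.

Section boundary_capacity.
Context {R : realType}.
Variable n' : nat.
Local Notation n := n'.+1.
Local Notation lam := (@lebesgue_rV R n).

Lemma affine_BV_norm_le_of_diff (f g : 'rV[R]_n -> R) : BV_space f ->
  lam.-integrable setT (EFin \o g) ->
  (forall u : 'rV[R]_n, exists2 d : R, 0 < d & forall t x, 0 < t < d ->
    `|g (x + t *: u) - g x| <= `|f (x + t *: u) - f x|) ->
  BV_space g /\ (affine_BV_norm g <= affine_BV_norm f)%E.
Proof.
move=> BVf ig H; have BVg : BV_space g by apply: BV_of_diff_le BVf ig _ => i; exact: H.
split; first exact: BVg.
rewrite !affine_BV_normE; apply: le_gauge_norm.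
- by move=> u; exact: dir_var_ge0.
- exact: measurable_dir_var.
- exact: measurable_dir_var.
- move=> u _; have [d d0 Hd] := H u; have [if_ _] := BVf.
  apply: (dir_var_le BVg d0) => t t0d; have /andP[t0 _] := t0d.
  apply: le_trans (diff_quot_norm_le BVf u t0).
  apply: le_Rintegral => //.
  + exact: (integrable_norm (integrable_diff (t *: u) ig)).
  + exact: (integrable_norm (integrable_diff (t *: u) if_)).
  + by move=> x _; exact: Hd.
- by move=> u; exact: dir_var_ge0.
Qed.

Lemma maxr_dist_le (a b c : R) : `|Num.max a c - Num.max b c| <= `|a - b|.
Proof.
have h1 := ler_norm (a - b); have h2 := ler_norm (b - a); rewrite distrC in h2.
by rewrite ler_norml; case: (leP a c) => ac; case: (leP b c) => bc; lra.
Qed.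

Lemma affine_BV_capacity_boundary (K : set 'rV[R]_n) : compact K ->
  affine_BV_capacity K = affine_BV_capacity (boundary K).
Proof.
move=> cptK; have clK : closed K by apply: compact_closed => //; exact: norm_hausdorff.
have bK : boundary K `<=` K by move=> x [+ _]; exact: clK.
have cb : compact (boundary K).
  apply: (@subclosed_compact _ (boundary K) K) => //.
  by apply: closedI; [exact: closed_closure|apply: open_closedC; exact: open_interior].
apply/eqP; rewrite eq_le; apply/andP; split; last exact: le_affine_BV_capacity.
rewrite -[leRHS]mul1e; apply: affine_BV_capacity_le => // f BVf bf.
(* Compactness of the boundary yields one radius around all its points within which f >= 1. *)
have [del d0 Hd] : exists2 del, 0 < del &
    forall y z, boundary K y -> ball y del z -> 1 <= f z.
  have := (compact_near_coveringP _).1 cb R (0 : R)^'+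
    (fun del y => forall z, ball y del z -> 1 <= f z) _ _.
  case.
    move=> y /bf /nbhs_ballP[e /= e0 He].
    exists (ball y (e / 2), [set r | r < e / 2]).
      split; first by apply: nbhsx_ballx; rewrite divr_gt0.
      by apply: nbhs_right_lt; rewrite divr_gt0.
    move=> [y' r] /= [yy' re] z y'z; apply: He; rewrite (splitr e).
    by apply: ball_triangle yy' _; exact: (le_ball (ltW re)).
  move=> e /= e0 He; exists (e / 2); first by rewrite divr_gt0.
  have e20 : 0 < e / 2 by rewrite divr_gt0.
  move=> y z by_; apply: (He (e / 2) _ e20 y by_).
  by rewrite /ball_/= sub0r normrN gtr0_norm// ltr_pdivrMr// mulr_natr mulr2n ltrDl.
pose g x := Num.max (f x) (\1_K x).
have [if_ _] := BVf.
have mK := compact_measurable_rV cptK.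
have i1 : lam.-integrable setT (EFin \o (\1_K : _ -> R)).
  by apply: integrable_indic_lty => //; exact: compact_lebesgue_rV_lty.
have ig : lam.-integrable setT (EFin \o g).
  have := integrableD measurableT (integrable_norm if_) i1.
  apply: le_integrable => //.
    apply/measurable_EFinP; apply: measurable_maxr => //.
    by apply/measurable_EFinP; exact: measurable_int if_.
  move=> x _ /=; rewrite lee_fin /g.
  have i0 : 0 <= \1_K x :> R by [].
  rewrite [leRHS]ger0_norm ?addr_ge0//.
  have [_|_] := leP (f x) (\1_K x); first by rewrite ger0_norm// lerDr.
  by rewrite lerDl.
have [|BVg gf] := affine_BV_norm_le_of_diff BVf ig.
  (* For such [t] the segment is shorter than [del]; the summand 1 covers u = 0. *)
  move=> u; exists (del / (`|u| + 1)); first by rewrite divr_gt0// ltr_wpDl.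
  move=> t x /andP[t0 td]; rewrite /g.
  have tu : `|t *: u| < del.
    rewrite normrZ gtr0_norm//; move: td; rewrite ltr_pdivlMr ?ltr_wpDl//.
    by apply: le_lt_trans; rewrite ler_pM2l// lerDl.
  have cross y v : `|v| < del -> K y -> ~ K (y + v) -> 1 <= f y /\ 1 <= f (y + v).
    move=> vd Ky Kyv; have [s /andP[s0 s1] bs] := segment_meets_boundary clK Ky Kyv.
    split; apply: (Hd _ _ bs); rewrite mx_norm_ball /ball_/=.
      rewrite addrAC subrr add0r normrZ ger0_norm//.
      by apply: le_lt_trans vd; rewrite ler_piMl.
    rewrite opprD addrACA subrr add0r -[X in _ - X]scale1r -scalerBl normrZ.
    rewrite ler0_norm ?subr_le0// opprB; apply: le_lt_trans vd.
    by rewrite ler_piMl// lerBlDr lerDl.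
  have fE y : 1 <= f y -> Num.max (f y) (\1_K y) = f y.
    by move=> fy; apply/max_idPl; rewrite (le_trans _ fy)// indicE; case: (_ \in _).
  (* If both endpoints lie on the same side of [K], the maximum is taken with one constant and is
     nonexpansive. Otherwise [cross] gives f >= 1 at both endpoints, where g = f. *)
  have [Kx|Kx] := pselect (K x); have [Kt|Kt] := pselect (K (x + t *: u)).
  - by rewrite !indicE !mem_set// maxr_dist_le.
  - by have [f1 f2] := cross x (t *: u) tu Kx Kt; rewrite !fE.
  - have := cross (x + t *: u) (- (t *: u)); rewrite normrN addrK => cr.
    by have [f1 f2] := cr tu Kt Kx; rewrite !fE.
  - by rewrite !indicE !memNset// maxr_dist_le.
exists g; split => //; last by rewrite mul1e.
move=> x Kx; have [iKx|iKx] := pselect (K° x).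
  apply: filterS iKx => y Ky; rewrite /g /= indicE mem_set// le_max lexx orbT.
  by [].
have /bf : boundary K x by split => //; exact: subset_closure.
by apply: filterS => y /= fy; rewrite /g le_max fy.
Qed.

End boundary_capacity.

(** * The capacity of the ball *)

Section rotation.
Context {R : realType} {n : nat}.
Implicit Types u v w x : 'rV[R]_n.

Lemma edotE u v : edot u v = (u *m v^T) ord0 ord0.
Proof. by rewrite mxE; apply: eq_bigr => i _; rewrite mxE. Qed.

Lemma enorm_sqr u : enorm u ^+ 2 = edot u u.
Proof. by rewrite sqr_sqrtr// edot_ge0. Qed.

Lemma ler_enormD u v : enorm (u + v) <= enorm u + enorm v.
Proof.
rewrite -(@ler_pXn2r _ 2)// ?nnegrE ?addr_ge0 ?enorm_ge0// sqrrD !enorm_sqr.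
have := edot_le u v; rewrite edotDl !(edotC _ (u + v)) !edotDl (edotC v u) => h.
by lra.
Qed.

Lemma continuous_enorm : continuous (@enorm R n).
Proof.
move=> x; apply: (@continuous_comp _ _ _ (fun u => edot u u) (@Num.sqrt R) x).
  apply: (@cvg_big _ _ _ _ _ _ _ (nbhs x)) => [|i _]; first exact: add_continuous.
  by apply: (@cvgM _ _ (nbhs x)); exact: coord_continuous.
exact: sqrt_continuous.
Qed.

(** The Householder reflection along [v - u], which exchanges the two vectors. It reduces estimates
    in every direction to the first coordinate axis. *)
Lemma unit_vectors_reflection u v : enorm u = 1 -> enorm v = 1 ->
  exists B : 'M[R]_n, [/\ `|\det B| = 1, u *m B = v, v *m B = u &
    forall x, enorm (x *m B) = enorm x].
Proof.
move=> u1 v1; have [->|uv] := eqVneq u v.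
  by exists 1%:M; split; rewrite ?mulmx1 ?det1 ?normr1// => x; rewrite mulmx1.
pose w := v - u; have w0 : edot w w != 0.
  by rewrite -enorm_sqr expf_eq0/= enorm_eq0 subr_eq0 eq_sym.
have uu : edot u u = 1 by rewrite -enorm_sqr u1 expr1n.
have vv : edot v v = 1 by rewrite -enorm_sqr v1 expr1n.
have uw : edot u w = edot u v - 1.
  by rewrite edotC {1}/w edotDl -scaleN1r edotZl uu (edotC v u) mulN1r.
have vw : edot v w = 1 - edot u v.
  by rewrite edotC {1}/w edotDl -scaleN1r edotZl vv mulN1r.
have ww : edot w w = edot v w - edot u w.
  by rewrite {1}/w edotDl -scaleN1r edotZl mulN1r.
have E x : x *m (w^T *m w) = edot x w *: w.
  by rewrite mulmxA [x *m w^T]mx11_scalar -edotE mul_scalar_mx.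
pose B : 'M[R]_n := 1%:M - (2 / edot w w) *: (w^T *m w).
have xB x : x *m B = x - (2 * edot x w / edot w w) *: w.
  rewrite mulmxBr mulmx1 -scalemxAr E scalerA; congr (_ - _ *: _).
  by rewrite mulrAC.
have BT : B^T = B by rewrite linearB/= linearZ/= tr_scalar_mx trmx_mul trmxK.
have edotB x : edot (x *m B) w = - edot x w.
  by rewrite xB -scaleNr edotDl edotZl mulNr mulfVK// mulr_natl mulr2n opprD addNKr.
have BB : B *m B = 1%:M.
  apply/row_matrixP => i; rewrite row_mul row1 rowE xB edotB xB.
  by rewrite mulrN mulNr scaleNr opprK subrK.
exists B; split.
- have /(congr1 determinant) := BB; rewrite det_mulmx det1 => /(congr1 Num.norm).
  by rewrite normrM normr1 -expr2 => /eqP; rewrite sqrp_eq1// => /eqP.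
- rewrite xB (_ : _ / _ = -1); first by rewrite scaleN1r opprK /w addrC subrK.
  apply: (mulIf w0); rewrite divfK//.
  by rewrite ww uw vw; ring.
- rewrite xB (_ : _ / _ = 1); first by rewrite scale1r /w opprB addrC subrK.
  apply: (mulIf w0); rewrite divfK//.
  by rewrite ww uw vw; ring.
- by move=> x; rewrite /enorm !edotE trmx_mul BT mulmxA -(mulmxA x) BB mulmx1.
Qed.

End rotation.

Section slabs.
Context {R : realType}.
Variable n : nat.
Local Notation lam := (@lebesgue_rV R).
Local Notation tl x := (\row_(i < n) x ord0 (lift ord0 i)).

Definition cylinder (A : set R) (D : set 'rV[R]_n) : set 'rV[R]_n.+1 :=
  [set x | A (x ord0 ord0) /\ D (tl x)].

Lemma measurable_cylinder (A : set R) (D : set 'rV[R]_n) : measurable A -> measurable D ->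
  measurable (cylinder A D).
Proof.
move=> mA mD; apply: (@measurableI _ _ ((fun x : 'rV[R]_n.+1 => x ord0 ord0) @^-1` A)
  ((fun x : 'rV[R]_n.+1 => tl x) @^-1` D)).
  by rewrite -[X in measurable X]setTI; apply: measurable_coord.
rewrite -[X in measurable X]setTI.
have h : measurable_fun setT (fun x : 'rV[R]_n.+1 => tl x).
  apply: measurable_fun_mx => i j.
  rewrite (_ : (fun x => _) = fun x : 'rV[R]_n.+1 => x ord0 (lift ord0 j)).
    exact: measurable_coord.
  by apply/funext => x; rewrite mxE.
exact: h.
Qed.

Lemma lebesgue_rV_cylinder (A : set R) (D : set 'rV[R]_n) : measurable A -> measurable D ->
  lam n.+1 (cylinder A D) =
  (@lebesgue_measure R A * lam n D)%E.
Proof.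
move=> mA mD; rewrite -product_measure1E//= /lebesgue_cons /pushforward; congr (_ _).
have consS (p : measurableTypeR R * 'rV[R]_n) : tl (rV_cons p) = p.2.
  by apply/rowP => i; rewrite mxE rV_consS.
by apply/seteqP; split => -[a y]; rewrite /preimage /cylinder /= consS rV_cons0.
Qed.

Lemma enorm_sqr_cons (x : 'rV[R]_n.+1) : enorm x ^+ 2 = x ord0 ord0 ^+ 2 + enorm (tl x) ^+ 2.
Proof.
rewrite !enorm_sqr /edot big_ord_recl expr2; congr (_ + _).
by apply: eq_bigr => i _; rewrite mxE.
Qed.

End slabs.

(** * Difference integrals along the first axis, estimated by slabs *)

Section slab_estimates.
Context {R : realType}.
Variable m : nat.
Local Notation n := m.+1.
Local Notation lam := (@lebesgue_rV R).
Local Notation tl x := (\row_(i < m) x ord0 (lift ord0 i)).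
Local Notation e0 := (delta_mx ord0 ord0 : 'rV[R]_n).
Implicit Types (f psi : 'rV[R]_n -> R) (v : 'rV[R]_n).

Definition eball (r : R) : set 'rV[R]_m := [set y | enorm y <= r].

Lemma measurable_eball r : measurable (eball r).
Proof.
rewrite (_ : eball r = enorm @^-1` `]-oo, r]).
  by rewrite -[X in measurable X]setTI; apply: measurable_enorm.
by apply/seteqP; split => x /=; rewrite in_itv.
Qed.

Lemma lebesgue_eball_fin r : lam m (eball r) \is a fin_num.
Proof.
rewrite ge0_fin_numE//; apply: le_lt_trans (lebesgue_rV_bounded m r); apply: le_measure.
- by rewrite inE; exact: measurable_eball.
- by rewrite inE; exact: measurable_box.
- by move=> x xr i; exact: le_trans (coord_le_enorm x i) xr.
Qed.

(** Unlike in [diff_pairing], the weight is any bounded measurable function, so that a discontinuous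
    sign pattern can be inserted. *)
Lemma Rintegral_diff_weighted f psi v : (lam n).-integrable setT (EFin \o f) -> bmeas psi ->
  \int[lam n]_x ((f (x + v) - f x) * psi x) =
  \int[lam n]_x (f x * (psi (x - v) - psi x)).
Proof.
move=> if_ bpsi.
have bpsiv : bmeas (fun x : 'rV[R]_n => psi (x - v)).
  case: bpsi => mpsi [C HC]; split; last by exists C.
  exact: (measurableT_comp mpsi (measurable_add_rV (- v))).
pose F (x : 'rV[R]_n) := psi (x - v) * f x; pose G x := psi x * f x.
have iF : (lam n).-integrable setT (EFin \o F) by exact: (bmeas_integrableM bpsiv if_).
have iG : (lam n).-integrable setT (EFin \o G) by exact: (bmeas_integrableM bpsi if_).
transitivity (\int[lam n]_x F x - \int[lam n]_x G x).
  rewrite -(Rintegral_translate v iF) -RintegralB//; last exact: (integrable_translate v iF).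
  by apply: eq_Rintegral => x _; rewrite /F /G addrK mulrBl !(mulrC (psi x)).
rewrite -RintegralB//.
by apply: eq_Rintegral => x _; rewrite /F /G mulrBr !(mulrC (f x)).
Qed.

(** A sign pattern on the cylinder over [D]: 1 below the level [a], -1 from [a] on. *)
Definition slab_sign (D : set 'rV[R]_m) (a : R) (x : 'rV[R]_n) : R :=
  \1_(cylinder `]-oo, a[ D) x - \1_(cylinder `[a, +oo[ D) x.

Lemma bmeas_slab_sign D a : measurable D -> bmeas (slab_sign D a).
Proof.
by move=> mD; apply: bmeasB; apply: bmeas_indic; exact: measurable_cylinder.
Qed.

Lemma slab_signE D a x : slab_sign D a x =
  (\1_D (tl x)) * (if x ord0 ord0 < a then 1 else -1).
Proof.
rewrite /slab_sign !indicE; have [Dx|Dx] := pselect (D (tl x)).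
  rewrite [in RHS]mem_set// mul1r; case: ltP => xa.
    rewrite mem_set ?memNset ?subr0//= /cylinder/= in_itv/= ?andbT// => -[].
    by rewrite leNgt xa.
  rewrite memNset ?mem_set ?sub0r//= /cylinder/= in_itv/= ?andbT// => -[].
  by rewrite ltNge xa.
by rewrite [in RHS]memNset// mul0r !memNset ?subrr//= => -[].
Qed.

(** The shifted pattern differs from the original only between the levels [a] and [a + t], where it
    jumps from -1 to 1. *)
Lemma slab_pairing f D a (t : R) : (lam n).-integrable setT (EFin \o f) -> measurable D ->
  0 < t -> \int[lam n]_x ((f (x + t *: e0) - f x) * slab_sign D a x) =
  2 * \int[lam n]_x (\1_(cylinder `[a, a + t[ D) x * f x).
Proof.
move=> if_ mD t0; rewrite Rintegral_diff_weighted//; last exact: bmeas_slab_sign.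
have mc : measurable (cylinder `[a, a + t[ D) by exact: measurable_cylinder.
rewrite -RintegralZl//; last by apply: (bmeas_integrableM _ if_); exact: bmeas_indic.
apply: eq_Rintegral => x _; rewrite mulrA mulrC; congr (_ * _).
rewrite !slab_signE.
have -> : tl (x - t *: e0) = tl x.
  by apply/rowP => i; rewrite !mxE/= mulr0 subr0.
have -> : (x - t *: e0) ord0 ord0 = x ord0 ord0 - t by rewrite !mxE/= mulr1.
have -> : \1_(cylinder `[a, a + t[ D) x =
    \1_D (tl x) * ((a <= x ord0 ord0 < a + t)%R)%:R :> R.
  rewrite !indicE /cylinder; have [Dx|Dx] := pselect (D (tl x)).
    rewrite [in RHS]mem_set// mul1r; congr (_%:R); congr nat_of_bool.
    by apply/idP/idP; rewrite inE/= in_itv/=; [case|move=> h; split].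
  by rewrite [in RHS]memNset// mul0r memNset//= => -[].
rewrite mulrCA -mulrBr; congr (_ * _).
rewrite ltrBlDr; case: ltP => h1; case: ltP => h2 /=; rewrite ?andbF/= ?andbT.
- by rewrite mulr0 subrr.
- by rewrite mulr1 opprK.
- by move: h2; rewrite ltNge => /negP[]; rewrite (le_trans _ h1)// lerDl ltW.
- by rewrite mulr0 subrr.
Qed.

Let lebesgue_cylinder (a t r : R) : 0 < t ->
  lam n (cylinder `[a, a + t[ (eball r)) = (t%:E * lam m (eball r))%E.
Proof.
move=> t0; apply: etrans (lebesgue_rV_cylinder _ (measurable_eball r)) _ => //.
by rewrite lebesgue_measure_itv/= lte_fin ltrDl t0 -EFinD addrAC subrr add0r.
Qed.

Lemma Rintegral_cylinder (a t r : R) : 0 < t ->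
  \int[lam n]_x (\1_(cylinder `[a, a + t[ (eball r)) x : R) = t * fine (lam m (eball r)).
Proof.
move=> t0; rewrite /Rintegral integral_indic ?setIT//; last first.
  by apply: measurable_cylinder => //; exact: measurable_eball.
apply: etrans (congr1 fine (lebesgue_cylinder a r t0)) _.
by rewrite fineM// lebesgue_eball_fin.
Qed.

Lemma integrable_cylinder (a t r : R) : 0 < t ->
  (lam n).-integrable setT (EFin \o (\1_(cylinder `[a, a + t[ (eball r)) : _ -> R)).
Proof.
move=> t0; apply: integrable_indic_lty.
  by apply: measurable_cylinder => //; exact: measurable_eball.
have E := lebesgue_cylinder a r t0; suff : (t%:E * lam m (eball r) < +oo)%E by rewrite -E.
by rewrite ltey_eq fin_numM ?orbT// lebesgue_eball_fin.
Qed.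

(* For psi = slab_sign and t small, the shift by t moves the half cylinders apart
   by a slab lying inside the unit ball, where f >= 1. *)
Lemma dir_var_e0_ge f r : BV_space f -> (forall x, enorm x <= 1 -> 1 <= f x) ->
  0 < r < 1 -> 2 * fine (lam m (eball r)) <= dir_var f e0.
Proof.
move=> BVf f1 /andP[r0 r1]; have [if_ _] := BVf.
(* With this thickness the slab over [eball r] lies in the unit ball: the first coordinate
   contributes at most t to the squared norm, the tail at most r^2 <= r, and t + r = 1. *)
pose t := 1 - r; have t0 : 0 < t by rewrite subr_gt0.
rewrite -(ler_pM2l t0) (le_trans _ (diff_quot_norm_le BVf e0 t0))// mulrCA.
rewrite -(Rintegral_cylinder 0)//.
have mc : measurable (cylinder `[0, 0 + t[ (eball r)).
  by apply: measurable_cylinder => //; exact: measurable_eball.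
apply: (@le_trans _ _ (2 * \int[lam n]_x (\1_(cylinder `[0, 0 + t[ (eball r)) x * f x))).
  rewrite ler_pM2l//; apply: le_Rintegral => //; first exact: integrable_cylinder.
    apply: (bmeas_integrableM _ if_); exact: bmeas_indic.
  move=> x _; rewrite indicE; have [/set_mem[/= xt xr]|] := boolP (x \in _); last by rewrite mul0r.
  rewrite mul1r; apply: f1; rewrite -(@ler_pXn2r _ 2)// ?nnegrE ?enorm_ge0// expr1n.
  rewrite enorm_sqr_cons; move: xt; rewrite in_itv/= add0r => /andP[x0 xt].
  have h1 : x ord0 ord0 ^+ 2 <= t * x ord0 ord0 by rewrite expr2 ler_wpM2r// ltW.
  have h2 : enorm (tl x) ^+ 2 <= r ^+ 2 by rewrite ler_pXn2r ?nnegrE ?enorm_ge0 ?(ltW r0).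
  have h3 : t * x ord0 ord0 <= t * 1 by rewrite ler_pM2l//; rewrite (le_trans (ltW xt))// /t gerBl ltW.
  have h4 : r ^+ 2 <= r by rewrite expr2 ger_pMr// ltW.
  by rewrite /t in h1 h3 *; lra.
rewrite -slab_pairing//; last exact: measurable_eball.
have bs : bmeas (slab_sign (eball r) 0) by apply: bmeas_slab_sign; exact: measurable_eball.
have ifd := integrable_diff (t *: e0) if_.
have ip : (lam n).-integrable setT
    (EFin \o (fun x => (f (x + t *: e0) - f x) * slab_sign (eball r) 0 x)).
  have := bmeas_integrableM bs ifd.
  by congr (_.-integrable _ _); apply/funext => x /=; rewrite mulrC.
apply: le_Rintegral => //; first exact: (integrable_norm ifd).
move=> x _; rewrite (le_trans (ler_norm _))// normrM ler_piMr// slab_signE normrM.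
rewrite mulr_ile1//; first by rewrite indicE; case: (_ \in _); rewrite ?normr1 ?normr0.
by case: ifP => _; rewrite ?normrN normr1.
Qed.

(** For a radially decreasing function, the difference along the first axis changes sign at the
    hyperplane where x and x + t e0 have equal norm, so its absolute value is exactly a pairing with
    a [slab_sign]. *)
Lemma diff_quot_norm_e0_le f (b t : R) : (lam n).-integrable setT (EFin \o f) ->
  (forall x y, enorm x <= enorm y -> f y <= f x) -> (forall x, 0 <= f x <= 1) ->
  (forall x, b < enorm x -> f x = 0) -> 0 < t ->
  diff_quot_norm f e0 t <= t * (2 * fine (lam m (eball b))).
Proof.
move=> if_ df f01 fb t0; rewrite /diff_quot_norm.
rewrite (_ : \int[lam n]_x _ =
    \int[lam n]_x ((f (x + t *: e0) - f x) * slab_sign setT (- (t / 2)) x)); last first.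
  apply: eq_Rintegral => x _; rewrite slab_signE indicT mul1r.
  (* The norms agree where the first coordinate is -t/2, whence the level of the pattern. *)
  have E : enorm (x + t *: e0) ^+ 2 = enorm x ^+ 2 + t * (2 * x ord0 ord0 + t).
    rewrite !enorm_sqr_cons.
    have -> : tl (x + t *: e0) = tl x by apply/rowP => i; rewrite !mxE/= mulr0 addr0.
    by rewrite !mxE/=; ring.
  have le2 (u v : 'rV[R]_n) : (enorm u <= enorm v) = (enorm u ^+ 2 <= enorm v ^+ 2).
    by rewrite ler_pXn2r ?nnegrE ?enorm_ge0.
  case: ltP => xt.
    rewrite mulr1 ger0_norm// subr_ge0; apply: df.
    by rewrite le2 E gerDl pmulr_rle0//; lra.
  rewrite mulrN1 ler0_norm// subr_le0; apply: df.
  by rewrite le2 E lerDl pmulr_rge0//; lra.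
rewrite slab_pairing// mulrCA ler_pM2l// -(Rintegral_cylinder (- (t / 2)) b t0).
have mc : measurable (cylinder `[(- (t / 2)), (- (t / 2)) + t[ (setT : set 'rV[R]_m)).
  by apply: measurable_cylinder => //; exact: measurableT.
apply: le_Rintegral => //; last 2 first.
- exact: integrable_cylinder.
- move=> x _; rewrite !indicE; have /andP[f0 f1] := f01 x.
  have [/set_mem[/= xt _]|] := boolP (x \in cylinder _ setT); last by rewrite mul0r.
  rewrite mul1r; have [xb|xb] := leP (enorm x) b; last by rewrite fb.
  rewrite mem_set//; split => //=; rewrite /eball/=; apply: le_trans xb.
  by rewrite -(@ler_pXn2r _ 2)// ?nnegrE ?enorm_ge0// [leRHS]enorm_sqr_cons lerDr sqr_ge0.
- by apply: bmeas_integrableM if_; exact: bmeas_indic.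
Qed.

End slab_estimates.

Section ball_capacity.
Context {R : realType}.

Lemma lebesgue_eball k (r : R) : 0 < r ->
  fine (lebesgue_rV k.+1 (eball r)) = r ^+ k.+1 * fine (ball_volume R k.+1).
Proof.
move=> r0; rewrite (_ : eball r = [set x | unit_ball (r^-1 *: x)]); last first.
  apply/seteqP; split => x;
    by rewrite /eball /unit_ball/= enormZ gtr0_norm ?invr_gt0// ler_pdivrMl// mulr1.
rewrite lebesgue_rV_scale//; last exact: measurable_unit_ball.
by rewrite fineM// ge0_fin_numE// ball_volume_lty.
Qed.

Variable k : nat.
Local Notation m := k.+1.
Local Notation n := m.+1.
Local Notation lam := (@lebesgue_rV R n).
Local Notation e0 := (delta_mx ord0 ord0 : 'rV[R]_n).
Local Notation w := (fine (ball_volume R m)).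
Implicit Types (f : 'rV[R]_n -> R) (b r : R) (x u : 'rV[R]_n).

Let w_gt0 : 0 < w.
Proof. by rewrite fine_gt0// ball_volume_gt0 ball_volume_lty. Qed.

Let wE : (2%:E * ball_volume R m)%E = (2 * w)%:E.
Proof. by rewrite EFinM fineK// ge0_fin_numE ?ball_volume_lty// ltW ?ball_volume_gt0. Qed.

Let enorm_e0 : enorm e0 = 1.
Proof.
rewrite /enorm /edot big_ord_recl mxE/= mulr1 big1 ?addr0 ?sqrtr1// => i _.
by rewrite mxE/= mul0r.
Qed.

Lemma gauge_norm_cst (c : R) : 0 < c -> gauge_norm (fun _ : 'rV[R]_n => c) = c%:E.
Proof.
move=> c0; have := @gauge_normZ R m c (fun=> 1) c0 (fun=> ler01) (measurable_cst _).
by rewrite gauge_norm1 mule1 mulr1.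
Qed.

(** A reflection preserves the ball and carries the first axis to any direction, so the variation
    has the same lower bound in all directions and the gauge is compared with a constant. *)
Lemma affine_BV_capacity_ball_ge r : 0 < r < 1 ->
  ((2 * (r ^+ m * w))%:E <= affine_BV_capacity (@unit_ball R n))%E.
Proof.
move=> r01; have /andP[r0 r1] := r01.
have c0 : 0 < 2 * (r ^+ m * w) by rewrite !mulr_gt0// exprn_gt0.
apply: le_ereal_inf_tmp => _ [f [BVf f1] <-].
rewrite affine_BV_normE -(gauge_norm_cst c0); apply: le_gauge_norm.
- by move=> u; rewrite ltW.
- exact: measurable_cst.
- exact: measurable_dir_var.
- move=> u u1; have [B [dB eB _ nB]] := unit_vectors_reflection enorm_e0 u1.
  have uB : B \in unitmx by rewrite unitmxE unitfE -normr_eq0 dB oner_eq0.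
  have := dir_var_affine_le 0 BVf uB e0; rewrite dB invr1 mul1r eB; apply: le_trans.
  rewrite -lebesgue_eball//; apply: dir_var_e0_ge => //; first exact: BV_affine.
  move=> x x1; have : unit_ball (x *m B + 0) by rewrite addr0 /unit_ball/= nB.
  by move=> /f1 /nbhs_singleton.
- by move=> u; exact: dir_var_ge0.
Qed.

Section plateau.
Variable b : R.
Hypothesis b1 : 1 < b.
Let eps := (b - 1) / 2.
Let eps0 : 0 < eps. Proof. by rewrite divr_gt0// subr_gt0. Qed.

(** As [eps] is half of b - 1, the value 1 is kept up to the radius (1 + b)/2 > 1, hence on a
    neighbourhood of the closed unit ball. *)
Definition plateau x : R := Num.min 1 (Num.max 0 ((b - enorm x) / eps)).

Lemma plateau01 x : 0 <= plateau x <= 1.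
Proof. by rewrite /plateau le_min ler01 le_max lexx ge_min lexx. Qed.

Lemma plateau_antitone x u : enorm x <= enorm u -> plateau u <= plateau x.
Proof.
move=> xu; have h : (b - enorm u) / eps <= (b - enorm x) / eps.
  by rewrite ler_pM2r ?invr_gt0// lerD2l lerN2.
rewrite /plateau; move: h; set p := _ / eps; set q := _ / eps => h.
by case: (leP 0 p) => ?; case: (leP 0 q) => ?; case: (leP 1 p) => ?; case: (leP 1 q) => ?;
  rewrite ?(min_r (@ler01 R)); lra.
Qed.

Lemma plateau_eq0 x : b < enorm x -> plateau x = 0.
Proof.
move=> bx; rewrite /plateau max_l ?min_r ?ler01//.
by rewrite pmulr_lle0 ?invr_gt0// subr_le0 ltW.
Qed.

Lemma plateau_eq1 x : enorm x <= (1 + b) / 2 -> 1 <= plateau x.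
Proof.
move=> xb; rewrite /plateau le_min lexx le_max/= ler_pdivlMr// mul1r; apply/orP; right.
by rewrite /eps; lra.
Qed.

Lemma plateau_lipschitz x u : `|plateau (x + u) - plateau x| <= eps^-1 * enorm u.
Proof.
have h1 := ler_enormD x u; have h2 := ler_enormD (x + u) (- u).
rewrite addrK -scaleN1r enormZ normrN1 mul1r in h2.
have ie0 : 0 < eps^-1 by rewrite invr_gt0.
have h3 : (b - enorm x) / eps - (b - enorm (x + u)) / eps <= eps^-1 * enorm u.
  by rewrite -mulrBl mulrC ler_pM2l//; lra.
have h4 : (b - enorm (x + u)) / eps - (b - enorm x) / eps <= eps^-1 * enorm u.
  by rewrite -mulrBl mulrC ler_pM2l//; lra.
have h5 : 0 <= eps^-1 * enorm u by rewrite mulr_ge0 ?enorm_ge0// ltW.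
rewrite /plateau ler_norml; move: h3 h4 h5.
set p := (b - enorm x) / eps; set q := _ / eps; set d := _ * enorm u => *.
by case: (leP 0 p) => ?; case: (leP 0 q) => ?; case: (leP 1 p) => ?; case: (leP 1 q) => ?;
  rewrite ?(min_r (@ler01 R)); lra.
Qed.

Let integrable_eball (r : R) :
  lam.-integrable setT (EFin \o (\1_(eball r : set 'rV[R]_n) : _ -> R)).
Proof.
apply: integrable_indic_lty; first exact: measurable_eball.
have := @lebesgue_eball_fin R n r; rewrite ge0_fin_numE//; exact: measurable_eball.
Qed.

Lemma integrable_plateau : lam.-integrable setT (EFin \o plateau).
Proof.
apply: le_integrable (integrable_eball b) => //.
  apply/measurable_EFinP; apply: measurable_minr => //; apply: measurable_maxr => //.
  apply: measurable_funM => //; apply: measurable_funB => //; exact: measurable_enorm.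
move=> x _ /=; rewrite lee_fin indicE; have /andP[p0 p1] := plateau01 x.
rewrite ger0_norm//; have [xb|xb] := leP (enorm x) b; last by rewrite plateau_eq0.
by rewrite mem_set// normr1.
Qed.

Lemma BV_plateau : BV_space plateau.
Proof.
(* Shifts have length below 1, so a point beyond radius [b + 1] still has both values equal to 0. *)
pose wt x := eps^-1 * \1_(eball (b + 1) : set 'rV[R]_n) x.
apply: (@BV_of_lipschitz R n plateau wt).
- exact: integrable_plateau.
- by move=> x; rewrite mulr_ge0// invr_ge0 ltW.
- exact: (integrableZl measurableT eps^-1 (integrable_eball (b + 1))).
move=> i t x /andP[t0 t1]; rewrite /wt indicE.
have et : enorm (t *: delta_mx ord0 i : 'rV[R]_n) = t.
  rewrite enormZ gtr0_norm// /enorm /edot (bigD1 i)//= mxE !eqxx mulr1 big1 ?addr0.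
    by rewrite sqrtr1 mulr1.
  by move=> j ji; rewrite mxE (negbTE ji) andbF mul0r.
have [xb|xb] := leP (enorm x) (b + 1).
  by rewrite mem_set// mulr1 mulrC (le_trans (plateau_lipschitz x _))// et mulrC.
have h := ler_enormD (x + t *: delta_mx ord0 i) (- (t *: delta_mx ord0 i)).
rewrite addrK -[- (t *: _)]scaleN1r enormZ normrN1 mul1r et in h.
rewrite (plateau_eq0 (x := x)); last by lra.
rewrite plateau_eq0; last by lra.
by rewrite subrr normr0 mulr_ge0// ?(ltW t0)// mulr_ge0// invr_ge0 ltW.
Qed.

Lemma affine_BV_capacity_ball_le :
  (affine_BV_capacity (@unit_ball R n) <= (2 * (b ^+ m * w))%:E)%E.
Proof.
have b0 : 0 < b by rewrite (lt_trans _ b1).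
have c0 : 0 < 2 * (b ^+ m * w) by rewrite !mulr_gt0// exprn_gt0.
have BVp := BV_plateau.
apply: (@le_trans _ _ (affine_BV_norm plateau)).
  apply: ereal_inf_lbound; exists plateau => //; split; first exact: BVp.
  move=> x x1; have : \forall y \near x, enorm y < (1 + b) / 2.
    have h : 1 < (1 + b) / 2 by rewrite ltr_pdivlMr// mul1r ltrD2l.
    by apply: (cvgr_lt _ (@continuous_enorm R n x)); exact: le_lt_trans x1 h.
  by apply: filterS => y /ltW /plateau_eq1.
rewrite affine_BV_normE -(gauge_norm_cst c0); apply: le_gauge_norm.
- by move=> u; exact: dir_var_ge0.
- exact: measurable_dir_var.
- exact: measurable_cst.
- move=> u u1; have [B [dB _ uB nB]] := unit_vectors_reflection enorm_e0 u1.
  have iB : B \in unitmx by rewrite unitmxE unitfE -normr_eq0 dB oner_eq0.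
  have := dir_var_affine_le 0 BVp iB u; rewrite dB invr1 mul1r uB.
  (* The plateau depends on [enorm] only, which the reflection preserves. *)
  rewrite (_ : (fun x => _) = plateau); last first.
    by apply/funext => x; rewrite /plateau addr0 nB.
  move=> h; apply: le_trans h _; rewrite -lebesgue_eball//.
  apply: (dir_var_le BVp ltr01) => t /andP[t0 _]; apply: diff_quot_norm_e0_le => //.
  + exact: integrable_plateau.
  + exact: plateau_antitone.
  + exact: plateau01.
  + exact: plateau_eq0.
- by move=> u; rewrite ltW.
Qed.

End plateau.

Theorem affine_BV_capacity_ball :
  affine_BV_capacity (@unit_ball R n) = (2%:E * ball_volume R m)%E.
Proof.
rewrite wE; have C0 := @affine_BV_capacity_ge0 R m (@unit_ball R n).
have Cle := affine_BV_capacity_ball_le; have Cge := affine_BV_capacity_ball_ge.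
have Cfin : affine_BV_capacity (@unit_ball R n) \is a fin_num.
  rewrite ge0_fin_numE//; apply: le_lt_trans (Cle 2 _) _; first by rewrite ltr1n.
  exact: ltry.
rewrite -(fineK Cfin) in Cle Cge *; congr _%:E.
set c := fine _ in Cle Cge *.
(* The shift to j + 2 keeps 1 - 1/(j + 2) strictly between 0 and 1; in [lim], s = 1 serves the upper
   bound and s = -1 the lower one. *)
have cvh : (fun j : nat => (j.+2%:R^-1 : R)) @ \oo --> (0 : R).
  by have := @cvg_harmonic R; rewrite -cvg_shiftS; exact.
have j0 (j : nat) : 0 < (j.+2%:R^-1 : R) by rewrite invr_gt0.
have j1 (j : nat) : (j.+2%:R^-1 : R) < 1 by rewrite invf_lt1// ltr1n.
have lim (s : R) : (fun j : nat => 2 * ((1 + s * j.+2%:R^-1) ^+ m * w)) @ \oo --> 2 * w.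
  have -> : 2 * w = 2 * ((1 + s * 0) ^+ m * w) by rewrite mulr0 addr0 expr1n mul1r.
  apply: cvgM; first exact: cvg_cst.
  apply: cvgM; last exact: cvg_cst.
  apply: (@continuous_cvg _ _ _ _ _ _ (fun y : R => y ^+ m)); first exact: exprn_continuous.
  apply: cvgD; first exact: cvg_cst.
  by apply: cvgM; [exact: cvg_cst|exact: cvh].
apply/le_anti/andP; split.
  apply: (cvgr_to_ge (lim 1)); apply: nearW => j.
  by rewrite -lee_fin; apply: Cle; rewrite mul1r ltrDl.
apply: (cvgr_to_le (lim (-1))); apply: nearW => j.
by rewrite -lee_fin; apply: Cge; rewrite mulN1r subr_gt0 j1/= gtrBl j0.
Qed.

(* The linear map expanding the last coordinate by s ^+ n fixes the disc, and it is
   s times a unimodular map. *)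
Theorem affine_BV_capacity_disc :
  affine_BV_capacity (@unit_ball R n `&`
    [set x | forall i : 'I_n, i = m :> nat -> x ord0 i = 0]) = 0%E.
Proof.
set D := _ `&` _; have D0 := @affine_BV_capacity_ge0 R m D.
have H (s : R) : 0 < s -> (affine_BV_capacity D <= (s^-1 ^+ m * (2 * w))%:E)%E.
  move=> s0; pose A : 'M[R]_n := diag_mx (\row_j if j == ord_max then s ^+ m else s^-1).
  have dA : \det A = 1.
    rewrite det_diag big_ord_recr/= mxE eqxx (eq_bigr (fun=> s^-1)).
      by rewrite prodr_const card_ord -exprMn mulVf ?expr1n// gt_eqF.
    by move=> i _; rewrite mxE -val_eqE/= ltn_eqF.
  have := @affine_BV_capacity_affine R m (@unit_ball R n) D A s 0.
  rewrite dA normr1 affine_BV_capacity_ball => /(_ erefl s0).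
  rewrite wE -EFinM; apply => x [x1 xm].
  suff -> : x *m (s *: A) + 0 = x by [].
  rewrite addr0 -scalemxAr; apply/rowP => j.
  rewrite mxE mul_mx_diag !mxE; case: eqP => [->|_].
    by rewrite (xm ord_max)// mul0r mulr0.
  by rewrite mulrCA mulfV ?mulr1// gt_eqF.
have Dfin : affine_BV_capacity D \is a fin_num.
  by rewrite ge0_fin_numE//; apply: le_lt_trans (H 1 ltr01) (ltry _).
rewrite -(fineK Dfin) in D0 H *; congr _%:E; set d := fine _ in D0 H *.
apply/le_anti/andP; split => //.
have lim : (fun j : nat => (j.+1%:R^-1 : R) * (2 * w)) @ \oo --> 0 * (2 * w).
  by apply: cvgM; [exact: cvg_harmonic|exact: cvg_cst].
rewrite mul0r in lim; apply: (cvgr_to_ge lim); apply: nearW => j.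
have := H j.+1%:R (ltr0Sn _ _); rewrite lee_fin => /le_trans; apply.
(* With s = j + 1 >= 1 and exponent m >= 1, the factor s^-m is at most 1/(j + 1). *)
rewrite ler_pM2r ?mulr_gt0// exprS ler_piMr// ?invr_ge0//.
by rewrite exprn_ile1// ?invr_ge0// invf_le1// ler1n.
Qed.

End ball_capacity.

Theorem theorem3 (R : realType) (n : nat) (n_ge2 : (2 <= n)%N) :
  (* (i) *)
  (forall K : set 'rV[R]_n, compact K ->
    affine_BV_capacity K = affine_BV_capacity (boundary K)) /\
  (* (ii) *)
  (forall (K : set 'rV[R]_n) (x0 : 'rV[R]_n) (r : R), compact K -> 0 < r ->
    affine_BV_capacity [set x0 + r *: x | x in K] =
    ((r ^+ n.-1)%:E * affine_BV_capacity K)%E) /\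
  (* (iii) *)
  (forall (K : set 'rV[R]_n) (Phi : 'M[R]_n) (x : 'rV[R]_n),
    compact K -> \det Phi = 1 ->
    affine_BV_capacity K = affine_BV_capacity [set y *m Phi^T + x | y in K]) /\
  (* (iv) *)
  (forall K1 K2 : set 'rV[R]_n, compact K1 -> compact K2 -> K1 `<=` K2 ->
    (affine_BV_capacity K1 <= affine_BV_capacity K2)%E) /\
  (* (v) *)
  (forall K : (set 'rV[R]_n)^nat, (forall j, compact (K j)) ->
    (forall j, K j.+1 `<=` K j) ->
    affine_BV_capacity (K j) @[j --> \oo] -->
      affine_BV_capacity (\bigcap_j K j)) /\
  (* (vi) *)
  (forall (K : set 'rV[R]_n) (eps : R), compact K -> 0 < eps ->
    exists O : set 'rV[R]_n, [/\ open O, K `<=` O &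
      forall F : set 'rV[R]_n, compact F -> F `<=` O -> K `<=` F ->
        (affine_BV_capacity F <= affine_BV_capacity K + eps%:E)%E]) /\
  (* (vii) *)
  (exists E F : set 'rV[R]_2, [/\ compact E, compact F &
    (affine_BV_capacity E + affine_BV_capacity F <=
     affine_BV_capacity (E `|` F))%E]) /\
  (* (viii) *)
  (affine_BV_capacity (@unit_ball R n) = (2%:E * ball_volume R n.-1)%E /\
   affine_BV_capacity (@unit_ball R n `&`
     [set x | forall i : 'I_n, i = n.-1 :> nat -> x ord0 i = 0]) = 0%E).

Proof.
case: n n_ge2 => [|[|k]]// _; split; first exact: affine_BV_capacity_boundary.
split; first by move=> K x0 r _; exact: affine_BV_capacityZ.
split; first by move=> K Phi x _; exact: affine_BV_capacity_SL.
split; first by move=> K1 K2 _ _; exact: le_affine_BV_capacity.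
split; first exact: affine_BV_capacity_bigcap.
split.
  move=> K eps _ /(affine_BV_capacity_outer_open K)[U [oU KU H]].
  by exists U; split => // F _ FU _; exact: H.
split; last by split; [exact: affine_BV_capacity_ball|exact: affine_BV_capacity_disc].
exists set0, set0; split; [exact: compact0|exact: compact0|].
by rewrite setU0; exact: affine_BV_capacity_set0.
Qed.
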